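(* Let $Q$ be a Dynkin or Euclidean quiver and $A=kQ$ its path algebra over an algebraically closed field $k$. Then each connected component of the tilting quiver $\overrightarrow{Q}(\mathrm{tilt}\,A)$ contains only finitely many non-saturated vertices.
   Context: Let $n$ be the number of vertices of $Q$ (a connected acyclic quiver whose underlying graph is of Dynkin type $A,D,E$ or of extended Dynkin/Euclidean type). A tilting module $T$ satisfies $\mathrm{pd}_AT\le1$, $\mathrm{Ext}^1_A(T,T)=0$ and there is an exact sequence $0\to A\to T_1\to T_2\to0$ with $T_1,T_2$ direct summands of finite direct sums of copies of $T$. The tilting quiver $\overrightarrow{Q}(\mathrm{tilt}\,A)$ has as vertices the isomorphism classes of basic tilting $A$-modules and an arrow $T_1\to T_2$ whenever $T_1=M\oplus X$, $T_2=M\oplus Y$ with $X,Y$ indecomposable and there is a short exact sequence $0\to X\to M'\to Y\to0$ with $M'$ a direct summand of a finite direct sum of copies of $M$. With $s(T)$ (resp. $e(T)$) the number of arrows starting (resp. ending) at $T$, a vertex $T$ is saturated if $s(T)+e(T)=n$ and non-saturated otherwise. *)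

(* Defs.v *)
(* Finite-dimensional modules over the path algebra kQ are
   represented, as usual, by finite-dimensional representations of Q
   (right kQ-modules in the convention of Assem-Simson-Skowronski).
   Linear maps act on ROW vectors: a map V -> W is a matrix 'M_(dim V, dim W). *)
From HB Require Import structures.
From mathcomp Require Import all_boot all_order all_algebra.
From Stdlib Require Import Relation_Operators.
Import GRing.Theory.
Local Open Scope ring_scope.

Record quiver := Quiver {
  qn : nat;
  qm : nat;
  qs : 'I_qm -> 'I_qn;
  qt : 'I_qm -> 'I_qn
}.

Fixpoint is_pathn (Q : quiver) (i : nat) (p : seq 'I_(qm Q)) (j : nat) : bool :=
  match p with
  | [::] => i == j
  | a :: p' => (val (qs Q a) == i) && is_pathn Q (val (qt Q a)) p' j
  end.

Definition acyclic (Q : quiver) : Prop :=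
  forall (i : 'I_(qn Q)) (p : seq 'I_(qm Q)), p != [::] -> ~~ is_pathn Q (val i) p (val i).

Definition qadj (Q : quiver) (i j : 'I_(qn Q)) : nat :=
  count (fun a : 'I_(qm Q) => ((qs Q a == i) && (qt Q a == j)) || ((qs Q a == j) && (qt Q a == i)))
        (enum 'I_(qm Q)).

Definition connected_quiver (Q : quiver) : Prop :=
  (0 < qn Q)%N /\
  forall i j : 'I_(qn Q), connect (fun x y => (0 < qadj Q x y)%N) i j.

Definition emult (E : seq (nat * nat)) (x y : nat) : nat :=
  count (fun e => (e == (x, y)) || (e == (y, x))) E.

Definition path_edges (k : nat) : seq (nat * nat) := [seq (i, i.+1) | i <- iota 0 k.-1].

Definition has_graph (Q : quiver) (k : nat) (E : seq (nat * nat)) : Prop :=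
  qn Q = k /\
  exists sigma : 'I_(qn Q) -> 'I_(qn Q), bijective sigma /\
    forall i j, qadj Q i j = emult E (val (sigma i)) (val (sigma j)).

Definition A_edges (k : nat) := path_edges k.
Definition D_edges (k : nat) := path_edges k.-1 ++ [:: (k - 3, k - 1)]%N.
Definition E_edges (k : nat) := path_edges k.-1 ++ [:: (2, k - 1)]%N.
(* Euclidean graphs: tilde A_k, tilde D_k have k+1 vertices *)
Definition At_edges (k : nat) := [seq (i, (i.+1 %% k.+1)%N) | i <- iota 0 k.+1].
Definition Dt_edges (k : nat) := path_edges k.-1 ++ [:: (1, k - 1); (k - 3, k)]%N.
Definition E6t_edges := path_edges 5 ++ [:: (2, 5); (5, 6)]%N.
Definition E7t_edges := path_edges 7 ++ [:: (3, 7)]%N.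
Definition E8t_edges := path_edges 8 ++ [:: (2, 8)]%N.

Definition dynkin (Q : quiver) : Prop :=
  exists k : nat,
    ((1 <= k)%N /\ has_graph Q k (A_edges k)) \/
    ((4 <= k)%N /\ has_graph Q k (D_edges k)) \/
    ((k \in [:: 6; 7; 8]%N) /\ has_graph Q k (E_edges k)).

Definition euclidean (Q : quiver) : Prop :=
  (exists k : nat, (1 <= k)%N /\ has_graph Q k.+1 (At_edges k)) \/
  (exists k : nat, (4 <= k)%N /\ has_graph Q k.+1 (Dt_edges k)) \/
  has_graph Q 7 E6t_edges \/ has_graph Q 8 E7t_edges \/ has_graph Q 9 E8t_edges.

Set Implicit Arguments. Unset Strict Implicit. Unset Printing Implicit Defensive.
Section Reps.
Variables (K : fieldType) (Q : quiver).

Record rep := Rep {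
  rdim : 'I_(qn Q) -> nat;
  rmap : forall a : 'I_(qm Q), 'M[K]_(rdim (qs Q a), rdim (qt Q a))
}.

Definition hom (M N : rep) := forall i : 'I_(qn Q), 'M[K]_(rdim M i, rdim N i).

Definition is_hom (M N : rep) (f : hom M N) : Prop :=
  forall a : 'I_(qm Q), rmap M a *m f (qt Q a) = f (qs Q a) *m rmap N a.

Definition iso (M N : rep) : Prop :=
  exists (f : hom M N) (g : hom N M), is_hom f /\ is_hom g /\
    (forall i, f i *m g i = 1%:M) /\ (forall i, g i *m f i = 1%:M).

Definition zero_rep : rep := @Rep (fun _ => 0%N) (fun a => 0).

Definition dsum (M N : rep) : rep :=
  @Rep (fun i => (rdim M i + rdim N i)%N)
       (fun a => block_mx (rmap M a) 0 0 (rmap N a)).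

Definition dsum_list (L : seq rep) : rep := foldr dsum zero_rep L.

Definition copies (T : rep) (k : nat) : rep := iter k (dsum T) zero_rep.

Definition in_add (T X : rep) : Prop :=
  exists (k : nat) (Z : rep), iso (copies T k) (dsum X Z).

Definition nonzero (X : rep) : Prop := exists i, (0 < rdim X i)%N.

Definition indecomposable (X : rep) : Prop :=
  nonzero X /\ forall Y Z, iso X (dsum Y Z) -> ~ nonzero Y \/ ~ nonzero Z.

Definition ses (X E Y : rep) (f : hom X E) (g : hom E Y) : Prop :=
  is_hom f /\ is_hom g /\
  forall i, [/\ row_free (f i), row_full (g i) & (f i == kermx (g i))%MS].

Definition splits (E Y : rep) (g : hom E Y) : Prop :=
  exists s : hom Y E, is_hom s /\ forall i, s i *m g i = 1%:M.

(* Ext^1(M, N) = 0 : every extension of M by N splits (Yoneda description) *)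
Definition ext1_zero (M N : rep) : Prop :=
  forall (E : rep) (f : hom N E) (g : hom E M), ses f g -> splits g.

Definition projective (P : rep) : Prop :=
  forall (M N : rep) (g : hom M N) (h : hom P N),
    is_hom g -> (forall i, row_full (g i)) -> is_hom h ->
    exists l : hom P M, is_hom l /\ forall i, l i *m g i = h i.

Definition pd_le1 (T : rep) : Prop :=
  exists (P0 P1 : rep) (f : hom P1 P0) (g : hom P0 T),
    projective P0 /\ projective P1 /\ ses f g.

(* The regular module A = kQ = direct sum of the P(i), P(i)_j = span of paths i -> j. *)
Fixpoint allseq (m L : nat) : seq (seq 'I_m) :=
  match L with
  | 0 => [:: [::]]
  | L'.+1 => [::] :: [seq a :: s | a <- enum 'I_m, s <- allseq m L']
  end.

(* all paths (start vertex, arrows) ending at j; in an acyclic quiver paths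
   have length at most qm Q *)
Definition paths_to (j : 'I_(qn Q)) : seq (nat * seq 'I_(qm Q)) :=
  [seq (val i, p) | i <- enum 'I_(qn Q),
                    p <- [seq p <- allseq (qm Q) (qm Q) | is_pathn Q (val i) p (val j)]].

Definition regular_rep : rep :=
  @Rep (fun j => size (paths_to j))
       (fun a => \matrix_(r, c)
          ((nth (0%N, [::]) (paths_to (qt Q a)) c ==
            ((nth (0%N, [::]) (paths_to (qs Q a)) r).1,
             rcons (nth (0%N, [::]) (paths_to (qs Q a)) r).2 a))%:R)).

Definition tilting (T : rep) : Prop :=
  [/\ pd_le1 T, ext1_zero T T &
      exists (T1 T2 : rep) (f : hom regular_rep T1) (g : hom T1 T2),
        in_add T T1 /\ in_add T T2 /\ ses f g].

Definition basic (T : rep) : Prop :=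
  exists L : seq rep, iso T (dsum_list L) /\
    (forall i, (i < size L)%N -> indecomposable (nth zero_rep L i)) /\
    (forall i j, (i < j < size L)%N -> ~ iso (nth zero_rep L i) (nth zero_rep L j)).

Definition basic_tilting (T : rep) : Prop := basic T /\ tilting T.

Definition tarrow (T1 T2 : rep) : Prop :=
  basic_tilting T1 /\ basic_tilting T2 /\
  exists M X Y : rep, [/\ iso T1 (dsum M X), iso T2 (dsum M Y),
    indecomposable X, indecomposable Y &
    exists (M' : rep) (f : hom X M') (g : hom M' Y), in_add M M' /\ ses f g].

Definition nout (T : rep) (s : nat) : Prop :=
  exists L : seq rep, [/\ size L = s,
    (forall i, (i < s)%N -> tarrow T (nth zero_rep L i)),
    (forall i j, (i < j < s)%N -> ~ iso (nth zero_rep L i) (nth zero_rep L j)) &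
    (forall T', tarrow T T' -> exists2 i, (i < s)%N & iso T' (nth zero_rep L i))].

Definition nin (T : rep) (e : nat) : Prop :=
  exists L : seq rep, [/\ size L = e,
    (forall i, (i < e)%N -> tarrow (nth zero_rep L i) T),
    (forall i j, (i < j < e)%N -> ~ iso (nth zero_rep L i) (nth zero_rep L j)) &
    (forall T', tarrow T' T -> exists2 i, (i < e)%N & iso T' (nth zero_rep L i))].

Definition saturated (T : rep) : Prop :=
  exists s e : nat, [/\ nout T s, nin T e & (s + e)%N = qn Q].

Definition same_component (T T' : rep) : Prop :=
  clos_refl_sym_trans rep tarrow T T'.

End Reps.

(* Main.v *)
(** Write [<x, y>] for the Euler form; [<dim M, dim N> = dim Hom(M, N) - dim Ext^1(M, N)].
    The dimension vectors of the summands [T_i] of a basic tilting module form a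
    basis of [Z^n], and conversely (Bongartz) a rigid sum of pairwise non-isomorphic
    indecomposables with that property is tilting. Let [M] be the complement of [T_i].

    If [M] is sincere, then [T_i] is either cogenerated or generated by [M], but not
    both, and accordingly it is replaced in exactly one way, along exactly one arrow
    leaving or entering [T]. So if all the complements are sincere, [T] has exactly
    [n] neighbours and is saturated.

    If [M] vanishes at a vertex [v], then [T_i] has dimension [1] at [v], because the
    dimension vectors generate [Z^n]. Hence every summand has dimension vector [x] with
    [<x, x> = 1] and [x_v <= 1]. The Dynkin or Euclidean graph carries a positive
    subadditive function, so the quadratic form is semidefinite and only finitely many
    such [x] exist. As a rigid representation is determined by its dimension vector,
    there are finitely many non-saturated [T] altogether, in whatever component. *)

Require Import Defs.
From HB Require Import structures.
From mathcomp Require Import all_boot all_order all_algebra.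
From mathcomp Require Import zify ring lra.
From Stdlib Require Import Relation_Operators Classical FunctionalExtensionality.
Set Implicit Arguments. Unset Strict Implicit. Unset Printing Implicit Defensive.
Import Order.TTheory GRing.Theory Num.Theory.
(* Otherwise [hom] is the one of mathcomp's vector spaces. *)
Import Defs.
Local Open Scope ring_scope.

(** Only the vanishing of Ext^1 is ever used, so no Ext group is formed: Ext^1(M, N) = 0 says that
    one linear map, whose kernel is Hom(M, N), is surjective. Rank-nullity for it gives the Euler
    form, and the needed pieces of the long exact sequences become corrections of pointwise linear
    maps.

    That a rigid representation is determined by its dimension vector usually rests on open orbits.
    Here two points of a representation space are joined by a line, and a polynomial determinant
    shows almost every point of the line to be isomorphic to each rigid end. This carries most of
    the proof: a relation between dimension vectors, its negative terms moved to the other side,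
    becomes an isomorphism of direct sums, so questions about summands turn into linear algebra over
    Z.

    In the Euclidean case the radical of the form is spanned by a positive vector, which can be
    added to a root without changing the form. The bound at [v] stops this, because the ratios to
    the subadditive function vary boundedly along the arrows of a connected quiver. *)

Lemma subr_swap (V : zmodType) (u v p q : V) : p - q = u - v -> u - p = v - q.
Proof.
move/eqP; rewrite subr_eq => /eqP->.
by rewrite !opprD opprK !addrA subrr add0r.
Qed.

(* Locked, so that rewriting with associativity does not unfold [pinvmx]. *)
HB.lock Definition pinv (K : fieldType) m n (A : 'M[K]_(m, n)) := pinvmx A.

(** * Exact sequences of matrices *)

Section ExactMatrices.
Variable K : fieldType.

Lemma pinv_sub m1 m2 n (A : 'M[K]_(m1, n)) (B : 'M_(m2, n)) :
  (A <= B)%MS -> A *m pinv B *m B = A.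
Proof. by rewrite pinv.unlock; apply: mulmxKpV. Qed.

Lemma pinv_free m n (A : 'M[K]_(m, n)) : row_free A -> A *m pinv A = 1%:M.
Proof. by rewrite pinv.unlock; apply: mulmxVp. Qed.

Lemma pinv_full m n (A : 'M[K]_(m, n)) : row_full A -> pinv A *m A = 1%:M.
Proof. by rewrite pinv.unlock; apply: mulVpmx. Qed.

Definition exactm m n k (j : 'M[K]_(m, n)) (p : 'M[K]_(n, k)) :=
  [/\ row_free j, row_full p & (j == kermx p)%MS].

Lemma exactm0 m n k (j : 'M[K]_(m, n)) (p : 'M[K]_(n, k)) :
  exactm j p -> j *m p = 0.
Proof. by case=> _ _ /andP[/sub_kermxP]. Qed.

Lemma exactm_lift m n k q (j : 'M[K]_(m, n)) (p : 'M[K]_(n, k)) (x : 'M_(q, n)) :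
  exactm j p -> x *m p = 0 -> x *m pinv j *m j = x.
Proof.
case=> _ _ /andP[_ kj] /sub_kermxP xk.
by apply: pinv_sub; apply: submx_trans kj.
Qed.

Lemma exactm_factor m n k q (j : 'M[K]_(m, n)) (p : 'M[K]_(n, k)) (x : 'M_(n, q)) :
  exactm j p -> j *m x = 0 -> p *m (pinv p *m x) = x.
Proof.
move=> ex jx; have [_ pf _] := ex.
have e0 : (p *m pinv p - 1%:M) *m p = 0.
  by rewrite mulmxBl -mulmxA pinv_full // mulmx1 mul1mx subrr.
apply/eqP; rewrite mulmxA -subr_eq0 -{2}[x]mul1mx -mulmxBl.
by rewrite -(exactm_lift ex e0) -(mulmxA _ j) jx mulmx0.
Qed.

Lemma row_free_cancel m n q (j : 'M[K]_(m, n)) (x y : 'M_(q, m)) :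
  row_free j -> x *m j = y *m j -> x = y.
Proof. by move=> /mxalgebra.row_free_inj; apply. Qed.

Lemma row_full_cancel m n q (p : 'M[K]_(m, n)) (x y : 'M_(n, q)) :
  row_full p -> p *m x = p *m y -> x = y.
Proof.
by move=> pf e; rewrite -[x]mul1mx -[y]mul1mx -(pinv_full pf) -!mulmxA e.
Qed.

Lemma exactm_dim m n k (j : 'M[K]_(m, n)) (p : 'M[K]_(n, k)) :
  exactm j p -> n = (m + k)%N.
Proof.
case=> /eqP jf /eqP pf /eqmx_rank; rewrite jf mxrank_ker pf => ->.
by rewrite subnK // -pf rank_leq_row.
Qed.

Lemma exactmP m n k (j : 'M[K]_(m, n)) (p : 'M[K]_(n, k)) :
  row_free j -> row_full p -> j *m p = 0 -> n = (m + k)%N -> exactm j p.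
Proof.
move=> jf pf jp e; split=> //; have h : (j <= kermx p)%MS by apply/sub_kermxP.
rewrite -(mxrank_leqif_eq h).2.
by rewrite mxrank_ker (eqP jf) (eqP pf) {1}e addnK.
Qed.

Lemma row_free_mul m n k (f : 'M[K]_(m, n)) (g : 'M[K]_(n, k)) :
  row_free f -> row_free g -> row_free (f *m g).
Proof. by move=> ff gf; rewrite /row_free mxrankMfree. Qed.

Lemma row_full_mul m n k (f : 'M[K]_(m, n)) (g : 'M[K]_(n, k)) :
  row_full f -> row_full g -> row_full (f *m g).
Proof. by move=> ff gf; rewrite /row_full (eqmxMfull _ ff). Qed.

Lemma row_free_of_mul m n k (f : 'M[K]_(m, n)) (g : 'M[K]_(n, k)) :
  row_free (f *m g) -> row_free f.
Proof.
rewrite /row_free !eqn_leq !rank_leq_row /= => h.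
by apply: leq_trans h (mxrankM_maxl _ _).
Qed.

Lemma row_full_of_mul m n k (f : 'M[K]_(m, n)) (g : 'M[K]_(n, k)) :
  row_full (f *m g) -> row_full g.
Proof.
rewrite /row_full !eqn_leq !rank_leq_col /= => h.
by apply: leq_trans h (mxrankM_maxr _ _).
Qed.

Lemma row_free1 n : row_free (1%:M : 'M[K]_n).
Proof. by rewrite /row_free mxrank1. Qed.
Lemma row_full1 n : row_full (1%:M : 'M[K]_n).
Proof. by rewrite /row_full mxrank1. Qed.

Lemma retract_free m n (f : 'M[K]_(m, n)) (g : 'M[K]_(n, m)) :
  f *m g = 1%:M -> row_free f.
Proof. by move=> e; apply: (@row_free_of_mul _ _ _ f g); rewrite e row_free1. Qed.
Lemma retract_full m n (f : 'M[K]_(m, n)) (g : 'M[K]_(n, m)) :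
  f *m g = 1%:M -> row_full g.
Proof. by move=> e; apply: (@row_full_of_mul _ _ _ f g); rewrite e row_full1. Qed.

End ExactMatrices.

(** * Homomorphisms, retracts and vanishing of Ext *)

Section RepBasics.
Variables (K : fieldType) (Q : quiver).
Local Notation rep := (rep K Q).
Implicit Types (M N P X Y Z E : rep).

Definition hcomp M N P (f : hom M N) (g : hom N P) : hom M P :=
  fun i => f i *m g i.
Definition hid M : hom M M := fun i => 1%:M.

Definition hom_inj M N (f : hom M N) := forall i, row_free (f i).
Definition hom_surj M N (f : hom M N) := forall i, row_full (f i).

Definition retract X T := exists (f : hom X T) (g : hom T X),
  [/\ is_hom f, is_hom g & forall i, f i *m g i = 1%:M].

(* [Ext^1(M, N) = 0]: by the standard projective resolution, [Ext^1(M, N)] is the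
   cokernel of the map sending [phi] to [rmap M * phi - phi * rmap N]. *)
Definition ext0 M N :=
  forall th : forall a, 'M[K]_(rdim M (qs Q a), rdim N (qt Q a)),
  exists phi : hom M N, forall a,
    rmap M a *m phi (qt Q a) - phi (qs Q a) *m rmap N a = th a.

Lemma is_hom_comp M N P (f : hom M N) (g : hom N P) :
  is_hom f -> is_hom g -> is_hom (hcomp f g).
Proof. by move=> hf hg a; rewrite /hcomp mulmxA hf -!mulmxA hg. Qed.

Lemma is_hom_id M : is_hom (hid M).
Proof. by move=> a; rewrite mulmx1 mul1mx. Qed.

Lemma is_hom0 M N : is_hom (fun i => 0 : 'M[K]_(rdim M i, rdim N i)).
Proof. by move=> a; rewrite mulmx0 mul0mx. Qed.

Lemma is_homB M N (f g : hom M N) :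
  is_hom f -> is_hom g -> is_hom (fun i => f i - g i).
Proof. by move=> hf hg a; rewrite mulmxBl mulmxBr hf hg. Qed.

Lemma is_homZ M N c (f : hom M N) : is_hom f -> is_hom (fun i => c *: f i).
Proof. by move=> hf a; rewrite -scalemxAl -scalemxAr hf. Qed.

Lemma retract_refl X : retract X X.
Proof.
by exists (hid X), (hid X); split=> [||i]; rewrite ?mulmx1 //; apply: is_hom_id.
Qed.

Lemma retract_trans X Y Z : retract X Y -> retract Y Z -> retract X Z.
Proof.
move=> [f [g [hf hg e]]] [f' [g' [hf' hg' e']]].
exists (hcomp f f'), (hcomp g' g); split; try exact: is_hom_comp.
by move=> i; rewrite /hcomp -mulmxA (mulmxA (f' i)) e' mul1mx e.
Qed.

Lemma iso_retract X Y : iso X Y -> retract X Y.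
Proof. by move=> [f [g [hf [hg [e _]]]]]; exists f, g. Qed.

Lemma iso_refl X : iso X X.
Proof.
by exists (hid X), (hid X); do ![split; first exact: is_hom_id]; split=> i; rewrite mulmx1.
Qed.

Lemma iso_sym X Y : iso X Y -> iso Y X.
Proof. by move=> [f [g [hf [hg [e e']]]]]; exists g, f. Qed.

Lemma iso_trans X Y Z : iso X Y -> iso Y Z -> iso X Z.
Proof.
move=> [f [g [hf [hg [e1 e2]]]]] [f' [g' [hf' [hg' [e1' e2']]]]].
exists (hcomp f f'), (hcomp g' g); split; first exact: is_hom_comp.
split; first exact: is_hom_comp.
split=> i; rewrite /hcomp -mulmxA.
  by rewrite (mulmxA (f' i)) e1' mul1mx e1.
by rewrite (mulmxA (g i)) e2 mul1mx e2'.
Qed.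

Lemma iso_dim X Y : iso X Y -> forall i, rdim X i = rdim Y i.
Proof.
move=> [f [g [_ [_ [e e']]]]] i; apply/eqP; rewrite eqn_leq.
have /eqP {1}<- := retract_free (e i); have /eqP {3}<- := retract_free (e' i).
by rewrite !rank_leq_col.
Qed.

Lemma inj_dim_iso X Y (f : hom X Y) :
  is_hom f -> hom_inj f -> (forall i, rdim X i = rdim Y i) -> iso X Y.
Proof.
move=> hf jf e; have ff i : row_full (f i).
  by rewrite /row_full (eqP (jf i)) e.
exists f, (fun i => pinv (f i)); split=> //; split; last first.
  by split=> i; [rewrite pinv_free | rewrite pinv_full].
move=> a; apply: (row_full_cancel (ff (qs Q a))); apply: (row_free_cancel (jf (qt Q a))).
rewrite -!mulmxA /= pinv_full // mulmx1 (mulmxA (f _)) pinv_free // mul1mx hf //.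
Qed.

Lemma retract_dim X Y : retract X Y -> forall i, (rdim X i <= rdim Y i)%N.
Proof.
move=> [f [g [_ _ e]]] i; have /eqP <- := retract_free (e i).
exact: rank_leq_col.
Qed.

Lemma retract_dim_iso X Y : retract X Y -> (forall i, rdim X i = rdim Y i) -> iso X Y.
Proof.
move=> [f [g [hf _ e]]]; apply: (inj_dim_iso hf) => i; exact: (retract_free (e i)).
Qed.

(** * Pieces of the long exact sequences *)

(** Ext^1 is right exact because the path algebra is hereditary. On cocycles this is direct: [th]
    extends to [M] through the pointwise left inverse of [j], which need not be a homomorphism, and
    the solution found there is restricted along [j]. *)
Lemma ext0_sub M' M N (j : hom M' M) : is_hom j -> hom_inj j -> ext0 M N -> ext0 M' N.
Proof.
move=> hj ij hM th.
have [phi hphi] := hM (fun a => pinv (j (qs Q a)) *m th a).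
exists (fun i => j i *m phi i) => a.
rewrite mulmxA hj -!mulmxA -mulmxBr hphi mulmxA pinv_free // mul1mx //.
Qed.

Lemma ext0_quot M N N' (p : hom N N') : is_hom p -> hom_surj p -> ext0 M N -> ext0 M N'.
Proof.
move=> hp sp hM th.
have [phi hphi] := hM (fun a => th a *m pinv (p (qt Q a))).
exists (fun i => phi i *m p i) => a.
by rewrite -!mulmxA -hp !mulmxA -mulmxBl hphi -mulmxA pinv_full // mulmx1.
Qed.

Lemma ext0_retract_l M' M N : retract M' M -> ext0 M N -> ext0 M' N.
Proof.
move=> [f [g [hf hg e]]]; apply: (ext0_sub hf) => i; exact: retract_free (e i).
Qed.

Lemma ext0_retract_r M N N' : retract N' N -> ext0 M N -> ext0 M N'.
Proof.
move=> [f [g [hf hg e]]]; apply: (ext0_quot hg) => i; exact: retract_full (e i).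
Qed.

(** A pointwise extension [psi] of [h] fails to be a homomorphism by a cocycle that vanishes on [X].
    It therefore descends to [C], where it is a coboundary, and subtracting that coboundary repairs
    [psi]. *)
Lemma hom_ext X E C N (f : hom X E) (g : hom E C) (h : hom X N) :
  ses f g -> ext0 C N -> is_hom h ->
  exists h' : hom E N, is_hom h' /\ forall i, f i *m h' i = h i.
Proof.
move=> [hf [hg ex]] hC hh.
have [psi fpsi] : exists psi : hom E N, forall i, f i *m psi i = h i.
  exists (fun i => pinv (f i) *m h i) => i.
  by rewrite mulmxA pinv_free ?mul1mx //; case: (ex i).
pose th a := rmap E a *m psi (qt Q a) - psi (qs Q a) *m rmap N a.
have fth a : f (qs Q a) *m th a = 0.
  by rewrite mulmxBr (mulmxA (f _) (rmap _ _)) -hf -mulmxA fpsi mulmxA fpsi hh subrr.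
have [phi hphi] := hC (fun a => pinv (g (qs Q a)) *m th a).
exists (fun i => psi i - g i *m phi i); split=> [a|i]; last first.
  by rewrite mulmxBr fpsi mulmxA (exactm0 (ex i)) mul0mx subr0.
rewrite mulmxBr mulmxBl; apply: subr_swap.
rewrite mulmxA hg -!mulmxA -mulmxBr hphi.
exact: (exactm_factor (ex _) (fth a)).
Qed.

Lemma hom_lift Y E X N (f : hom Y E) (g : hom E X) (h : hom N X) :
  ses f g -> ext0 N Y -> is_hom h ->
  exists h' : hom N E, is_hom h' /\ forall i, h' i *m g i = h i.
Proof.
move=> [hf [hg ex]] hC hh.
have [psi fpsi] : exists psi : hom N E, forall i, psi i *m g i = h i.
  exists (fun i => h i *m pinv (g i)) => i.
  by rewrite -mulmxA pinv_full ?mulmx1 //; case: (ex i).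
pose th a := rmap N a *m psi (qt Q a) - psi (qs Q a) *m rmap E a.
have fth a : th a *m g (qt Q a) = 0.
  by rewrite mulmxBl -(mulmxA (rmap _ _)) fpsi -(mulmxA (psi _)) hg mulmxA fpsi hh subrr.
have [phi hphi] := hC (fun a => th a *m pinv (f (qt Q a))).
exists (fun i => psi i - phi i *m f i); split=> [a|i]; last first.
  by rewrite mulmxBl fpsi -mulmxA (exactm0 (ex i)) mulmx0 subr0.
rewrite mulmxBr mulmxBl; apply: subr_swap.
rewrite -[_ *m f _ *m rmap _ _]mulmxA -hf !mulmxA -mulmxBl hphi.
exact: (exactm_lift (ex _) (fth a)).
Qed.

(** The lifting hypothesis says that the connecting map from Hom(X, N) to Ext^1(C, N) is zero. It is
    the form in which a left approximation supplies this fact. *)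
Lemma ext0_coker X E C N (f : hom X E) (g : hom E C) :
  ses f g -> ext0 E N ->
  (forall h : hom X N, is_hom h ->
     exists h' : hom E N, is_hom h' /\ forall i, f i *m h' i = h i) ->
  ext0 C N.
Proof.
move=> [hf [hg ex]] hE lift th.
have [phi hphi] := hE (fun a => g (qs Q a) *m th a).
have hom_fphi : is_hom (hcomp f phi).
  move=> a; apply/eqP; rewrite -subr_eq0 /hcomp mulmxA hf -!mulmxA -mulmxBr hphi.
  by rewrite mulmxA (exactm0 (ex _)) mul0mx.
have [h' [hh' e']] := lift _ hom_fphi.
have e0 i : f i *m (phi i - h' i) = 0 by rewrite mulmxBr e' subrr.
have [psi epsi] : exists psi : hom C N, forall i, g i *m psi i = phi i - h' i.
  by exists (fun i => pinv (g i) *m (phi i - h' i)) => i; apply: exactm_factor (ex _) (e0 _).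
exists psi => a; have [_ gs _] := ex (qs Q a); apply: (row_full_cancel gs).
rewrite mulmxBr (mulmxA (g _) (rmap _ _)) -hg -mulmxA epsi mulmxA epsi -hphi.
by rewrite mulmxBr mulmxBl hh' opprB subrKA.
Qed.

Lemma ext0_ker Y E X N (f : hom Y E) (g : hom E X) :
  ses f g -> ext0 N E ->
  (forall h : hom N X, is_hom h ->
     exists h' : hom N E, is_hom h' /\ forall i, h' i *m g i = h i) ->
  ext0 N Y.
Proof.
move=> [hf [hg ex]] hE lift th.
have [phi hphi] := hE (fun a => th a *m f (qt Q a)).
have hom_fphi : is_hom (hcomp phi g).
  move=> a; apply/eqP; rewrite -subr_eq0 /hcomp -mulmxA -hg !mulmxA -mulmxBl hphi.
  by rewrite -mulmxA (exactm0 (ex _)) mulmx0.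
have [h' [hh' e']] := lift _ hom_fphi.
have e0 i : (phi i - h' i) *m g i = 0 by rewrite mulmxBl e' subrr.
have [psi epsi] : exists psi : hom N Y, forall i, psi i *m f i = phi i - h' i.
  by exists (fun i => (phi i - h' i) *m pinv (f i)) => i; apply: exactm_lift (ex _) (e0 _).
exists psi => a; have [fs _ _] := ex (qt Q a); apply: (row_free_cancel fs).
rewrite mulmxBl -(mulmxA (rmap _ _)) epsi -(mulmxA (psi _)) hf mulmxA epsi -hphi.
by rewrite mulmxBr mulmxBl hh' opprB subrKA.
Qed.

Lemma ext0_mid_l X E C N (f : hom X E) (g : hom E C) :
  ses f g -> ext0 X N -> ext0 C N -> ext0 E N.
Proof.
move=> [hf [hg ex]] hX hC th.
have [phi hphi] := hX (fun a => f (qs Q a) *m th a).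
have [psi fpsi] : exists psi : hom E N, forall i, f i *m psi i = phi i.
  exists (fun i => pinv (f i) *m phi i) => i.
  by rewrite mulmxA pinv_free ?mul1mx //; case: (ex i).
pose th1 a := th a - (rmap E a *m psi (qt Q a) - psi (qs Q a) *m rmap N a).
have fth a : f (qs Q a) *m th1 a = 0.
  by rewrite mulmxBr mulmxBr (mulmxA (f _) (rmap _ _)) -hf -(mulmxA (rmap _ _)) fpsi
     (mulmxA (f _) (psi _)) fpsi hphi subrr.
have [phi2 h2] := hC (fun a => pinv (g (qs Q a)) *m th1 a).
exists (fun i => psi i + g i *m phi2 i) => a.
rewrite mulmxDr mulmxDl opprD addrACA mulmxA hg -!mulmxA -[X in _ + X]mulmxBr h2.
by rewrite (exactm_factor (ex _) (fth a)) addrC subrK.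
Qed.

Lemma ext0_mid_r Y E X N (f : hom Y E) (g : hom E X) :
  ses f g -> ext0 N Y -> ext0 N X -> ext0 N E.
Proof.
move=> [hf [hg ex]] hY hX th.
have [phi hphi] := hX (fun a => th a *m g (qt Q a)).
have [psi fpsi] : exists psi : hom N E, forall i, psi i *m g i = phi i.
  exists (fun i => phi i *m pinv (g i)) => i.
  by rewrite -mulmxA pinv_full ?mulmx1 //; case: (ex i).
pose th1 a := th a - (rmap N a *m psi (qt Q a) - psi (qs Q a) *m rmap E a).
have fth a : th1 a *m g (qt Q a) = 0.
  by rewrite mulmxBl mulmxBl -(mulmxA (rmap _ _)) fpsi -(mulmxA (psi _)) hg mulmxA fpsi hphi subrr.
have [phi2 h2] := hY (fun a => th1 a *m pinv (f (qt Q a))).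
exists (fun i => psi i + phi2 i *m f i) => a.
rewrite mulmxDr mulmxDl opprD addrACA -[phi2 _ *m _ *m _]mulmxA -hf !mulmxA.
by rewrite -[X in _ + X]mulmxBl h2 (exactm_lift (ex _) (fth a)) addrC subrK.
Qed.

(** * Extensions *)

Definition extrep N M (th : forall a, 'M[K]_(rdim M (qs Q a), rdim N (qt Q a))) : rep :=
  @Rep K Q (fun i => (rdim M i + rdim N i)%N)
       (fun a => block_mx (rmap M a) (th a) 0 (rmap N a)).

Lemma extrep_ses N M th :
  @ses K Q N (@extrep N M th) M (fun i => row_mx 0 1%:M) (fun i => col_mx 1%:M 0).
Proof.
split.
  by move=> a; rewrite /= mul_row_block mul_mx_row !mul0mx mulmx1 !mul1mx !mulmx0 !add0r.
split; first by move=> a; rewrite /= mul_block_col mul_col_mx !mul0mx !mulmx1 !mul1mx !mulmx0 !addr0.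
move=> i; apply: exactmP; last by rewrite /= addnC.
- by apply: (@retract_free _ _ _ _ (col_mx 0 1%:M)); rewrite mul_row_col mulmx0 add0r mulmx1.
- by apply: (@retract_full _ _ _ (row_mx 1%:M 0)); rewrite mul_row_col mulmx0 addr0 mulmx1.
by rewrite mul_row_col mulmx0 mul0mx addr0.
Qed.

(** A section of the extension glued along [th] has the form (1, phi), and compatibility with the
    arrows says exactly that [phi] solves the equation for [th]. Conversely a section is a lift of
    the identity. *)
Lemma ext1_zeroP M N : ext1_zero M N <-> ext0 M N.
Proof.
split=> [h th | h E f g s].
  have [s [hs es]] := h _ _ _ (extrep_ses th).
  exists (fun i => rsubmx (s i)) => a; have := hs a.
  have := es (qs Q a); have [l1 [r1 ->]] : exists l r, s (qs Q a) = row_mx l r.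
    by exists (lsubmx (s (qs Q a))), (rsubmx (s (qs Q a))); rewrite hsubmxK.
  have [l2 [r2 ->]] : exists l r, s (qt Q a) = row_mx l r.
    by exists (lsubmx (s (qt Q a))), (rsubmx (s (qt Q a))); rewrite hsubmxK.
  rewrite mul_row_col mulmx1 mulmx0 addr0 => -> /=.
  rewrite mul_mx_row mul_row_block mul1mx => /eq_row_mx[_ e].
  by rewrite !row_mxKr e mul1mx addrK.
have [s' [hs e]] := hom_lift s h (is_hom_id M).
by exists s'; split.
Qed.

End RepBasics.

(** * Subrepresentations, kernels, images and cokernels *)

Section Constructions.
Variables (K : fieldType) (Q : quiver).
Local Notation rep := (rep K Q).
Implicit Types (M N P X Y Z E T : rep).

Lemma exists_sub E (U : forall i, 'M[K]_(rdim E i)) :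
  (forall a, (U (qs Q a) *m rmap E a <= U (qt Q a))%MS) ->
  exists X (f : hom X E), [/\ is_hom f, hom_inj f & forall i, (f i :=: U i)%MS].
Proof.
move=> st; pose B i := row_base (U i).
exists (@Rep K Q (fun i => \rank (U i))
  (fun a => B (qs Q a) *m rmap E a *m pinv (B (qt Q a)))), B; split.
- move=> a /=; apply: pinv_sub; rewrite /B (eqmxMr _ (eq_row_base _)) eq_row_base.
  exact: st.
- by move=> i; apply: row_base_free.
- by move=> i; apply: eq_row_base.
Qed.

Lemma exists_ker E Y (g : hom E Y) : is_hom g ->
  exists X (f : hom X E), [/\ is_hom f, hom_inj f & forall i, (f i :=: kermx (g i))%MS].
Proof.
move=> hg; apply: exists_sub => a; apply/sub_kermxP.
by rewrite -mulmxA hg mulmxA mulmx_ker mul0mx.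
Qed.

Lemma exists_ker_ses E Y (g : hom E Y) : is_hom g -> hom_surj g ->
  exists X (f : hom X E), ses f g.
Proof.
move=> hg sg; have [X [f [hf jf e]]] := exists_ker hg.
by exists X, f; split=> //; split=> // i; split=> //; apply/eqmxP.
Qed.

Lemma exists_im E Y (g : hom E Y) : is_hom g ->
  exists I (p : hom E I) (j : hom I Y),
    [/\ is_hom p, hom_surj p, is_hom j, hom_inj j & forall i, p i *m j i = g i].
Proof.
move=> hg.
have [I [j [hj jj ej]]] : exists I (j : hom I Y),
    [/\ is_hom j, hom_inj j & forall i, (j i :=: <<g i>>)%MS].
  apply: exists_sub => a; rewrite (eqmxMr _ (genmxE _)) genmxE -hg.
  exact: submxMl.
have [p ep] : exists p : hom E I, forall i, p i *m j i = g i.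
  by exists (fun i => g i *m pinv (j i)) => i; rewrite pinv_sub // ej genmxE.
exists I, p, j; split=> //.
  move=> a; apply: (row_free_cancel (jj _)).
  by rewrite -mulmxA ep -(mulmxA (p _)) hj mulmxA ep hg.
move=> i; have := eqmx_rank (introT eqmxP (ej i)); rewrite genmxE (eqP (jj i)) -(ep i).
move=> e; have := mxrankM_maxl (p i) (j i); rewrite -e => le.
by rewrite /row_full eqn_leq rank_leq_col.
Qed.

(** [cokermx] is square; its column base cuts it down to a surjection [V]. The arrows act on the
    quotient through [pinv V], and the choice is harmless since the image of [f] is stable under the
    arrows. *)
Lemma exists_coker X E (f : hom X E) : is_hom f ->
  exists C (g : hom E C), [/\ is_hom g, hom_surj g & forall i, (f i :=: kermx (g i))%MS].
Proof.
move=> hf; pose V i := col_base (cokermx (f i)).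
have kV i q (B : 'M_(q, _)) : B *m V i = 0 <-> (B <= f i)%MS.
  have eb := mulmx_base (cokermx (f i)); split=> [e|].
    by rewrite submxE -eb mulmxA e mul0mx.
  rewrite submxE => /eqP e; move: (congr1 (mulmx B) eb); rewrite e mulmxA => {}e.
  by apply: (row_free_cancel (row_base_free (cokermx (f i)))); rewrite e mul0mx.
have fV i : row_full (V i) by apply: col_base_full.
exists (@Rep K Q (fun i => \rank (cokermx (f i)))
  (fun a => pinv (V (qs Q a)) *m rmap E a *m V (qt Q a))), V; split=> //.
- move=> a /=; have /(proj1 (kV _ _ _)) : (1%:M - V (qs Q a) *m pinv (V (qs Q a))) *m V (qs Q a) = 0.
    by rewrite mulmxBl -mulmxA pinv_full // mulmx1 mul1mx subrr.
  move=> /(submxMr (rmap E a)) h.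
  have /(proj2 (kV _ _ _)) : ((1%:M - V (qs Q a) *m pinv (V (qs Q a))) *m rmap E a <= f (qt Q a))%MS.
    by apply: submx_trans h _; rewrite -hf submxMl.
  by move/eqP; rewrite mulmxBl mul1mx mulmxBl subr_eq0 => /eqP ->; rewrite !mulmxA.
- move=> i; apply/eqmxP/andP; split.
    by apply/sub_kermxP; apply: (proj2 (kV _ _ _)).
  by apply: (proj1 (kV _ _ _)); apply: mulmx_ker.
Qed.

Lemma exists_coker_ses X E (f : hom X E) : is_hom f -> hom_inj f ->
  exists C (g : hom E C), ses f g.
Proof.
move=> hf jf; have [C [g [hg sg e]]] := exists_coker hf.
by exists C, g; split=> //; split=> // i; split=> //; apply/eqmxP.
Qed.

Lemma ses_dim X E Y (f : hom X E) (g : hom E Y) :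
  ses f g -> forall i, rdim E i = (rdim X i + rdim Y i)%N.
Proof. by move=> [_ [_ ex]] i; apply: exactm_dim (ex i). Qed.

Lemma ses0 X E Y (f : hom X E) (g : hom E Y) :
  ses f g -> forall i, f i *m g i = 0.
Proof. by move=> [_ [_ ex]] i; apply: exactm0 (ex i). Qed.

(** * Direct sums *)

Definition dsum_inl X Y : hom X (dsum X Y) := fun i => row_mx 1%:M 0.
Definition dsum_inr X Y : hom Y (dsum X Y) := fun i => row_mx 0 1%:M.
Definition dsum_fst X Y : hom (dsum X Y) X := fun i => col_mx 1%:M 0.
Definition dsum_snd X Y : hom (dsum X Y) Y := fun i => col_mx 0 1%:M.

Definition hom_pair N X Y (f : hom N X) (g : hom N Y) : hom N (dsum X Y) :=
  fun i => row_mx (f i) (g i).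
Definition hom_copair N X Y (f : hom X N) (g : hom Y N) : hom (dsum X Y) N :=
  fun i => col_mx (f i) (g i).

Lemma is_hom_pair N X Y (f : hom N X) (g : hom N Y) :
  is_hom f -> is_hom g -> is_hom (hom_pair f g).
Proof.
by move=> hf hg a; rewrite /hom_pair /= mul_mx_row mul_row_block !mulmx0 addr0 add0r hf hg.
Qed.

Lemma is_hom_copair N X Y (f : hom X N) (g : hom Y N) :
  is_hom f -> is_hom g -> is_hom (hom_copair f g).
Proof.
by move=> hf hg a; rewrite /hom_copair /= mul_block_col mul_col_mx !mul0mx addr0 add0r hf hg.
Qed.

Lemma is_hom_inl X Y : is_hom (@dsum_inl X Y).
Proof. apply: (is_hom_pair (@is_hom_id _ _ X) (@is_hom0 _ _ X Y)). Qed.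
Lemma is_hom_inr X Y : is_hom (@dsum_inr X Y).
Proof. apply: (is_hom_pair (@is_hom0 _ _ Y X) (@is_hom_id _ _ Y)). Qed.
Lemma is_hom_fst X Y : is_hom (@dsum_fst X Y).
Proof. apply: (is_hom_copair (@is_hom_id _ _ X) (@is_hom0 _ _ Y X)). Qed.
Lemma is_hom_snd X Y : is_hom (@dsum_snd X Y).
Proof. apply: (is_hom_copair (@is_hom0 _ _ X Y) (@is_hom_id _ _ Y)). Qed.

Lemma inl_fst X Y i : @dsum_inl X Y i *m @dsum_fst X Y i = 1%:M.
Proof. by rewrite mul_row_col mulmx0 addr0 mulmx1. Qed.
Lemma inr_snd X Y i : @dsum_inr X Y i *m @dsum_snd X Y i = 1%:M.
Proof. by rewrite mul_row_col mulmx0 add0r mulmx1. Qed.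
Lemma fst_inl_snd_inr X Y i :
  @dsum_fst X Y i *m @dsum_inl X Y i + @dsum_snd X Y i *m @dsum_inr X Y i = 1%:M.
Proof.
rewrite /dsum_fst /dsum_inl /dsum_snd /dsum_inr !mul_col_row !mulmx0 !mul0mx !mulmx1 add_block_mx.
by rewrite !addr0 !add0r -scalar_mx_block.
Qed.

Lemma retract_inl X Y : retract X (dsum X Y).
Proof.
exists (@dsum_inl X Y), (@dsum_fst X Y); split; [exact: is_hom_inl | exact: is_hom_fst |].
exact: inl_fst.
Qed.

Lemma retract_inr X Y : retract Y (dsum X Y).
Proof.
exists (@dsum_inr X Y), (@dsum_snd X Y); split; [exact: is_hom_inr | exact: is_hom_snd |].
exact: inr_snd.
Qed.

Lemma ses_dsum0 X Y : ses (@dsum_inl X Y) (@dsum_snd X Y).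
Proof.
split; [exact: is_hom_inl | split; first exact: is_hom_snd].
move=> i; apply: exactmP => //.
- exact: retract_free (inl_fst _ _ i).
- exact: retract_full (inr_snd _ _ i).
by rewrite mul_row_col mulmx0 mul0mx addr0.
Qed.

Lemma ses_dsum X E Y X' E' Y' (f : hom X E) (g : hom E Y) (f' : hom X' E') (g' : hom E' Y') :
  ses f g -> ses f' g' ->
  @ses K Q (dsum X X') (dsum E E') (dsum Y Y')
    (fun i => block_mx (f i) 0 0 (f' i)) (fun i => block_mx (g i) 0 0 (g' i)).
Proof.
move=> s s'; have [hf [hg ex]] := s; have [hf' [hg' ex']] := s'.
split; first by move=> a; rewrite /= !mulmx_block !mulmx0 !mul0mx !addr0 !add0r hf hf'.
split; first by move=> a; rewrite /= !mulmx_block !mulmx0 !mul0mx !addr0 !add0r hg hg'.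
move=> i; have [a1 a2 _] := ex i; have [b1 b2 _] := ex' i; apply: exactmP.
- apply: (@retract_free _ _ _ _ (block_mx (pinv (f i)) 0 0 (pinv (f' i)))).
  rewrite mulmx_block !mulmx0 !mul0mx !addr0 !add0r !pinv_free //.
  by rewrite -scalar_mx_block.
- apply: (@retract_full _ _ _ (block_mx (pinv (g i)) 0 0 (pinv (g' i)))).
  rewrite mulmx_block !mulmx0 !mul0mx !addr0 !add0r !pinv_full //.
  by rewrite -scalar_mx_block.
- by rewrite mulmx_block !mulmx0 !mul0mx !addr0 !add0r (ses0 s) (ses0 s') block_mx0.
- by rewrite /= (ses_dim s) (ses_dim s') addnACA.
Qed.

Lemma ses_split X E Y (f : hom X E) (g : hom E Y) :
  ses f g -> splits g -> iso (dsum Y X) E.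
Proof.
move=> s [t [ht et]]; have [hf [hg ex]] := s.
apply: (@inj_dim_iso _ _ _ _ (hom_copair t f)); first exact: is_hom_copair.
  move=> i; rewrite -kermx_eq0 -submx0; set k := kermx _.
  have : k *m hom_copair t f i = 0 by apply: mulmx_ker.
  rewrite -[k]hsubmxK mul_row_col => e.
  have := congr1 (fun z => z *m g i) e; rewrite mulmxDl -!mulmxA et (ses0 s) mulmx1 mulmx0 addr0 mul0mx => e1.
  move: e; rewrite e1 mul0mx add0r => e2.
  have [fi _ _] := ex i.
  have -> : rsubmx k = 0 by apply: (row_free_cancel fi); rewrite e2 mul0mx.
  by rewrite row_mx0.
by move=> i; rewrite /= (ses_dim s) addnC.
Qed.

Lemma retract_compl X T : retract X T -> exists Z, iso T (dsum X Z).
Proof.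
move=> [f [g [hf hg e]]].
have [Z [j s]] := exists_ker_ses hg (fun i => retract_full (e i)).
by exists Z; apply: iso_sym; apply: (ses_split s); exists f.
Qed.

Lemma ses_split_ext X E Y (f : hom X E) (g : hom E Y) :
  ses f g -> ext0 Y X -> iso (dsum Y X) E.
Proof.
by move=> s h; apply: (ses_split s); apply: (proj2 (ext1_zeroP _ _) h) s.
Qed.

Lemma ext0_dsum_l X Y N : ext0 X N -> ext0 Y N -> ext0 (dsum X Y) N.
Proof. exact: ext0_mid_l (ses_dsum0 X Y). Qed.

Lemma ext0_dsum_r X Y N : ext0 N X -> ext0 N Y -> ext0 N (dsum X Y).
Proof. exact: ext0_mid_r (ses_dsum0 X Y). Qed.

Lemma ext0_dsumP X Y : ext0 (dsum X Y) (dsum X Y) ->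
  [/\ ext0 X X, ext0 X Y, ext0 Y X & ext0 Y Y].
Proof.
have x := retract_inl X Y; have y := retract_inr X Y.
by move=> h; split; [apply: (ext0_retract_l x) | apply: (ext0_retract_l x)
  | apply: (ext0_retract_l y) | apply: (ext0_retract_l y)];
  [apply: (ext0_retract_r x) | apply: (ext0_retract_r y)
  | apply: (ext0_retract_r x) | apply: (ext0_retract_r y)].
Qed.

Lemma ext0_zero_l N : ext0 (zero_rep K Q) N.
Proof.
move=> th; exists (fun i => 0) => a; apply/matrixP => i j; by case: i.
Qed.

Lemma ext0_zero_r N : ext0 N (zero_rep K Q).
Proof.
move=> th; exists (fun i => 0) => a; apply/matrixP => i j; by case: j.
Qed.

Lemma retract_dsum X Y X' Y' :
  retract X X' -> retract Y Y' -> retract (dsum X Y) (dsum X' Y').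
Proof.
move=> [f [g [hf hg e]]] [f' [g' [hf' hg' e']]].
exists (fun i => block_mx (f i) 0 0 (f' i)), (fun i => block_mx (g i) 0 0 (g' i)); split.
- by move=> a; rewrite /= !mulmx_block !mulmx0 !mul0mx !addr0 !add0r hf hf'.
- by move=> a; rewrite /= !mulmx_block !mulmx0 !mul0mx !addr0 !add0r hg hg'.
- move=> i; rewrite mulmx_block !mulmx0 !mul0mx !addr0 !add0r e e'.
  by rewrite -scalar_mx_block.
Qed.

Lemma iso_dsum X Y X' Y' : iso X X' -> iso Y Y' -> iso (dsum X Y) (dsum X' Y').
Proof.
move=> i1 i2; apply: retract_dim_iso => [|i]; last by rewrite /= (iso_dim i1) (iso_dim i2).
by apply: retract_dsum; apply: iso_retract.
Qed.

(** * Additive closure *)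

Definition inadd T X := exists k, retract X (copies T k).

Lemma in_addP T X : in_add T X <-> inadd T X.
Proof.
split=> [[k [Z i]] | [k r]]; exists k.
  apply: retract_trans (retract_inl X Z) _.
  by apply: iso_retract; apply: iso_sym.
by have [Z i] := retract_compl r; exists Z.
Qed.

(** The ideal of homomorphisms factoring through add T. It is closed under addition, and [X] lies in
    add T when its identity is in the ideal; closure of add T under direct sums then follows by
    writing the identity of a direct sum as a sum of two projections. *)
Definition facadd T M N (h : hom M N) := exists k (f : hom M (copies T k))
  (g : hom (copies T k) N), [/\ is_hom f, is_hom g & forall i, f i *m g i = h i].

Lemma facadd_comp T M N M' N' (f : hom M' M) (h : hom M N) (g : hom N N') :
  is_hom f -> is_hom g -> facadd T h -> facadd T (hcomp f (hcomp h g)).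
Proof.
move=> hf hg [k [u [v [hu hv e]]]]; exists k, (hcomp f u), (hcomp v g).
split; try exact: is_hom_comp; move=> i.
by rewrite /hcomp -e !mulmxA.
Qed.

Lemma facadd_eq T M N (h h' : hom M N) : (forall i, h i = h' i) -> facadd T h -> facadd T h'.
Proof. by move=> e [k [f [g [hf hg e']]]]; exists k, f, g; split=> // i; rewrite -e. Qed.

Lemma facaddD T M N (h h' : hom M N) :
  facadd T h -> facadd T h' -> facadd T (fun i => h i + h' i).
Proof.
move=> [k [f [g [hf hg e]]]] h2; apply: (@facadd_eq _ _ _ (fun i => f i *m g i + h' i)).
  by move=> i; rewrite e.
clear h e; elim: k f g hf hg => [|k IH] f g hf hg.
  apply: facadd_eq h2 => i.
  by rewrite (_ : f i *m g i = 0) ?add0r //; apply/matrixP => r s; rewrite !mxE big_ord0.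
have h3 := IH _ _ (is_hom_comp hf (@is_hom_snd _ _)) (is_hom_comp (@is_hom_inr _ _) hg).
have [k' [u [v [hu hv e]]]] := h3.
exists k'.+1, (hom_pair (hcomp f (@dsum_fst _ _)) u), (hom_copair (hcomp (@dsum_inl _ _) g) v).
split.
- by apply: is_hom_pair => //; apply: is_hom_comp => //; apply: is_hom_fst.
- by apply: is_hom_copair => //; apply: is_hom_comp => //; apply: is_hom_inl.
move=> i; rewrite /hom_pair /hom_copair mul_row_col e addrA; congr (_ + _).
rewrite /hcomp -!mulmxA -mulmxDr; congr (_ *m _).
by rewrite !mulmxA -mulmxDl fst_inl_snd_inr mul1mx.
Qed.

Lemma inaddP T X : inadd T X <-> facadd T (hid X).
Proof.
split=> [[k [f [g [hf hg e]]]] | [k [f [g [hf hg e]]]]]; exists k.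
  by exists f, g; split.
by exists f, g; split.
Qed.

Lemma inadd_retract T X Y : retract X Y -> inadd T Y -> inadd T X.
Proof. by move=> r [k rk]; exists k; apply: retract_trans rk. Qed.

Lemma inadd_dsum T X Y : inadd T X -> inadd T Y -> inadd T (dsum X Y).
Proof.
move=> /inaddP hX /inaddP hY; apply/inaddP.
have h1 := facadd_comp (@is_hom_fst X Y) (@is_hom_inl X Y) hX.
have h2 := facadd_comp (@is_hom_snd X Y) (@is_hom_inr X Y) hY.
apply: facadd_eq (facaddD h1 h2) => i.
by rewrite /hcomp /hid !mul1mx fst_inl_snd_inr.
Qed.

Lemma inadd_zero T : inadd T (zero_rep K Q).
Proof. by exists 0%N; apply: retract_refl. Qed.

Lemma inadd_copies T X k : inadd T X -> inadd T (copies X k).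
Proof. by move=> h; elim: k => [|k IH]; [apply: inadd_zero | apply: inadd_dsum]. Qed.

Lemma inadd_trans S T X : inadd S T -> inadd T X -> inadd S X.
Proof. by move=> h [k r]; apply: inadd_retract r _; apply: inadd_copies. Qed.

Lemma inadd_refl T : inadd T T.
Proof. by exists 1%N; apply: retract_inl. Qed.

Lemma inadd_of_retract T X : retract X T -> inadd T X.
Proof. by move=> r; apply: inadd_retract r (inadd_refl T). Qed.

Lemma inadd_dsum_list T L :
  (forall i, (i < size L)%N -> inadd T (nth (zero_rep K Q) L i)) -> inadd T (dsum_list L).
Proof.
elim: L => [|X L IH] h; first exact: inadd_zero.
apply: inadd_dsum; first exact: (h 0%N).
by apply: IH => i hi; apply: (h i.+1).
Qed.

Lemma ext0_copies_l T N k : ext0 T N -> ext0 (copies T k) N.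
Proof. by move=> h; elim: k => [|k IH]; [apply: ext0_zero_l | apply: ext0_dsum_l]. Qed.

Lemma ext0_copies_r T N k : ext0 N T -> ext0 N (copies T k).
Proof. by move=> h; elim: k => [|k IH]; [apply: ext0_zero_r | apply: ext0_dsum_r]. Qed.

Lemma ext0_inadd_l T X N : inadd T X -> ext0 T N -> ext0 X N.
Proof. by move=> [k r] h; apply: ext0_retract_l r _; apply: ext0_copies_l. Qed.

Lemma ext0_inadd_r T X N : inadd T X -> ext0 N T -> ext0 N X.
Proof. by move=> [k r] h; apply: ext0_retract_r r _; apply: ext0_copies_r. Qed.

Lemma retract_nth L i : (i < size L)%N ->
  retract (nth (zero_rep K Q) L i) (dsum_list L).
Proof.
elim: L i => [//|X L IH] [_|i hi] /=; first exact: retract_inl.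
by apply: retract_trans (IH i hi) _; apply: retract_inr.
Qed.

Lemma copies_ses X E Y (f : hom X E) (g : hom E Y) k : ses f g ->
  exists (f' : hom (copies X k) (copies E k)) (g' : hom (copies E k) (copies Y k)), ses f' g'.
Proof.
move=> s; elim: k => [|k [f' [g' s']]]; last by do 2!eexists; apply: ses_dsum s s'.
exists (hid _), (hid _); split; first exact: is_hom_id.
split; first exact: is_hom_id.
move=> i; apply: exactmP => //=; try exact: row_free1; try exact: row_full1.
by apply/matrixP => [[]].
Qed.

End Constructions.

(** * Fitting's lemma and decomposition into indecomposables *)

Section Indecomposables.
Variables (K : fieldType) (Q : quiver).
Local Notation rep := (rep K Q).
Implicit Types (M N P X Y Z E T : rep).

Definition hpow X (f : hom X X) n : hom X X := fun i => iter n (mulmx (f i)) 1%:M.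

Lemma is_hom_pow X (f : hom X X) n : is_hom f -> is_hom (hpow f n).
Proof.
move=> hf; elim: n => [|n IH]; first exact: is_hom_id.
exact: (is_hom_comp hf IH).
Qed.

Lemma hpowD X (f : hom X X) m n i : hpow f (m + n) i = hpow f m i *m hpow f n i.
Proof.
elim: m => [|m IH]; first by rewrite mul1mx.
by rewrite addSn -[RHS]mulmxA -IH.
Qed.

Lemma nonzero_or X : nonzero X \/ forall i, rdim X i = 0%N.
Proof.
case: (classic (nonzero X)) => h; [by left | right] => i.
by apply/eqP; rewrite -leqn0 leqNgt; apply/negP => hi; apply: h; exists i.
Qed.

Lemma retract_indec X Y : indecomposable X -> nonzero Y -> retract Y X -> iso Y X.
Proof.
move=> [_ hX] nY r; have [Z e] := retract_compl r.
case: (hX _ _ e) => // nZ; apply: (retract_dim_iso r) => i.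
rewrite (iso_dim e) /= [rdim Z i](_ : _ = 0%N) ?addn0 //.
by case: (nonzero_or Z).
Qed.

Lemma free_endo_retract X Y (f : hom X Y) (g : hom Y X) : is_hom f -> is_hom g ->
  (forall i, row_free (f i *m g i)) -> retract X Y.
Proof.
move=> hf hg fr.
have [z hz] : exists z : hom X X, forall i, z i *m (f i *m g i) = 1%:M.
  exists (fun i => invmx (f i *m g i)) => i.
  by rewrite mulVmx // -row_free_unit.
have hfg : is_hom (hcomp f g) by apply: is_hom_comp.
have hz' : is_hom z.
  move=> a; apply: (row_free_cancel (fr (qt Q a))).
  by rewrite -mulmxA hz mulmx1 -(mulmxA (z _)) (hfg a) mulmxA hz mul1mx.
exists (hcomp z f), g; split=> //; first exact: is_hom_comp.
by move=> i; rewrite /hcomp -mulmxA hz.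
Qed.

(** For a power [p] of minimal total rank, [p] and its square have equal rank at every vertex, so
    the image of [p] is a direct summand. By indecomposability this image is zero or everything. *)
Lemma fitting X (f : hom X X) : indecomposable X -> is_hom f ->
  (forall i, row_free (f i)) \/ exists n, forall i, hpow f n i = 0.
Proof.
move=> iX hf; pose r n := (\sum_i \rank (hpow f n i))%N.
(* The minimum is taken at a positive exponent, so that [p] has [f] as its first factor and
   injectivity of [p] passes to [f]. *)
have [n hn] : exists n, forall m, (r n.+1 <= r m)%N.
  suff [n hn] : exists n, forall m, (r n <= r m)%N.
    exists n => m; apply: leq_trans (hn m); apply: leq_sum => i _; exact: mxrankM_maxr.
  suff h : forall k n, (r n <= k)%N -> exists n, forall m, (r n <= r m)%N by exact: (h (r 0%N) 0%N).
  elim=> [|k IH] n hn.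
    by exists n => m; apply: leq_trans hn _.
  case: (classic (exists m, (r m <= k)%N)) => [[m hm]|hm]; first exact: IH hm.
  exists n => m; apply: leq_trans hn _; rewrite ltnNge; apply/negP => h.
  by apply: hm; exists m.
pose p := hpow f n.+1; have hp : is_hom p by apply: is_hom_pow.
have rk i : \rank (p i *m p i) = \rank (p i).
  have le j : (\rank (p j *m p j) <= \rank (p j))%N by apply: mxrankM_maxl.
  apply/eqP; rewrite eqn_leq le /= leqNgt; apply/negP => lt.
  have := hn (n.+1 + n.+1)%N; rewrite leqNgt => /negP; apply.
  rewrite /r (bigD1 i) // [X in (_ < X)%N](bigD1 i) // -addSn.
  apply: leq_add; first by rewrite hpowD; exact: lt.
  by apply: leq_sum => j _; rewrite hpowD; exact: le.
have [I [q [j [hq sq hj jj e]]]] := exists_im hp.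
have ju i : row_free (j i *m q i).
  have := rk i; rewrite -e -mulmxA (mulmxA (j i)) mulmxA.
  rewrite !(mxrankMfree _ (jj i)) (eqmxMfull _ (sq i)) /row_free => ->.
  exact: sq.
have rI : retract I X by apply: (free_endo_retract hj hq ju).
case: (nonzero_or I) => nI; last first.
  right; exists n.+1 => i; rewrite -/p -e; move: (q i) (j i); rewrite nI => u v.
  by rewrite [u]thinmx0 mul0mx.
left=> i; have d := iso_dim (retract_indec iX nI rI) i.
have : row_free (p i).
  rewrite -e; apply: row_free_mul => //.
  by rewrite /row_free (eqP (sq i)) d.
by move/row_free_of_mul.
Qed.

(** This is locality of the endomorphism ring: on the kernel of [g] the map [f] is the identity, so
    if [f] is nilpotent this kernel vanishes. *)
Lemma add_one_free X (f g : hom X X) : indecomposable X -> is_hom f -> is_hom g ->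
  (forall i, f i + g i = 1%:M) ->
  (forall i, row_free (f i)) \/ (forall i, row_free (g i)).
Proof.
move=> iX hf hg e; case: (fitting iX hf) => [|[n hn]]; [by left | right] => i.
rewrite -kermx_eq0; set k := kermx _; have k0 : k *m g i = 0 by apply: mulmx_ker.
have k1 : k *m f i = k.
  by move: (congr1 (mulmx k) (e i)); rewrite mulmxDr k0 addr0 mulmx1.
have kn m : k *m hpow f m i = k.
  by elim: m => [|m IH]; rewrite ?mulmx1 //= -/(hpow f m i) mulmxA k1.
by rewrite -(kn n) hn mulmx0.
Qed.

(** The identity of [X] is the sum of the endomorphisms through [Y] and through [Z]; by locality one
    of them is bijective. This primality is all that is used of the Krull-Schmidt theorem. *)
Lemma indec_prime X Y Z : indecomposable X -> retract X (dsum Y Z) ->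
  retract X Y \/ retract X Z.
Proof.
move=> iX [f [g [hf hg e]]].
pose u := hcomp (hcomp f (@dsum_fst _ _ Y Z)) (hcomp (@dsum_inl _ _ Y Z) g).
pose v := hcomp (hcomp f (@dsum_snd _ _ Y Z)) (hcomp (@dsum_inr _ _ Y Z) g).
have h1 := is_hom_comp hf (@is_hom_fst _ _ Y Z).
have h2 := is_hom_comp (@is_hom_inl _ _ Y Z) hg.
have h3 := is_hom_comp hf (@is_hom_snd _ _ Y Z).
have h4 := is_hom_comp (@is_hom_inr _ _ Y Z) hg.
have [] : (forall i, row_free (u i)) \/ (forall i, row_free (v i)).
- apply: add_one_free => //; [exact: is_hom_comp | exact: is_hom_comp |] => i.
  rewrite /u /v /hcomp -!mulmxA -mulmxDr !mulmxA -mulmxDl -e.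
  by rewrite fst_inl_snd_inr mul1mx.
- by move=> fr; left; apply: (free_endo_retract h1 h2 fr).
- by move=> fr; right; apply: (free_endo_retract h3 h4 fr).
Qed.

Lemma retract_zero_inv X : retract X (zero_rep K Q) -> ~ nonzero X.
Proof. by move=> /retract_dim h [i]; rewrite ltnNge (leq_trans (h i)). Qed.

Lemma indec_dsum_list X L : indecomposable X -> retract X (dsum_list L) ->
  exists2 i, (i < size L)%N & retract X (nth (zero_rep K Q) L i).
Proof.
move=> iX; elim: L => [|Y L IH] /=; first by move/retract_zero_inv; case: iX.
case/(indec_prime iX) => [r|/IH[i hi r]]; first by exists 0%N.
by exists i.+1.
Qed.

Lemma indec_inadd X T : indecomposable X -> inadd T X -> retract X T.
Proof.
move=> iX [k]; elim: k => [|k IH] /=; first by move/retract_zero_inv; case: iX.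
by case/(indec_prime iX).
Qed.

Definition tdim X := (\sum_i rdim X i)%N.

Lemma tdim_gt0 X : nonzero X -> (0 < tdim X)%N.
Proof. by move=> [i hi]; rewrite /tdim (bigD1 i) //= ltn_addr. Qed.

Lemma tdim_dsum X Y Z : iso X (dsum Y Z) -> tdim X = (tdim Y + tdim Z)%N.
Proof.
by move=> e; rewrite /tdim -big_split; apply: eq_bigr => i _; rewrite (iso_dim e).
Qed.

Lemma decomposable X : nonzero X -> ~ indecomposable X ->
  exists Y Z, [/\ iso X (dsum Y Z), nonzero Y & nonzero Z].
Proof.
move=> nX h; apply: NNPP => h'; apply: h; split=> // Y Z e.
case: (classic (nonzero Y)) => nY; [right => nZ | by left].
by apply: h'; exists Y, Z.
Qed.

Lemma indec_notin_inadd T X : ~ inadd T X ->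
  exists Y, [/\ indecomposable Y, retract Y X & ~ inadd T Y].
Proof.
have [n] := ubnP (tdim X); elim: n X => // n IH X hn nX.
have n0 : nonzero X.
  case: (nonzero_or X) => // h; case: nX; exists 0%N.
  by apply: iso_retract; apply: (@inj_dim_iso _ _ _ _ (fun i => 0));
    [apply: is_hom0 | move=> i; rewrite /row_free mxrank0 h | ].
case: (classic (indecomposable X)) => iX; first by exists X; split=> //; apply: retract_refl.
have [Y [Z [e nY nZ]]] := decomposable n0 iX.
have t := tdim_dsum e; have tY := tdim_gt0 nY; have tZ := tdim_gt0 nZ.
have rY : retract Y X := retract_trans (retract_inl Y Z) (iso_retract (iso_sym e)).
have rZ : retract Z X := retract_trans (retract_inr Y Z) (iso_retract (iso_sym e)).
case: (classic (inadd T Y)) => aY.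
  have aZ : ~ inadd T Z.
    move=> aZ; apply: nX; apply: inadd_retract (iso_retract e) _; exact: inadd_dsum.
  have [|W [iW rW aW]] := IH Z _ aZ; last by exists W; split=> //; apply: retract_trans rZ.
  by rewrite -ltnS (leq_trans _ hn) // ltnS t -{1}[tdim Z]add0n ltn_add2r.
have [|W [iW rW aW]] := IH Y _ aY; last by exists W; split=> //; apply: retract_trans rY.
by rewrite -ltnS (leq_trans _ hn) // ltnS t -{1}[tdim Y]addn0 ltn_add2l.
Qed.

(** * Endomorphisms of rigid indecomposables *)

Lemma hpow_comm X (f g h : hom X X) n : 
  (forall i, f i *m g i = h i *m f i) -> forall i, f i *m hpow g n i = hpow h n i *m f i.
Proof.
move=> e i; elim: n => [|n IH]; first by rewrite mulmx1 mul1mx.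
by rewrite /hpow !iterS -!/(hpow _ _ _) mulmxA e -mulmxA IH mulmxA.
Qed.

(* The Happel-Ringel lemma for endomorphisms: the extension of [X / im f] by
   [im f] given by [X] lifts along [X -> im f], and rigidity then exhibits
   [im f] as a summand of [X + X]. *)
Lemma rigid_endo_free X (f : hom X X) : indecomposable X -> ext0 X X -> is_hom f ->
  (forall i, f i = 0) \/ (forall i, row_free (f i)).
Proof.
move=> iX rX hf; have [I [p [j [hp sp hj jj e]]]] := exists_im hf.
have [C [c s]] := exists_coker_ses hj jj; have [_ [hc ex]] := s.
have [r er] : exists r : hom X I, forall i, j i *m r i = 1%:M.
  by exists (fun i => pinv (j i)) => i; apply: pinv_free.
(* [th] is the cocycle of [X] as an extension of [C] by [I], computed from the pointwise retraction
   [r]; [th'] lifts it along [p] to a cocycle with values in [X]. *)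
have [th eth] : exists th : forall a, 'M[K]_(rdim C (qs Q a), rdim I (qt Q a)),
    forall a, c (qs Q a) *m th a = rmap X a *m r (qt Q a) - r (qs Q a) *m rmap I a.
  exists (fun a => pinv (c (qs Q a)) *m (rmap X a *m r (qt Q a) - r (qs Q a) *m rmap I a)) => a.
  apply: exactm_factor (ex _) _.
  by rewrite mulmxBr (mulmxA _ (rmap X a)) -hj -mulmxA er mulmx1 mulmxA er mul1mx subrr.
have [th' eth'] : exists th' : forall a, 'M[K]_(rdim C (qs Q a), rdim X (qt Q a)),
    forall a, th' a *m p (qt Q a) = th a.
  by exists (fun a => th a *m pinv (p (qt Q a))) => a; rewrite -mulmxA pinv_full // mulmx1.
have [phi hphi] := rX (fun a => c (qs Q a) *m th' a).
pose u : hom X I := fun i => r i - phi i *m p i.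
pose v : hom I X := hcomp j phi.
have hu : is_hom u.
  move=> a; rewrite mulmxBr mulmxBl; apply: subr_swap.
  rewrite -eth -eth' (mulmxA (c _)) -hphi mulmxBl -(mulmxA (rmap X a) (phi _)).
  by rewrite -(mulmxA (phi _) (rmap X a)) hp (mulmxA (phi _) (p _)).
have hv : is_hom v.
  move=> a; apply/eqP; rewrite -subr_eq0 /v /hcomp mulmxA hj -!mulmxA -mulmxBr hphi.
  by rewrite mulmxA (ses0 s) mul0mx.
have one i : j i *m u i + v i *m p i = 1%:M.
  by rewrite /u /v /hcomp mulmxBr er mulmxA subrK.
have huj : is_hom (hcomp u j) by apply: is_hom_comp.
have hpv : is_hom (hcomp p v) by apply: is_hom_comp.
(* With f = p j and 1 = j u + v p on the image, f (1 - u j) = p v p j = (p v) f. If [p v] is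
   injective, so is [p] and hence [f]; otherwise [p v] is nilpotent. In that case, [u j] injective
   forces dim I = dim X and again [f] is injective, while 1 - u j injective yields f = 0 from f (1 -
   u j)^n = (p v)^n f = 0. *)
have ef : forall i, f i *m (1%:M - hcomp u j i) = hcomp p v i *m f i.
  move=> i; have e1 : j i *m (u i *m j i) + v i *m (p i *m j i) = j i.
    by rewrite !mulmxA -mulmxDl one mul1mx.
  rewrite /hcomp -e mulmxBr mulmx1 -(mulmxA (p i) (v i)) -(mulmxA (p i) (j i)).
  by apply/eqP; rewrite subr_eq addrC -mulmxDr e1.
case: (fitting iX hpv) => [fr|[n hn]].
  right=> i; rewrite -e; apply: row_free_mul => //.
  exact: row_free_of_mul (fr i).
case: (add_one_free iX huj (is_homB (@is_hom_id _ _ X) huj)).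
- by move=> i; rewrite addrC subrK.
- move=> fr; right=> i; have ui := row_free_of_mul (fr i).
  have d : rdim X i = rdim I i.
    apply/eqP; rewrite eqn_leq; have := rank_leq_col (u i); rewrite (eqP ui) => -> /=.
    by have := rank_leq_col (j i); rewrite (eqP (jj i)).
  rewrite -e; apply: row_free_mul => //.
  by rewrite /row_free (eqP (sp i)) d.
- move=> fr; left=> i.
  have := hpow_comm n ef i; rewrite hn mul0mx => e0.
  have : row_free (hpow (fun i => 1%:M - hcomp u j i) n i).
    elim: n {hn e0} => [|n IH]; first exact: row_free1.
    by rewrite /hpow iterS; apply: row_free_mul; [apply: fr | apply: IH].
  by move=> fr'; apply: (row_free_cancel fr'); rewrite e0 mul0mx.
Qed.

End Indecomposables.

(** An eigenvalue [c] at one vertex of the support makes f - c non-injective there, so f - c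
    vanishes at all vertices by the dichotomy for rigid indecomposables. *)
Lemma rigid_endo_scalar (K : closedFieldType) (Q : quiver) (X : rep K Q) (f : hom X X) :
  indecomposable X -> ext0 X X -> is_hom f -> exists c, forall i, f i = c%:M.
Proof.
move=> iX rX hf; have [[i hi] _] := iX.
have [c ec] : exists c, ~~ row_free (f i - c%:M).
  have : size (char_poly (f i)) != 1%N by rewrite size_char_poly; case: (rdim X i) hi.
  move/closed_rootP => [c]; rewrite -eigenvalue_root_char => /eigenvalueP[v ev v0].
  exists c; apply/negP => fr; case/eqP: v0; apply: (row_free_cancel fr).
  by rewrite mulmxBr ev mul_mx_scalar subrr mul0mx.
have hfc : is_hom (fun i => f i - c *: hid X i).
  by apply: is_homB => //; apply: is_homZ; apply: is_hom_id.
exists c => k; case: (rigid_endo_free iX rX hfc) => [/(_ k)/eqP|/(_ i)].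
  by rewrite subr_eq0 /hid scalemx1 => /eqP.
by rewrite /hid scalemx1 (negbTE ec).
Qed.

(** * Families of matrices as row vectors *)

Section Packing.
Variables (K : fieldType) (n : nat) (p q : 'I_n -> nat).

Definition pack (f : forall i, 'M[K]_(p i, q i)) : 'rV[K]_(\sum_i p i * q i) :=
  \mxrow_i mxvec (f i).
Definition unpack (v : 'rV[K]_(\sum_i p i * q i)) i : 'M[K]_(p i, q i) :=
  vec_mx (submxrow v i).

Lemma packK f i : unpack (pack f) i = f i.
Proof. by rewrite /unpack mxrowK mxvecK. Qed.

Lemma unpackK v : pack (unpack v) = v.
Proof.
rewrite /pack -[RHS]submxrowK; apply: eq_mxrow => i.
by rewrite /unpack vec_mxK.
Qed.

Lemma eq_pack f g : (forall i, f i = g i) -> pack f = pack g.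
Proof. by move=> e; apply: eq_mxrow => i; rewrite e. Qed.

Lemma unpackD u v i : unpack (u + v) i = unpack u i + unpack v i.
Proof. by rewrite /unpack -linearD; congr vec_mx; apply/matrixP => r s; rewrite !mxE. Qed.

Lemma unpackZ c v i : unpack (c *: v) i = c *: unpack v i.
Proof. by rewrite /unpack -linearZ; congr vec_mx; apply/matrixP => r s; rewrite !mxE. Qed.

Lemma unpack0 i : unpack 0 i = 0.
Proof. by have := unpackZ 0 0 i; rewrite !scale0r. Qed.

Lemma unpack_sum (I : Type) (r : seq I) (F : I -> _) i :
  unpack (\sum_(k <- r) F k) i = \sum_(k <- r) unpack (F k) i.
Proof.
exact: (big_morph (fun v => unpack v i) (fun u v => unpackD u v i) (unpack0 i)).
Qed.

Lemma packD f g : pack (fun i => f i + g i) = pack f + pack g.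
Proof.
by rewrite -[RHS]unpackK; apply: eq_pack => i; rewrite unpackD !packK.
Qed.

Lemma packZ c f : pack (fun i => c *: f i) = c *: pack f.
Proof.
by rewrite -[RHS]unpackK; apply: eq_pack => i; rewrite unpackZ !packK.
Qed.

Lemma pack_eq0 f : (forall i, f i = 0) <-> pack f = 0.
Proof.
split=> [e|e i]; last by rewrite -packK e unpack0.
by rewrite -[RHS]unpackK; apply: eq_pack => i; rewrite e unpack0.
Qed.

End Packing.

(** * Hom and Ext as kernel and cokernel of one matrix *)

Section Differential.
Variables (K : fieldType) (Q : quiver).
Local Notation rep := (rep K Q).
Implicit Types (M N P X Y Z E T : rep).

Definition diff M N (f : hom M N) : forall a, 'M[K]_(rdim M (qs Q a), rdim N (qt Q a)) :=
  fun a => rmap M a *m f (qt Q a) - f (qs Q a) *m rmap N a.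

(** The kernel of this matrix is Hom(M, N) and its cokernel is Ext^1(M, N); the difference of its
    numbers of rows and columns is the Euler form. *)
Definition Dmx M N := \matrix_k pack (diff (unpack (delta_mx 0 k) : hom M N)).

Lemma DmxE M N v : v *m Dmx M N = pack (diff (unpack v : hom M N)).
Proof.
rewrite mulmx_sum_row.
transitivity (\sum_k v 0 k *: pack (diff (unpack (delta_mx 0 k) : hom M N))).
  by apply: eq_bigr => k _; rewrite rowK.
rewrite -[RHS](_ : pack (diff (unpack (\sum_k v 0 k *: delta_mx 0 k) : hom M N)) = _); last first.
  by rewrite -row_sum_delta.
pose F v := pack (diff (unpack v : hom M N)).
have F0 : F 0 = 0.
  by apply/pack_eq0 => a; rewrite /diff !unpack0 mulmx0 mul0mx subr0.
have FD u w : F (u + w) = F u + F w.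
  rewrite /F -packD; apply: eq_pack => a; rewrite /diff !unpackD.
  by rewrite mulmxDr mulmxDl opprD addrACA.
rewrite -/(F _) (big_morph F FD F0); apply: eq_bigr => k _.
rewrite /F -packZ; apply: eq_pack => a; rewrite /diff !unpackZ.
by rewrite -scalemxAr -scalemxAl scalerBr.
Qed.

Lemma diff_is_hom M N (f : hom M N) : is_hom f <-> pack f *m Dmx M N = 0.
Proof.
rewrite DmxE -pack_eq0; split=> h a.
  by rewrite /diff !packK h subrr.
by have := h a; rewrite /diff !packK => /eqP; rewrite subr_eq0 => /eqP.
Qed.

Lemma ext0_full M N : ext0 M N <-> row_full (Dmx M N).
Proof.
split=> [h | h th].
  rewrite -sub1mx; apply/row_subP => k.
  have [phi e] := h (unpack (row k 1%:M)).
  apply/submxP; exists (pack phi); rewrite DmxE -[LHS]unpackK; apply: eq_pack => a.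
  by rewrite -e /diff !packK.
exists (unpack (pack th *m pinv (Dmx M N)) : hom M N) => a.
have := DmxE (pack th *m pinv (Dmx M N)); rewrite -mulmxA pinv_full // mulmx1 => e.
by have := congr1 (fun v => unpack v a) e; rewrite !packK /diff => <-.
Qed.

(** A spanning family is enough, so all rows of [kermx] are taken without removing dependent ones.
    Indexing by [nat], with value 0 out of range, allows the approximations to be built by induction
    on the number of maps. *)
Lemma hom_basis M N : exists n (b : nat -> hom M N), (forall k, is_hom (b k)) /\
  forall h, is_hom h -> exists c : nat -> K, forall i, h i = \sum_(k < n) c k *: b k i.
Proof.
pose D := Dmx M N; pose r (k : nat) : 'rV[K]_(\sum_i rdim M i * rdim N i) :=
  if insub k is Some k' then row k' (kermx D) else 0.
exists (\sum_i rdim M i * rdim N i)%N, (fun k => unpack (r k)); split.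
  move=> k; apply/diff_is_hom; rewrite unpackK /r; case: insub => [k'|]; last by rewrite mul0mx.
  by rewrite -row_mul mulmx_ker row0.
move=> h /diff_is_hom /sub_kermxP /submxP [c ec].
exists (fun k => if insub k is Some k' then c 0 k' else 0) => i.
rewrite -[LHS]packK ec mulmx_sum_row unpack_sum; apply: eq_bigr => k _.
by rewrite unpackZ /r valK.
Qed.

Lemma cocycle_basis M N : exists n
  (b : nat -> forall a, 'M[K]_(rdim M (qs Q a), rdim N (qt Q a))),
  forall th : (forall a, 'M[K]_(rdim M (qs Q a), rdim N (qt Q a))),
  exists c : nat -> K, forall a, th a = \sum_(k < n) c k *: b k a.
Proof.
exists (\sum_a rdim M (qs Q a) * rdim N (qt Q a))%N,
  (fun k => @unpack K _ (fun a => rdim M (qs Q a)) (fun a => rdim N (qt Q a))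
     (if insub k is Some k' then delta_mx 0 k' else 0)) => th.
exists (fun k => if insub k is Some k' then pack th 0 k' else 0) => a.
rewrite -[LHS]packK {1}[pack th]row_sum_delta unpack_sum; apply: eq_bigr => k _.
by rewrite unpackZ valK.
Qed.

(** * The Euler form *)

Definition euler (x y : 'I_(qn Q) -> int) : int :=
  \sum_i x i * y i - \sum_a x (qs Q a) * y (qt Q a).

Definition dimz M : 'I_(qn Q) -> int := fun i => (rdim M i)%:Z.

Lemma eulerE M N : euler (dimz M) (dimz N) =
  (\rank (kermx (Dmx M N)))%:Z - (\sum_a rdim M (qs Q a) * rdim N (qt Q a) - \rank (Dmx M N))%N%:Z.
Proof.
rewrite mxrank_ker -!subzn ?rank_leq_row ?rank_leq_col //.
rewrite opprB subrKA.
have sumz (I : finType) (F : I -> nat) : ((\sum_i F i)%N%:Z : int) = \sum_i (F i)%:Z.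
  by rewrite (big_morph Posz PoszD (erefl _)).
by rewrite /euler !sumz; congr (_ - _); apply: eq_bigr => i _; rewrite PoszM.
Qed.

Lemma euler_ext0_ge0 M N : ext0 M N -> 0 <= euler (dimz M) (dimz N).
Proof.
by move/ext0_full/eqP => e; rewrite eulerE e subnn subr0.
Qed.

Lemma euler_ext0_gt0 M N (f : hom M N) i : ext0 M N -> is_hom f -> f i != 0 ->
  0 < euler (dimz M) (dimz N).
Proof.
move/ext0_full/eqP => e hf fi; rewrite eulerE e subnn subr0 ltz_nat lt0n mxrank_eq0.
apply/eqP => k0; move/diff_is_hom/sub_kermxP: hf; rewrite k0 submx0.
by move/eqP/pack_eq0/(_ i)/eqP; rewrite (negbTE fi).
Qed.

Lemma euler_hom0_le0 M N :
  (forall f : hom M N, is_hom f -> forall i, f i = 0) -> euler (dimz M) (dimz N) <= 0.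
Proof.
move=> h; rewrite eulerE (_ : kermx _ = 0) ?mxrank0 ?sub0r ?oppr_le0 //.
apply/row_matrixP => k; rewrite row0 -[LHS]unpackK; apply/pack_eq0 => i.
by apply: (h (unpack _)); apply/diff_is_hom; rewrite unpackK -row_mul mulmx_ker row0.
Qed.

Lemma euler_hom0_ext0 M N : ext0 M N ->
  (forall f : hom M N, is_hom f -> forall i, f i = 0) -> euler (dimz M) (dimz N) = 0.
Proof.
by move=> e h; apply/le_anti; rewrite euler_hom0_le0 // euler_ext0_ge0.
Qed.

Lemma euler_gt0_hom M N : 0 < euler (dimz M) (dimz N) ->
  exists (f : hom M N) i, is_hom f /\ f i != 0.
Proof.
move=> h; apply: NNPP => nh; have : euler (dimz M) (dimz N) <= 0.
  apply: euler_hom0_le0 => f hf i; apply/eqP; case: eqP => // /eqP fi.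
  by case: nh; exists f, i.
by rewrite leNgt h.
Qed.

Lemma euler_scalar X : ext0 X X -> nonzero X ->
  (forall f : hom X X, is_hom f -> exists c, forall i, f i = c%:M) ->
  euler (dimz X) (dimz X) = 1.
Proof.
move=> rX [i hi] sc; have gt0 : 0 < euler (dimz X) (dimz X).
  apply: (@euler_ext0_gt0 _ _ (hid X) i) => //; first exact: is_hom_id.
  by rewrite -mxrank_eq0 mxrank1 -lt0n.
move: gt0; rewrite eulerE; move/ext0_full/eqP: rX => ->; rewrite subnn subr0 ltz_nat => gt0.
congr Posz; apply/eqP; rewrite eqn_leq gt0 andbT.
have : (kermx (Dmx X X) <= pack (hid X))%MS.
  apply/row_subP => k; have hk : is_hom (unpack (row k (kermx (Dmx X X))) : hom X X).
    by apply/diff_is_hom; rewrite unpackK -row_mul mulmx_ker row0.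
  have [c ec] := sc _ hk; apply/submxP; exists c%:M; rewrite mul_scalar_mx -packZ.
  by rewrite -[LHS]unpackK; apply: eq_pack => j; rewrite ec /hid scalemx1.
by move/mxrankS => h; apply: leq_trans h (rank_leq_row _).
Qed.

(** * Approximations and universal extensions *)

(** The components of [f] span Hom(X, T), so every map to [T] is a linear combination of them and
    factors through [f]. *)
Lemma left_approx X T : exists k (f : hom X (copies T k)), is_hom f /\
  forall h : hom X T, is_hom h -> exists h' : hom (copies T k) T,
    is_hom h' /\ forall i, f i *m h' i = h i.
Proof.
have [n [b [hb span]]] := hom_basis X T; exists n.
suff [f [hf ef]] : exists f : hom X (copies T n), is_hom f /\ forall c : nat -> K,
    exists h' : hom (copies T n) T, is_hom h' /\ forall i, f i *m h' i = \sum_(k < n) c k *: b k i.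
  exists f; split=> // h /span [c ec]; have [h' [hh' e]] := ef c.
  by exists h'; split=> // i; rewrite ec e.
elim: n {span} => [|n [f [hf ef]]].
  exists (fun i => 0); split=> [|c]; first exact: is_hom0.
  by exists (fun i => 0); split=> [|i]; [exact: is_hom0 | rewrite mulmx0 big_ord0].
exists (hom_pair (b n) f); split=> [|c]; first exact: is_hom_pair.
have [h' [hh' e']] := ef c.
exists (hom_copair (fun i => c n *: hid T i) h'); split=> [|i].
  by apply: is_hom_copair => //; apply: is_homZ; apply: is_hom_id.
by rewrite mul_row_col e' big_ord_recr /= addrC -scalemxAr mulmx1.
Qed.

Lemma right_approx X T : exists k (f : hom (copies T k) X), is_hom f /\
  forall h : hom T X, is_hom h -> exists h' : hom T (copies T k),
    is_hom h' /\ forall i, h' i *m f i = h i.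
Proof.
have [n [b [hb span]]] := hom_basis T X; exists n.
suff [f [hf ef]] : exists f : hom (copies T n) X, is_hom f /\ forall c : nat -> K,
    exists h' : hom T (copies T n), is_hom h' /\ forall i, h' i *m f i = \sum_(k < n) c k *: b k i.
  exists f; split=> // h /span [c ec]; have [h' [hh' e]] := ef c.
  by exists h'; split=> // i; rewrite ec e.
elim: n {span} => [|n [f [hf ef]]].
  exists (fun i => 0); split=> [|c]; first exact: is_hom0.
  by exists (fun i => 0); split=> [|i]; [exact: is_hom0 | rewrite mulmx0 big_ord0].
exists (hom_copair (b n) f); split=> [|c]; first exact: is_hom_copair.
have [h' [hh' e']] := ef c.
exists (hom_pair (fun i => c n *: hid T i) h'); split=> [|i].
  by apply: is_hom_pair => //; apply: is_homZ; apply: is_hom_id.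
by rewrite mul_row_col e' big_ord_recr /= addrC -scalemxAl mul1mx.
Qed.

Lemma right_approx_copies X T k (f : hom (copies T k) X) : is_hom f ->
  (forall h : hom T X, is_hom h -> exists h' : hom T (copies T k),
    is_hom h' /\ forall i, h' i *m f i = h i) ->
  forall m (h : hom (copies T m) X), is_hom h -> exists h' : hom (copies T m) (copies T k),
    is_hom h' /\ forall i, h' i *m f i = h i.
Proof.
move=> hf ap; elim=> [|m IH] h hh.
  by exists (fun i => 0); split=> [|i]; [exact: is_hom0 | apply/matrixP => [[]]].
have [h1 [hh1 e1]] := ap _ (is_hom_comp (@is_hom_inl _ _ T (copies T m)) hh).
have [h2 [hh2 e2]] := IH _ (is_hom_comp (@is_hom_inr _ _ T (copies T m)) hh).
exists (hom_copair h1 h2); split=> [|i]; first exact: is_hom_copair.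
rewrite mul_col_mx e1 e2 -mul_col_mx -[RHS]mul1mx; congr (_ *m _).
by rewrite -block_mxEv -scalar_mx_block.
Qed.

(** Bongartz's extension, built by gluing on one copy of [T] for each of the spanning cocycles,
    which makes every cocycle with values in [A] a coboundary in [E]. A cocycle with values in [E]
    is first reduced to one with values in [A], using that Ext^1(T, T^k) = 0. *)
Lemma universal_extension T A : ext0 T T -> exists k E (f : hom A E) (g : hom E (copies T k)),
  ses f g /\ ext0 T E.
Proof.
move=> rT; have [n [b span]] := cocycle_basis T A; exists n.
suff [E [f [g [s ef]]]] : exists E (f : hom A E) (g : hom E (copies T n)), ses f g /\
    forall c : nat -> K, exists phi : hom T E, forall a,
      rmap T a *m phi (qt Q a) - phi (qs Q a) *m rmap E a =
      (\sum_(k < n) c k *: b k a) *m f (qt Q a).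
  exists E, f, g; split=> // th; have [hf [hg ex]] := s.
  have [psi epsi] := ext0_copies_r (k := n) rT (fun a => th a *m g (qt Q a)).
  have [u eu] : exists u : hom T E, forall i, u i *m g i = psi i.
    exists (fun i => psi i *m pinv (g i)) => i.
    by rewrite -mulmxA pinv_full ?mulmx1 //; case: (ex i).
  pose th' a := th a - (rmap T a *m u (qt Q a) - u (qs Q a) *m rmap E a).
  have th'g a : th' a *m g (qt Q a) = 0.
    by rewrite mulmxBl mulmxBl -(mulmxA (rmap _ _)) eu -(mulmxA (u _)) hg mulmxA eu epsi subrr.
  have [c ec] := span (fun a => th' a *m pinv (f (qt Q a))).
  have [phi ephi] := ef c; exists (fun i => u i + phi i) => a.
  rewrite mulmxDr mulmxDl opprD addrACA ephi -ec (exactm_lift (ex _) (th'g a)).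
  by rewrite addrC subrK.
elim: n {span} => [|n [E [f [g [s ef]]]]].
  exists A, (hid A), (fun i => 0); split.
    split; first exact: is_hom_id.
    split; first exact: is_hom0.
    move=> i; apply: exactmP; rewrite ?row_free1 ?mulmx0 ?addn0 //.
    by rewrite /row_full mxrank0.
  by move=> c; exists (fun i => 0) => a; rewrite big_ord0 !mul0mx mulmx0 subr0.
have [hf [hg ex]] := s.
have [hi [hp _]] := extrep_ses (fun a => b n a *m f (qt Q a)).
set E' := extrep _ in hi hp; pose i' : hom E E' := fun i => row_mx 0 1%:M.
have hi' : is_hom i' by exact: hi.
exists E', (hcomp f i'), (fun i => block_mx 1%:M 0 0 (g i)); split.
  split; first exact: is_hom_comp.
  split.
    move=> a; rewrite /= !mulmx_block !mulmx0 !mul0mx !addr0 !add0r mulmx1 mul1mx -mulmxA.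
    by rewrite (ses0 s) mulmx0 hg.
  move=> i; have [fi gi _] := ex i; apply: exactmP.
  - apply: row_free_mul => //; apply: (@retract_free _ _ _ _ (col_mx 0 1%:M)).
    by rewrite mul_row_col mulmx0 add0r mulmx1.
  - apply: (@retract_full _ _ _ (block_mx 1%:M 0 0 (pinv (g i)))).
    rewrite mulmx_block !mulmx0 !mul0mx !addr0 !add0r mulmx1 pinv_full //.
    by rewrite -scalar_mx_block.
  - rewrite /hcomp /i' -mulmxA mul_row_block !mulmx0 !mul0mx !mul1mx !add0r.
    by rewrite mul_mx_row mulmx0 (ses0 s) row_mx0.
  - by rewrite /= (ses_dim s) addnCA.
move=> c; have [phi ephi] := ef c.
(* The scalar on the new copy of [T] meets the gluing cocycle [b n] and produces the missing term
   c_n b_n; on that copy itself the two contributions cancel. *)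
exists (fun i => row_mx (- c n *: 1%:M) (phi i)) => a.
rewrite /= mul_mx_row mul_row_block mulmx0 addr0 opp_row_mx add_row_mx.
rewrite big_ord_recr /= /hcomp /i' mulmxA mul_mx_row mulmx0 mulmx1.
rewrite -scalemxAr -!scalemxAl mulmx1 !mul1mx subrr mul_mx_row mulmx0; congr row_mx.
by rewrite opprD addrCA ephi scaleNr opprK mulmxDl -scalemxAl addrC.
Qed.

End Differential.

(** * Matrices depending polynomially on a parameter *)

Section PolynomialFunctions.
Variable K : fieldType.

Definition polyfun (F : K -> K) := exists p : {poly K}, forall t, F t = p.[t].

Lemma polyfunC c : polyfun (fun=> c).
Proof. by exists c%:P => t; rewrite hornerC. Qed.
Lemma polyfunX : polyfun id.
Proof. by exists 'X => t; rewrite hornerX. Qed.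
Lemma polyfunD F G : polyfun F -> polyfun G -> polyfun (fun t => F t + G t).
Proof. by move=> [p hp] [q hq]; exists (p + q) => t; rewrite hornerD hp hq. Qed.
Lemma polyfunM F G : polyfun F -> polyfun G -> polyfun (fun t => F t * G t).
Proof. by move=> [p hp] [q hq]; exists (p * q) => t; rewrite hornerM hp hq. Qed.
Lemma polyfunN F : polyfun F -> polyfun (fun t => - F t).
Proof. by move=> [p hp]; exists (- p) => t; rewrite hornerN hp. Qed.
Lemma polyfun_eq F G : F =1 G -> polyfun F -> polyfun G.
Proof. by move=> e [p hp]; exists p => t; rewrite -e. Qed.

Lemma polyfun_sum (I : Type) (r : seq I) (P : pred I) (F : I -> K -> K) :
  (forall i, polyfun (F i)) -> polyfun (fun t => \sum_(i <- r | P i) F i t).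
Proof.
move=> h; elim: r => [|i r IH].
  by apply: polyfun_eq (polyfunC 0) => t; rewrite big_nil.
case Pi: (P i); last by apply: polyfun_eq IH => t; rewrite big_cons Pi.
by apply: polyfun_eq (polyfunD (h i) IH) => t; rewrite big_cons Pi.
Qed.

Lemma polyfun_prod (I : Type) (r : seq I) (P : pred I) (F : I -> K -> K) :
  (forall i, polyfun (F i)) -> polyfun (fun t => \prod_(i <- r | P i) F i t).
Proof.
move=> h; elim: r => [|i r IH].
  by apply: polyfun_eq (polyfunC 1) => t; rewrite big_nil.
case Pi: (P i); last by apply: polyfun_eq IH => t; rewrite big_cons Pi.
by apply: polyfun_eq (polyfunM (h i) IH) => t; rewrite big_cons Pi.
Qed.

Definition polyfunmx m n (F : K -> 'M[K]_(m, n)) := forall i j, polyfun (fun t => F t i j).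

Lemma polyfunmxC m n (A : 'M[K]_(m, n)) : polyfunmx (fun=> A).
Proof. by move=> i j; apply: polyfunC. Qed.

Lemma polyfunmx_mul m n k (F : K -> 'M[K]_(m, n)) (G : K -> 'M[K]_(n, k)) :
  polyfunmx F -> polyfunmx G -> polyfunmx (fun t => F t *m G t).
Proof.
move=> hF hG i j; apply: (@polyfun_eq (fun t => \sum_l F t i l * G t l j)).
  by move=> t; rewrite mxE.
by apply: polyfun_sum => l; apply: polyfunM.
Qed.

Lemma polyfunmxD m n (F G : K -> 'M[K]_(m, n)) :
  polyfunmx F -> polyfunmx G -> polyfunmx (fun t => F t + G t).
Proof.
move=> hF hG i j; apply: polyfun_eq (polyfunD (hF i j) (hG i j)).
by move=> t; rewrite mxE.
Qed.

Lemma polyfunmxN m n (F : K -> 'M[K]_(m, n)) : polyfunmx F -> polyfunmx (fun t => - F t).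
Proof. by move=> hF i j; apply: polyfun_eq (polyfunN (hF i j)) => t; rewrite mxE. Qed.

Lemma polyfunmxZ m n f (F : K -> 'M[K]_(m, n)) :
  polyfun f -> polyfunmx F -> polyfunmx (fun t => f t *: F t).
Proof.
by move=> hf hF i j; apply: polyfun_eq (polyfunM hf (hF i j)) => t; rewrite mxE.
Qed.

Lemma polyfun_det n (F : K -> 'M[K]_n) : polyfunmx F -> polyfun (fun t => \det (F t)).
Proof.
move=> hF; apply: polyfun_sum => s; apply: polyfunM; first exact: polyfunC.
by apply: polyfun_prod => i.
Qed.

Lemma polyfunmx_adj n (F : K -> 'M[K]_n) : polyfunmx F -> polyfunmx (fun t => \adj (F t)).
Proof.
move=> hF i j; apply: (@polyfun_eq (fun t => cofactor (F t) j i)).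
  by move=> t; rewrite mxE.
apply: polyfunM; first exact: polyfunC.
apply: polyfun_det => r s; apply: polyfun_eq (hF (lift j r) (lift i s)) => t.
by rewrite !mxE.
Qed.

End PolynomialFunctions.

(** * A rigid representation is determined by its dimension vector *)

Section RigidUnique.
Variables (Q : quiver).

(* [U] is isomorphic to a generic member of any line through it in the
   representation space: the identity is corrected to a homomorphism [U -> M_t]
   depending polynomially on [t]. *)
Lemma rigid_generic (K : fieldType) (d : 'I_(qn Q) -> nat)
    (u v : forall a, 'M[K]_(d (qs Q a), d (qt Q a))) :
  ext0 (@Rep K Q d u) (@Rep K Q d u) ->
  exists p : {poly K}, p != 0 /\ forall t, ~~ root p t ->
    iso (@Rep K Q d u) (@Rep K Q d (fun a => (1 - t) *: u a + t *: v a)).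
Proof.
set U := @Rep K Q d u; set V := @Rep K Q d v => /ext0_full f0.
pose W t := @Rep K Q d (fun a => (1 - t) *: u a + t *: v a).
pose D t := (1 - t) *: Dmx U U + t *: Dmx U V.
have DE t x : x *m D t = pack (@diff K Q U (W t) (unpack x)).
  rewrite mulmxDr -!scalemxAr (DmxE (N := U)) (DmxE (N := V)).
  transitivity (@pack K _ (fun a => d (qs Q a)) (fun a => d (qt Q a))
    (fun a => (1 - t) *: @diff K Q U U (unpack x) a + t *: @diff K Q U V (unpack x) a)).
    have z1 := packZ (p := fun a => d (qs Q a)) (q := fun a => d (qt Q a)) (1 - t)
      (@diff K Q U U (unpack x)).
    have z2 := packZ (p := fun a => d (qs Q a)) (q := fun a => d (qt Q a)) t
      (@diff K Q U V (unpack x)).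
    exact: (esym (etrans (packD _ _) (congr2 +%R z1 z2))).
  apply: eq_pack => a.
  rewrite /diff /= !scalerBr addrACA -scalerDl subrK scale1r -opprD.
  by rewrite mulmxDr -!scalemxAr.
set B := pinv (Dmx U U); pose S t := B *m D t; pose e := pack (hid U).
(* When [S t] is invertible, e - e D S^-1 B is a correction of the identity [e] that is killed by D;
   the factor det S clears the denominator by Cramer's rule. At t = 0, [S] is the identity and [e]
   is already a homomorphism, so F 0 = e. *)
pose F t := \det (S t) *: e - e *m D t *m \adj (S t) *m B.
have FD t : F t *m D t = 0.
  rewrite mulmxBl -scalemxAl -!mulmxA -/(S t) mul_adj_mx !mulmxA.
  by rewrite mul_mx_scalar subrr.
have pD : polyfunmx D.
  apply: polyfunmxD; apply: polyfunmxZ; try exact: polyfunmxC; last exact: polyfunX.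
  by apply: polyfunD; [exact: polyfunC | apply: polyfunN; exact: polyfunX].
have pS : polyfunmx S by apply: polyfunmx_mul => //; apply: polyfunmxC.
have pF : polyfunmx F.
  apply: polyfunmxD; first by apply: polyfunmxZ; [exact: polyfun_det | exact: polyfunmxC].
  apply: polyfunmxN; apply: polyfunmx_mul; last exact: polyfunmxC.
  apply: polyfunmx_mul; last exact: polyfunmx_adj.
  by apply: polyfunmx_mul => //; apply: polyfunmxC.
pose f t : hom U (W t) := unpack (F t).
have [p hp] : polyfun (fun t => \prod_i \det (unpack (F t) i : 'M[K]_(d i))).
  apply: polyfun_prod => i; apply: polyfun_det => r s.
  apply: (@polyfun_eq _ (fun t => \sum_k F t 0 k * (unpack (delta_mx 0 k) i : 'M[K]_(d i)) r s)).
    move=> t; rewrite [F t in RHS]row_sum_delta unpack_sum summxE.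
    by apply: eq_bigr => k _; rewrite unpackZ [in RHS]mxE.
  by apply: polyfun_sum => k; apply: polyfunM => //; apply: polyfunC.
exists p; split.
  apply/eqP => p0; have := hp 0; rewrite p0 horner0.
  have D0 : D 0 = Dmx U U by rewrite /D subr0 scale1r scale0r addr0.
  have S0 : S 0 = 1%:M by rewrite /S D0 /B pinv_full.
  have F0 : F 0 = e.
    rewrite /F S0 det1 scale1r D0 (proj1 (diff_is_hom (hid U))) ?mul0mx ?subr0 //.
    exact: is_hom_id.
  rewrite big1 => [/eqP|i _]; first by rewrite oner_eq0.
  by rewrite F0 packK /hid det1.
move=> t; rewrite rootE -hp => nz; apply: (@inj_dim_iso _ _ _ _ (f t)) => //.
  have := FD t; rewrite DE => /pack_eq0 h a.
  by have /eqP := h a; rewrite subr_eq0 => /eqP.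
move=> i; rewrite row_free_unit unitmxE unitfE.
by apply: contra nz => h; apply/prodf_eq0; exists i.
Qed.

(** The line from [M] to [N] is also the line from [N] to [M] with parameter 1 - t. An algebraically
    closed field has a parameter avoiding the roots of both polynomials, and that point of the line
    is isomorphic to both ends. *)
Lemma rigid_iso (K : closedFieldType) (M N : rep K Q) :
  ext0 M M -> ext0 N N -> (forall i, rdim M i = rdim N i) -> iso M N.
Proof.
case: M N => d u [d' v] /= rM rN e.
have e' : d = d' by apply: functional_extensionality.
subst d'; have [p [p0 hp]] := rigid_generic v rM.
have [q [q0 hq]] := rigid_generic u rN.
(* Substituting 1 - X twice gives [q] back, so the substituted polynomial is nonzero. *)
have pq0 : p * (q \Po (1 - 'X)) != 0.
  rewrite mulf_neq0 //; apply: contra q0 => /eqP h.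
  have := comp_polyA q (1 - 'X) (1 - 'X); rewrite h comp_poly0.
  by rewrite comp_polyB comp_polyC comp_polyX opprB addrCA subrr addr0 comp_polyXr => <-.
have /closed_nonrootP [t] := pq0; rewrite rootM negb_or => /andP[h1 h2].
have {}h2 : ~~ root q (1 - t).
  by move: h2; rewrite !rootE horner_comp !hornerE.
apply: iso_trans (hp _ h1) _; apply: iso_sym.
have := hq _ h2; rewrite subKr; congr iso; congr Rep.
by apply: functional_extensionality_dep => a; rewrite addrC.
Qed.

End RigidUnique.

(** * Paths in an acyclic quiver *)

Section Paths.
Variable (Q : quiver).
Implicit Types (p : seq 'I_(qm Q)) (a : 'I_(qm Q)).

Lemma is_pathn_cat i p p' j : is_pathn Q i (p ++ p') j ->
  exists k, is_pathn Q i p k && is_pathn Q k p' j.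
Proof.
elim: p i => [|a p IH] i /=; first by move=> h; exists i; rewrite eqxx.
by case/andP=> -> /IH[k hk]; exists k.
Qed.

Lemma is_pathn_rcons i p a j :
  is_pathn Q i (rcons p a) j = is_pathn Q i p (qs Q a) && (val (qt Q a) == j).
Proof. by elim: p i => [|b p IH] i /=; rewrite ?IH ?andbA // [val _ == i]eq_sym. Qed.

Lemma not_uniq_split (T : eqType) (s : seq T) : ~~ uniq s ->
  exists s1 x s2 s3, s = s1 ++ (x :: s2) ++ x :: s3.
Proof.
elim: s => //= x s IH; rewrite negb_and negbK => /orP[/splitPr[s2 s3]|/IH].
  by exists [::], x, s2, s3.
by case=> [s1 [y [s2 [s3 ->]]]]; exists (x :: s1), y, s2, s3.
Qed.

(** A repeated arrow would close a cycle, so the arrows of a path are distinct. Hence the cut-off at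
    length [qm Q] in [paths_to] loses no path. *)
Lemma acyclic_path_size i p j : acyclic Q -> is_pathn Q i p j -> (size p <= qm Q)%N.
Proof.
move=> ac hp; have : uniq p.
  apply/negPn/negP => /not_uniq_split[s1 [x [s2 [s3 e]]]].
  move: hp; rewrite e => /is_pathn_cat[k /andP[_]] /is_pathn_cat[l /andP[h1 h2]].
  have /= /andP[/eqP hk _] := h1; have /= /andP[/eqP hl _] := h2.
  have /negP := ac (qs Q x) (x :: s2) isT; apply.
  by rewrite -hk -hl in h1.
move/card_uniqP => <-; apply: leq_trans (max_card _) _; by rewrite card_ord.
Qed.

Lemma mem_allseq m L (s : seq 'I_m) : (s \in allseq m L) = (size s <= L)%N.
Proof.
elim: L s => [|L IH] [|x s] //=; rewrite inE /=.
apply/allpairsP/idP => [[[y t] /= [_ ht [_ ->]]]|h].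
  by rewrite ltnS -IH.
by exists (x, s); rewrite mem_enum IH.
Qed.

Lemma uniq_allseq m L : uniq (allseq m L).
Proof.
elim: L => //= L IH; apply/andP; split.
  by apply/negP => /allpairsP[[y t] /= [_ _]].
by apply: allpairs_uniq => //; [exact: enum_uniq | move=> [x s] [y t] _ _ /= [-> ->]].
Qed.

Lemma uniq_paths_to j : uniq (@paths_to Q j).
Proof.
apply: allpairs_uniq_dep; first exact: enum_uniq.
  by move=> i _; apply: filter_uniq; apply: uniq_allseq.
by move=> [i p] [i' p'] /= _ _ [/val_inj -> ->].
Qed.

Lemma mem_paths_to k p (j : 'I_(qn Q)) : acyclic Q ->
  reflect (exists2 i : 'I_(qn Q), k = val i & is_pathn Q k p j) ((k, p) \in @paths_to Q j).
Proof.
move=> ac; apply: (iffP allpairsPdep) => [[i [q [_]]]|[i -> hp]].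
  by rewrite mem_filter => /andP[hq _] [-> ->]; exists i.
exists i, p; split=> //; first exact: mem_enum.
by rewrite mem_filter hp mem_allseq (acyclic_path_size ac hp).
Qed.

(** If every vertex of [B] had a predecessor in [B], walking backwards would give paths of every
    length. *)
Lemma source_vertex (B : pred 'I_(qn Q)) b0 : acyclic Q -> B b0 ->
  exists2 b, B b & forall a, qt Q a = b -> ~~ B (qs Q a).
Proof.
move=> ac hb0; apply: NNPP => h.
have back b : B b -> exists2 a, qt Q a = b & B (qs Q a).
  move=> hb; apply: NNPP => h'; apply: h; exists b => // a e.
  by apply/negP => hB; apply: h'; exists a.
have paths k : exists (i : 'I_(qn Q)) p, [/\ B i, size p = k & is_pathn Q i p b0].
  elim: k => [|k [i [p [hi sp hp]]]]; first by exists b0, [::]; rewrite /= eqxx.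
  have [a ta ba] := back _ hi; exists (qs Q a), (a :: p); split=> //=; first by rewrite sp.
  by rewrite eqxx ta.
have [i [p [_ sp /(acyclic_path_size ac)]]] := paths (qm Q).+1.
by rewrite sp ltnn.
Qed.

End Paths.

(** * The regular representation: projectivity and generation *)

Section RegularRep.
Variables (K : fieldType) (Q : quiver).
Hypothesis ac : acyclic Q.
Local Notation rep := (rep K Q).
Local Notation A := (regular_rep K Q).
Implicit Types (M N P X Y Z E T : rep).

Definition fam N := forall i, 'rV[K]_(rdim N i).

(** The result is supported at the target of [a], where the equality of vertices transports it, and
    is 0 elsewhere. Acting on a whole family, with a vector at every vertex, lets a path act by a
    plain [foldl] although its steps live in different spaces. *)
Definition famact N (n : fam N) (a : 'I_(qm Q)) : fam N := fun j =>
  match eqP (x := qt Q a) (y := j) with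
  | ReflectT e => eq_rect (qt Q a) (fun k => 'rV[K]_(rdim N k)) (n (qs Q a) *m rmap N a) j e
  | ReflectF _ => 0
  end.

Lemma famactE N (n : fam N) a : famact n a (qt Q a) = n (qs Q a) *m rmap N a.
Proof. by rewrite /famact; case: eqP => // e; rewrite (eq_axiomK e). Qed.

Definition pathvec j (x : nat * seq 'I_(qm Q)) : 'rV[K]_(rdim A j) :=
  \row_c (nth (0%N, [::]) (paths_to j) c == x)%:R.

Lemma row1_pathvec j r : row r 1%:M = pathvec j (nth (0%N, [::]) (paths_to j) r).
Proof.
apply/rowP => c; rewrite !mxE nth_uniq ?uniq_paths_to //.
by rewrite (inj_eq val_inj) eq_sym.
Qed.

Lemma pathvec_row j x : x \in paths_to j -> exists r, 
  x = nth (0%N, [::]) (paths_to j) (val (r : 'I_(rdim A j))).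
Proof.
move=> h; have hi : (index x (paths_to j) < rdim A j)%N by rewrite /= index_mem.
by exists (Ordinal hi); rewrite /= nth_index.
Qed.

Lemma pathvec_map a x : x \in paths_to (qs Q a) ->
  pathvec (qs Q a) x *m rmap A a = pathvec (qt Q a) (x.1, rcons x.2 a).
Proof.
move=> /pathvec_row[r ->]; rewrite -row1_pathvec -row_mul mul1mx.
by apply/rowP => c; rewrite !mxE.
Qed.

(** The homomorphism from the regular representation prescribed on trivial paths: a path goes to the
    vector obtained by acting along its arrows, read off at its end. *)
Definition homA N (n : fam N) : hom A N := fun j =>
  \matrix_(r < rdim A j) foldl (@famact N) n (nth (0%N, [::]) (paths_to j) r).2 j.

Lemma pathvec_hom N (n : fam N) j x : x \in paths_to j ->
  pathvec j x *m homA n j = foldl (@famact N) n x.2 j.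
Proof. by move=> /pathvec_row[r ->]; rewrite -row1_pathvec -row_mul mul1mx rowK. Qed.

Lemma mem_paths_rcons a x : x \in paths_to (qs Q a) -> (x.1, rcons x.2 a) \in paths_to (qt Q a).
Proof.
case: x => k p /= /(mem_paths_to _ _ _ ac)[i e h].
by apply/(mem_paths_to _ _ _ ac); exists i; rewrite // is_pathn_rcons h /=.
Qed.

Lemma is_hom_homA N (n : fam N) : is_hom (homA n).
Proof.
move=> a; apply/row_matrixP => r; rewrite -[rmap A a]mul1mx !row_mul row1_pathvec.
set x := nth _ _ _; have hx : x \in paths_to (qs Q a) by apply: mem_nth; apply: (ltn_ord r).
rewrite pathvec_map // pathvec_hom ?mem_paths_rcons //= foldl_rcons famactE.
by rewrite -[homA n (qs Q a)]mul1mx row_mul row1_pathvec pathvec_hom.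
Qed.

Definition trivial_path j := pathvec j (val j, [::]).

Lemma mem_trivial j : (val j, [::]) \in @paths_to Q j.
Proof. by apply/(mem_paths_to _ _ _ ac); exists j; rewrite //= eqxx. Qed.

Lemma trivial_homA N (n : fam N) j : trivial_path j *m homA n j = n j.
Proof. by rewrite /trivial_path pathvec_hom ?mem_trivial. Qed.

Lemma homA_eq0 N (f : hom A N) : is_hom f -> (forall j, trivial_path j *m f j = 0) ->
  forall j, f j = 0.
Proof.
move=> hf f0 j; apply/row_matrixP => r; rewrite row0 -[f j]mul1mx row_mul row1_pathvec.
have : nth (0%N, [::]) (paths_to j) r \in paths_to j by apply: mem_nth; apply: (ltn_ord r).
case: (nth _ _ _) => i p; elim/last_ind: p j {r} => [|p a IH] j.
  by case/(mem_paths_to _ _ _ ac) => k _ /= /eqP ->; apply: f0.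
case/(mem_paths_to _ _ _ ac) => k ek; rewrite is_pathn_rcons => /andP[hp /eqP /val_inj <-].
have hx : (i, p) \in paths_to (qs Q a) by apply/(mem_paths_to _ _ _ ac); exists k.
by rewrite -(pathvec_map hx) -mulmxA hf mulmxA IH // mul0mx.
Qed.

(** A homomorphism from [A] is determined by the images of the trivial paths, and these can be
    lifted along [g] independently of each other. *)
Lemma regular_lift M N (g : hom M N) (h : hom A N) : is_hom g -> hom_surj g -> is_hom h ->
  exists l : hom A M, is_hom l /\ forall i, l i *m g i = h i.
Proof.
move=> hg sg hh; pose n i := trivial_path i *m h i *m pinv (g i).
exists (homA n); split=> [|i]; first exact: is_hom_homA.
apply/eqP; rewrite -subr_eq0; apply/eqP.
have hd : is_hom (fun i => hcomp (homA n) g i - h i).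
  by apply: is_homB => //; apply: is_hom_comp => //; apply: is_hom_homA.
apply: (homA_eq0 hd) => j; rewrite mulmxBr /hcomp mulmxA trivial_homA /n.
by rewrite -(mulmxA _ (pinv _)) pinv_full // mulmx1 subrr.
Qed.

Lemma regular_ext0 N : ext0 A N.
Proof.
apply/ext1_zeroP => E f g [hf [hg ex]].
have [|l [hl e]] := regular_lift hg _ (@is_hom_id _ _ A); last by exists l.
by move=> i; case: (ex i).
Qed.

Lemma regular_gen N : exists k (h : hom (copies A k) N), is_hom h /\ hom_surj h.
Proof.
(* The r-th family takes the r-th basis vector at each vertex, and 0 where there is none; [tdim N]
   families reach all basis vectors. *)
pose n (r : nat) : fam N := fun i => if insub r is Some r' then row r' 1%:M else 0.
suff H k : exists h : hom (copies A k) N, is_hom h /\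
    forall r j, (r < k)%N -> (n r j <= h j)%MS.
  have [h [hh e]] := H (tdim N); exists (tdim N), h; split=> // j.
  rewrite -sub1mx; apply/row_subP => r; have := e r j; rewrite /n valK; apply.
  by apply: leq_trans (ltn_ord r) _; rewrite /tdim (bigD1 j) //= leq_addr.
elim: k => [|k [h [hh e]]]; first by exists (fun i => 0); split; [exact: is_hom0 |].
exists (hom_copair (homA (n k)) h); split.
  by apply: is_hom_copair => //; apply: is_hom_homA.
have sub j : (homA (n k) j <= hom_copair (homA (n k)) h j)%MS /\ (h j <= hom_copair (homA (n k)) h j)%MS.
  by rewrite /hom_copair -!addsmxE addsmxSl addsmxSr.
move=> r j; rewrite ltnS leq_eqVlt => /orP[/eqP->|hr].
  by apply: submx_trans (sub j).1; rewrite -trivial_homA submxMl.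
by apply: submx_trans (sub j).2; apply: e.
Qed.

Lemma projective_of_ext0 P : (forall N, ext0 P N) -> projective P.
Proof.
move=> hP M N g h hg sg hh; have [X [f s]] := exists_ker_ses hg sg.
exact: hom_lift s (hP X) hh.
Qed.

(** The kernel of a free cover is itself projective, since vanishing of Ext^1 in the first argument
    passes to subrepresentations. *)
Lemma resolution N : exists k U (f : hom U (copies A k)) (g : hom (copies A k) N),
  ses f g /\ forall Y, ext0 U Y.
Proof.
have [k [g [hg sg]]] := regular_gen N; have [U [f s]] := exists_ker_ses hg sg.
exists k, U, f, g; split=> // Y; have [hf [_ ex]] := s; apply: (ext0_sub hf).
  by move=> i; case: (ex i).
by apply: ext0_copies_l; apply: regular_ext0.
Qed.

Lemma pd_le1_all N : pd_le1 N.
Proof.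
have [k [U [f [g [s eU]]]]] := resolution N; exists (copies A k), U, f, g; split.
  by apply: projective_of_ext0 => Y; apply: ext0_copies_l; apply: regular_ext0.
by split=> //; apply: projective_of_ext0.
Qed.

Lemma regular_hom_neq0 N : nonzero N -> exists (f : hom A N) i, is_hom f /\ f i != 0.
Proof.
move=> [i hi]; pose n : fam N := fun j => const_mx 1.
exists (homA n), i; split; first exact: is_hom_homA.
apply/eqP => e; have := trivial_homA n i; rewrite e mulmx0 => /rowP/(_ (Ordinal hi)).
by rewrite !mxE => /eqP; rewrite eq_sym oner_eq0.
Qed.

Definition simple_rep b : rep := @Rep K Q (fun i => (i == b) : nat) (fun a => 0).

Lemma eulerEr (x y : 'I_(qn Q) -> int) :
  euler x y = \sum_b y b * (x b - \sum_(a | qt Q a == b) x (qs Q a)).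
Proof.
rewrite /euler; under [RHS]eq_bigr => b _ do rewrite mulrBr.
rewrite sumrB; congr (_ - _); first by apply: eq_bigr => i _; rewrite mulrC.
rewrite (partition_big (qt Q) predT) //=; apply: eq_bigr => b _.
by rewrite mulr_sumr; apply: eq_bigr => a /eqP <-; rewrite mulrC.
Qed.

(* A representation with no extensions is projective, and has a simple quotient
   at each vertex receiving no arrow from its support. *)
Lemma projective_hom_sincere N M : nonzero N -> (forall Y, ext0 N Y) ->
  (forall i, (0 < rdim M i)%N) -> exists (f : hom N M) i, is_hom f /\ f i != 0.
Proof.
move=> [b0 hb0] eN sM; apply: euler_gt0_hom; rewrite eulerEr.
(* [c b] is the Euler form of [N] with the simple at [b], nonnegative because [N] has no extensions.
   At a source of the support of [N] it equals the dimension of [N], and sincerity of [M] makes that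
   term of the sum positive. *)
pose c b := dimz N b - \sum_(a | qt Q a == b) dimz N (qs Q a).
have c0 b : 0 <= c b.
  suff <- : euler (dimz N) (dimz (simple_rep b)) = c b by apply: euler_ext0_ge0.
  rewrite eulerEr (bigD1 b) //= -[RHS]addr0; congr (_ + _).
    by rewrite {1}/dimz /= eqxx mul1r.
  by apply: big1 => i nb; rewrite {1}/dimz /= (negbTE nb) mul0r.
have [b hb src] := @source_vertex Q (fun i => (0 < rdim N i)%N) b0 ac hb0.
rewrite (bigD1 b) //= ltr_wpDr //; last first.
  apply: mulr_gt0; first by rewrite /dimz ltz_nat.
  rewrite big1 ?subr0 /dimz ?ltz_nat // => a /eqP /src.
  by rewrite -eqn0Ngt => /eqP ->.
by apply: sumr_ge0 => i _; apply: mulr_ge0 => //; apply: c0.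
Qed.

End RegularRep.

(** * Tilting modules and generation of the lattice of dimension vectors *)

Section Tilting.
Variables (K : closedFieldType) (Q : quiver).
Hypothesis ac : acyclic Q.
Local Notation rep := (rep K Q).
Local Notation A := (regular_rep K Q).
Local Notation nthr := (nth (zero_rep K Q)).
Implicit Types (M N P X Y Z E F T : rep) (L : seq rep).

Definition coresolves T := exists (T1 T2 : rep) (f : hom A T1) (g : hom T1 T2),
  [/\ inadd T T1, inadd T T2 & ses f g].

Lemma tiltingP T : tilting T <-> ext0 T T /\ coresolves T.
Proof.
split=> [[_ /ext1_zeroP rT [T1 [T2 [f [g [/in_addP h1 [/in_addP h2 s]]]]]]]|].
  by split=> //; exists T1, T2, f, g.
move=> [rT [T1 [T2 [f [g [h1 h2 s]]]]]]; split; first exact: pd_le1_all.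
  exact/ext1_zeroP.
by exists T1, T2, f, g; split; [apply/in_addP | split; [apply/in_addP |]].
Qed.

(** A cover of [N] by copies of [A] extends along the coresolution to copies of [T1], as the
    obstruction lies in Ext^1 of copies of [T2] with [N]. *)
Lemma tilting_gen T N : coresolves T -> ext0 T N ->
  exists k (h : hom (copies T k) N), is_hom h /\ hom_surj h.
Proof.
move=> [T1 [T2 [f [g [a1 a2 s]]]]] eN; have [k [h [hh sh]]] := regular_gen ac N.
have [f' [g' s']] := copies_ses k s.
have [h' [hh' e]] := hom_ext s' (ext0_copies_l (k := k) (ext0_inadd_l a2 eN)) hh.
have [m [u [v [hu hv ev]]]] := inadd_copies k a1.
exists m, (hcomp v h'); split=> [|i]; first exact: is_hom_comp.
apply: row_full_mul; first exact: retract_full (ev i).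
by apply: (@row_full_of_mul _ _ _ _ (f' i)); rewrite e.
Qed.

(** The kernel of the right approximation has no extensions by [T], so it is generated by [T]; then
    [N] has no extensions with it either, and the approximation splits. *)
Lemma tilting_add T N : ext0 T T -> coresolves T -> ext0 T N -> ext0 N T -> inadd T N.
Proof.
move=> rT cT eTN eNT; have [k [f [hf ap]]] := right_approx N T.
have sf : hom_surj f.
  have [m [h [hh sh]]] := tilting_gen cT eTN.
  have [h' [_ e]] := right_approx_copies hf ap hh.
  by move=> i; apply: (@row_full_of_mul _ _ _ _ (h' i)); rewrite e.
have [N1 [j s]] := exists_ker_ses hf sf.
have e1 : ext0 T N1 by apply: (ext0_ker s) => //; apply: ext0_copies_r.
have [m [h [hh sh]]] := tilting_gen cT e1.
have e2 : ext0 N N1 by apply: (ext0_quot hh) => //; apply: ext0_copies_r.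
exists k; apply: retract_trans (retract_inl N N1) _.
by apply: iso_retract; apply: ses_split_ext s e2.
Qed.

Lemma left_approx_copies X T k (f : hom X (copies T k)) : is_hom f ->
  (forall h : hom X T, is_hom h -> exists h' : hom (copies T k) T,
    is_hom h' /\ forall i, f i *m h' i = h i) ->
  forall m (h : hom X (copies T m)), is_hom h -> exists h' : hom (copies T k) (copies T m),
    is_hom h' /\ forall i, f i *m h' i = h i.
Proof.
move=> hf ap; elim=> [|m IH] h hh.
  exists (fun i => 0); split=> [|i]; first exact: is_hom0.
  by apply/matrixP => r [].
have [h1 [hh1 e1]] := ap _ (is_hom_comp hh (@is_hom_fst _ _ T (copies T m))).
have [h2 [hh2 e2]] := IH _ (is_hom_comp hh (@is_hom_snd _ _ T (copies T m))).
exists (hom_pair h1 h2); split=> [|i]; first exact: is_hom_pair.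
rewrite mul_mx_row e1 e2 -mul_mx_row -[RHS]mulmx1; congr (_ *m _).
by rewrite -block_mxEh -scalar_mx_block.
Qed.

(** Embedding [X] into copies of [A], and these into add T, shows that the left approximation is
    injective. Its cokernel is compatible with [T] on both sides, hence in add T. *)
Lemma tilting_submodule_dim T X k (j : hom X (copies A k)) :
  ext0 T T -> coresolves T -> is_hom j -> hom_inj j -> 
  exists T1 T2, [/\ inadd T T1, inadd T T2 & forall i, rdim T1 i = (rdim X i + rdim T2 i)%N].
Proof.
move=> rT cT hj ij; have [m [f [hf ap]]] := left_approx X T.
have jf : hom_inj f.
  have [T1 [T2 [u [v [a1 a2 s]]]]] := cT; have [u' [v' s']] := copies_ses k s.
  have [l [w [z [hw hz ew]]]] := inadd_copies k a1; have [hu' [_ ex]] := s'.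
  have [h' [_ e]] := left_approx_copies hf ap (is_hom_comp (is_hom_comp hj hu') hw).
  move=> i; apply: (@row_free_of_mul _ _ _ _ _ (h' i)); rewrite e.
  apply: row_free_mul; last exact: retract_free (ew i).
  by apply: row_free_mul => //; case: (ex i).
have [C [g s]] := exists_coker_ses hf jf.
exists (copies T m), C; split; last exact: (ses_dim s).
  exact: inadd_copies (inadd_refl T).
have [_ [hg ex]] := s; apply: tilting_add => //.
  apply: (ext0_quot hg); last exact: ext0_copies_r.
  by move=> i; case: (ex i).
by apply: (ext0_coker s) => //; apply: ext0_copies_l.
Qed.

(** * Dimension vectors of the indecomposable summands *)

Definition coords L N (c : nat -> int) :=
  forall v, dimz N v = \sum_(j < size L) c j * dimz (nthr L j) v.

Definition spans L := forall N, exists c, coords L N c.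

Record brigid L : Prop := BRigid {
  brigid_indec : forall i, (i < size L)%N -> indecomposable (nthr L i);
  brigid_noniso : forall i j, (i < size L)%N -> (j < size L)%N -> i <> j -> ~ iso (nthr L i) (nthr L j);
  brigid_ext0 : ext0 (dsum_list L) (dsum_list L) }.

Lemma indec_iso_of_retract X Y : indecomposable X -> indecomposable Y -> retract X Y -> iso X Y.
Proof. by move=> [nX _] iY r; apply: retract_indec. Qed.

Lemma coordsD L M N c d : coords L M c -> coords L N d ->
  forall X, (forall v, rdim X v = rdim M v + rdim N v)%N -> coords L X (fun j => c j + d j).
Proof.
move=> hM hN X e v; rewrite /dimz e PoszD -!/(dimz _ _) hM hN -big_split /=.
by apply: eq_bigr => j _; rewrite mulrDl.
Qed.

Lemma coordsB L M N c d : coords L M c -> coords L N d ->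
  forall X, (forall v, rdim M v = rdim X v + rdim N v)%N -> coords L X (fun j => c j - d j).
Proof.
move=> hM hN X e v.
have -> : dimz X v = dimz M v - dimz N v by rewrite /dimz e PoszD addrK.
rewrite hM hN -sumrB.
by apply: eq_bigr => j _; rewrite mulrBl.
Qed.

Lemma coords_copies L N c k : coords L N c -> coords L (copies N k) (fun j => k%:Z * c j).
Proof.
move=> h; elim: k => [|k IH].
  by move=> v; rewrite big1 // => j _; rewrite !mul0r.
have := coordsD h IH; move/(_ (copies N k.+1)) => h' v.
rewrite h' //; apply: eq_bigr => j _; congr (_ * _).
by rewrite -[k.+1]add1n PoszD mulrDl mul1r.
Qed.

Lemma coords_nth L i : (i < size L)%N -> coords L (nthr L i) (fun j => (j == i)%:Z).
Proof.
move=> hi v; rewrite (bigD1 (Ordinal hi)) //= eqxx mul1r big1 ?addr0 // => j.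
by rewrite -val_eqE /= => /negbTE ->; rewrite mul0r.
Qed.

Lemma coords_iso L N N' c : iso N N' -> coords L N c -> coords L N' c.
Proof. by move=> e h v; rewrite -h /dimz (iso_dim e). Qed.

Lemma inadd_coords L N : (forall i, (i < size L)%N -> indecomposable (nthr L i)) ->
  inadd (dsum_list L) N -> exists c, coords L N c.
Proof.
move=> iL; have [n] := ubnP (tdim N); elim: n N => // n IH N hn aN.
case: (nonzero_or N) => [nN|z]; last first.
  by exists (fun=> 0) => v; rewrite /dimz z big1 // => j _; rewrite mul0r.
case: (classic (indecomposable N)) => iN.
  have [i hi r] := indec_dsum_list iN (indec_inadd iN aN).
  exists (fun j => (j == i)%:Z); apply: coords_iso (coords_nth hi).
  by apply: iso_sym; apply: indec_iso_of_retract => //; apply: iL.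
have [Y [Z [e nY nZ]]] := decomposable nN iN.
have t := tdim_dsum e; have tY := tdim_gt0 nY; have tZ := tdim_gt0 nZ.
have e' := iso_retract (iso_sym e).
have aY := inadd_retract (retract_trans (retract_inl Y Z) e') aN.
have aZ := inadd_retract (retract_trans (retract_inr Y Z) e') aN.
have [|c hc] := IH Y _ aY.
  by rewrite -ltnS (leq_trans _ hn) // ltnS t -{1}[tdim Y]addn0 ltn_add2l.
have [|d hd] := IH Z _ aZ.
  by rewrite -ltnS (leq_trans _ hn) // ltnS t -{1}[tdim Z]add0n ltn_add2r.
by exists (fun j => c j + d j); apply: coordsD hc hd _ _ => v; rewrite (iso_dim e).
Qed.

Definition mults L (m : nat -> nat) : rep :=
  dsum_list [seq copies (nthr L j) (m j) | j <- iota 0 (size L)].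

Lemma nth_mults L m j : (j < size L)%N ->
  nth (zero_rep K Q) [seq copies (nthr L j) (m j) | j <- iota 0 (size L)] j = copies (nthr L j) (m j).
Proof. by move=> h; rewrite (nth_map 0%N) ?size_iota // nth_iota. Qed.

Lemma rdim_copies X k v : rdim (copies X k) v = (k * rdim X v)%N.
Proof. by elim: k => //= k ->; rewrite mulSn. Qed.

Lemma rdim_mults L m v : rdim (mults L m) v = (\sum_(j < size L) m j * rdim (nthr L j) v)%N.
Proof.
rewrite /mults -(big_mkord predT (fun j => m j * rdim (nthr L j) v)%N) /index_iota subn0.
by elim: (iota _ _) => [|j s IH]; rewrite ?big_nil // big_cons /= IH rdim_copies.
Qed.

Lemma inadd_mults L m M :
  (forall j, (j < size L)%N -> (0 < m j)%N -> inadd M (nthr L j)) -> inadd M (mults L m).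
Proof.
move=> h; apply: inadd_dsum_list => j; rewrite size_map size_iota => hj.
rewrite nth_mults //; case: (posnP (m j)) => [->|h0]; first exact: inadd_zero.
exact: inadd_copies (h j hj h0).
Qed.

Lemma indec_mults X L m : indecomposable X -> retract X (mults L m) ->
  exists j, [/\ (j < size L)%N, (0 < m j)%N & retract X (nthr L j)].
Proof.
move=> iX /(indec_dsum_list iX)[j]; rewrite size_map size_iota => hj.
rewrite nth_mults // => r; exists j; split=> //.
  rewrite lt0n; apply/eqP => m0; move: r; rewrite m0.
  by move/retract_zero_inv; case: iX.
by apply: indec_inadd => //; exists (m j).
Qed.

Definition pos_part (c : int) : nat := if c is Posz n then n else 0%N.
Definition neg_part (c : int) : nat := if c is Negz n then n.+1 else 0%N.

Lemma pos_neg_partB c : c = (pos_part c)%:Z - (neg_part c)%:Z.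
Proof. by case: c => n; rewrite ?subr0 // sub0r NegzE. Qed.

(** Moving the negative coefficients to the side of [F] equates the dimension vectors of two rigid
    sums. They are isomorphic, so [F] is a summand of a sum taken from add M. *)
Lemma add_of_coords L M F d (c : nat -> int) :
  ext0 M M -> ext0 F F -> ext0 F M -> ext0 M F -> (0 < d)%N ->
  (forall v, d%:Z * dimz F v = \sum_(j < size L) c j * dimz (nthr L j) v) ->
  (forall j, (j < size L)%N -> c j <> 0 -> inadd M (nthr L j)) -> inadd M F.
Proof.
move=> rM rF eFM eMF d0 hc hM.
have aP : inadd M (mults L (pos_part \o c)).
  by apply: inadd_mults => j hj /= h; apply: hM => // e; rewrite e in h.
have aN : inadd M (mults L (neg_part \o c)).
  by apply: inadd_mults => j hj /= h; apply: hM => // e; rewrite e in h.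
apply: (inadd_retract _ aP).
apply: (@retract_trans _ _ _ (dsum (copies F d) (mults L (neg_part \o c)))).
  apply: retract_trans (retract_inl _ _).
  by case: d d0 {hc} => // d _; apply: retract_inl.
apply: iso_retract; apply: rigid_iso.
- apply: ext0_dsum_l; apply: ext0_dsum_r.
  + by apply: ext0_copies_l; apply: ext0_copies_r.
  + by apply: ext0_copies_l; apply: (ext0_inadd_r aN).
  + by apply: (ext0_inadd_l aN); apply: ext0_copies_r.
  + by apply: (ext0_inadd_l aN); apply: (ext0_inadd_r aN).
- by apply: (ext0_inadd_l aP); apply: (ext0_inadd_r aP).
move=> v; apply/eqP; rewrite -eqz_nat /= rdim_copies !rdim_mults PoszD PoszM.
rewrite -/(dimz F v) hc !(big_morph Posz PoszD (erefl _)) -big_split /=; apply/eqP.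
apply: eq_bigr => j _; rewrite !PoszM /=; move: (c j) => z.
by rewrite {1}[z]pos_neg_partB mulrBl /dimz subrK.
Qed.

Lemma add_of_spans L F : brigid L -> spans L -> ext0 F F ->
  ext0 F (dsum_list L) -> ext0 (dsum_list L) F -> inadd (dsum_list L) F.
Proof.
move=> bL sL rF e1 e2; have [c hc] := sL F.
apply: (@add_of_coords L _ F 1%N c) => //; first exact: brigid_ext0.
  by move=> v; rewrite mul1r hc.
by move=> j hj _; apply: inadd_of_retract; apply: retract_nth.
Qed.

(** The positive and negative parts of a relation give isomorphic rigid sums with disjoint sets of
    summands. An indecomposable occurring in one would be isomorphic to a different one in the
    other. *)
Lemma brigid_independent L (c : nat -> int) : brigid L ->
  (forall v, \sum_(j < size L) c j * dimz (nthr L j) v = 0) ->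
  forall j, (j < size L)%N -> c j = 0.
Proof.
move=> [iL nL rL] hc.
have rm m : ext0 (mults L m) (mults L m).
  have am : inadd (dsum_list L) (mults L m).
    by apply: inadd_mults => j hj _; apply: inadd_of_retract; apply: retract_nth.
  by apply: (ext0_inadd_l am); apply: (ext0_inadd_r am).
have e : iso (mults L (pos_part \o c)) (mults L (neg_part \o c)).
  apply: rigid_iso => // v; apply/eqP; rewrite -eqz_nat !rdim_mults.
  rewrite -subr_eq0 !(big_morph Posz PoszD (erefl _)) -sumrB -[X in _ == X](hc v).
  apply/eqP; apply: eq_bigr => j _; rewrite !PoszM /=; move: (c j) => z.
  by rewrite [z in RHS]pos_neg_partB mulrBl.
have key m m' : iso (mults L m) (mults L m') -> forall j, (j < size L)%N ->
    (0 < m j)%N -> (0 < m' j)%N.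
  move=> e' j hj mj; have [] := @indec_mults (nthr L j) L m' (iL _ hj).
    apply: retract_trans (iso_retract e').
    apply: (@retract_trans _ _ _ (copies (nthr L j) (m j))).
      by case: (m j) mj => // k _; apply: retract_inl.
    by rewrite -(nth_mults m hj); apply: retract_nth; rewrite size_map size_iota.
  move=> l [hl ml r]; case: (eqVneq l j) => [<- //|/eqP ne].
  have := indec_iso_of_retract (iL _ hj) (iL _ hl) r => /iso_sym.
  by move/(nL _ _ hl hj ne).
move=> j hj; case cj: (c j) => [[|n]|n] //.
  by have := key _ _ e j hj; rewrite /= cj => /(_ isT).
by have := key _ _ (iso_sym e) j hj; rewrite /= cj => /(_ isT).
Qed.

Lemma coords_uniq L N c d : brigid L -> coords L N c -> coords L N d ->
  forall j, (j < size L)%N -> c j = d j.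
Proof.
move=> bL hc hd j hj; apply/eqP; rewrite -subr_eq0; apply/eqP.
apply: (@brigid_independent L (fun j => c j - d j)) => // v.
under eq_bigr => k _ do rewrite mulrBl.
by rewrite sumrB -hc -hd subrr.
Qed.

(** In a resolution of [N] both projective terms embed into free modules, and the dimension vector
    of such a submodule is a difference of two from add T. *)
Lemma tilting_spans T L : iso T (dsum_list L) -> brigid L -> tilting T -> spans L.
Proof.
move=> e [iL nL _] /tiltingP[rT cT] N.
have toL X : inadd T X -> exists c, coords L X c.
  move=> aX; apply: inadd_coords => //; apply: inadd_trans aX.
  by apply: inadd_of_retract; apply: iso_retract.
have [k [U [f [g [s eU]]]]] := resolution ac N; have [hf [_ ex]] := s.
have [|T1 [T2 [a1 a2 e1]]] := tilting_submodule_dim rT cT hf; first by move=> i; case: (ex i).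
have [|T3 [T4 [a3 a4 e2]]] := tilting_submodule_dim rT cT (@is_hom_id _ _ (copies A k)).
  by move=> i; apply: row_free1.
have [c1 h1] := toL _ a1; have [c2 h2] := toL _ a2.
have [c3 h3] := toL _ a3; have [c4 h4] := toL _ a4.
have hU := coordsB h1 h2 e1; have hA := coordsB h3 h4 e2.
by eexists; apply: (coordsB hA hU) => v; rewrite (ses_dim s) addnC.
Qed.

Lemma spans_matrix L : spans L ->
  exists B : 'M[int]_(qn Q, size L), B *m (\matrix_(j, v) dimz (nthr L j) v) = 1%:M.
Proof.
move=> sL; have h b := sL (simple_rep K b).
have [c hc] := fin_all_exists h.
exists (\matrix_(b, j) c b j); apply/matrixP => b v; rewrite !mxE.
transitivity (dimz (simple_rep K b) v); last by rewrite /dimz /= eq_sym; case: eqP.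
by rewrite hc; apply: eq_bigr => j _; rewrite !mxE.
Qed.

(** From B D = 1 follows (D B - 1) D = 0, and independence of the rows of [D] gives D B = 1. The
    traces of the two products are the two sizes. *)
Lemma brigid_spans_size L : brigid L -> spans L -> size L = qn Q.
Proof.
move=> bL /spans_matrix[B hB]; set D := \matrix_(j, v) _ in hB.
have hD : D *m B = 1%:M.
  apply/eqP; rewrite -subr_eq0; apply/eqP/matrixP => i j; rewrite [RHS]mxE.
  pose E := D *m B - 1%:M.
  have E0 : E *m D = 0 by rewrite mulmxBl -mulmxA hB mulmx1 mul1mx subrr.
  pose c k := if insub k is Some k' then E i k' else 0.
  suff : c j = 0 by rewrite /c valK.
  apply: (@brigid_independent L) => // v; transitivity ((E *m D) i v); last by rewrite E0 mxE.
  by rewrite [RHS]mxE; apply: eq_bigr => k _; rewrite /c valK [D k v]mxE.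
have := mxtrace_mulC B D; rewrite hB hD !mxtrace1 => /eqP.
by rewrite eqr_nat => /eqP.
Qed.

(** The universal extension of [A] by copies of [T] is rigid and compatible with [T] on both sides.
    Since the summands generate all dimension vectors, it lies in add T, and the extension is the
    required coresolution. *)
Lemma spans_tilting L : brigid L -> spans L -> tilting (dsum_list L).
Proof.
move=> bL sL; have rL := brigid_ext0 bL; set T := dsum_list L in rL *.
apply/tiltingP; split=> //; have [k [E [f [g [s eTE]]]]] := universal_extension A rL.
have eA := @regular_ext0 K Q ac.
have eET : ext0 E T by apply: (ext0_mid_l s) => //; apply: ext0_copies_l.
have eEE : ext0 E E by apply: (ext0_mid_l s) => //; apply: ext0_copies_l.
exists E, (copies T k), f, g; split=> //; first exact: add_of_spans.
exact: inadd_copies (inadd_refl T).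
Qed.

Lemma basic_tiltingP T : basic_tilting T <->
  exists L, [/\ iso T (dsum_list L), brigid L & spans L].
Proof.
split=> [[[L [e [iL nL]]] tT]|[L [e bL sL]]].
  have rT := (proj1 (tiltingP T) tT).1.
  have bL : brigid L.
    split=> // [i j hi hj /eqP|].
      rewrite neq_ltn => /orP[] h; first by apply: nL; rewrite h.
      by move/iso_sym; apply: nL; rewrite h.
    by apply: ext0_retract_l (iso_retract (iso_sym e)) _; apply: ext0_retract_r (iso_retract (iso_sym e)) _.
  by exists L; split=> //; apply: tilting_spans e bL tT.
split.
  exists L; split=> //; split; first exact: brigid_indec.
  move=> i j /andP[ij hj]; apply: (brigid_noniso bL) => //; first exact: ltn_trans hj.
  by move=> e'; rewrite e' ltnn in ij.
have /tiltingP[rL [T1 [T2 [f [g [a1 a2 s]]]]]] := spans_tilting bL sL.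
have aT : inadd T (dsum_list L) by apply: inadd_of_retract; apply: iso_retract (iso_sym e).
apply/tiltingP; split.
  by apply: ext0_retract_l (iso_retract e) _; apply: ext0_retract_r (iso_retract e) _.
by exists T1, T2, f, g; split=> //; apply: inadd_trans aT _.
Qed.

Lemma basic_tilting_iso T T' : iso T T' -> basic_tilting T -> basic_tilting T'.
Proof.
move=> e /basic_tiltingP[L [e' bL sL]]; apply/basic_tiltingP; exists L; split=> //.
by apply: iso_trans (iso_sym e) e'.
Qed.

Lemma basic_tilting_ext0 T : basic_tilting T -> ext0 T T.
Proof. by move=> [_ [_ /ext1_zeroP]]. Qed.

End Tilting.

(** * Complements of a summand and its replacement *)

Section Exchange.
Variables (K : closedFieldType) (Q : quiver).
Hypothesis ac : acyclic Q.
Local Notation rep := (rep K Q).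
Local Notation A := (regular_rep K Q).
Local Notation nthr := (nth (zero_rep K Q)).
Implicit Types (M N P X Y Z E F T : rep) (L : seq rep).

Definition others L i := [seq (nthr L (bump i j)) | j <- iota 0 (size L).-1].
Definition compl L i := dsum_list (others L i).

Lemma size_others L i : size (others L i) = (size L).-1.
Proof. by rewrite size_map size_iota. Qed.

Lemma nth_others L i j : (j < (size L).-1)%N -> nthr (others L i) j = nthr L (bump i j).
Proof. by move=> h; rewrite (nth_map 0%N) ?size_iota // nth_iota. Qed.

Lemma ltn_bump L i j : (i < size L)%N -> (j < (size L).-1)%N -> (bump i j < size L)%N.
Proof. by rewrite /bump; case: leqP => /=; lia. Qed.

Lemma bump_surj i j n : (i < n)%N -> (j < n)%N -> j <> i -> exists2 k, (k < n.-1)%N & bump i k = j.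
Proof.
case: n => // n hi hj ji; have ji' : j != i by apply/eqP.
exists (unbump i j); last by rewrite unbumpK.
have := @unlift_some n.+1 (Ordinal hi) (Ordinal hj); rewrite -val_eqE /= eq_sym => /(_ ji')[k e _].
by move: (congr1 val e) => /= ->; rewrite bumpK.
Qed.

Section Fixed.
Variables (L : seq rep) (i : nat).
Hypotheses (bL : brigid L) (hi : (i < size L)%N).
Local Notation M := (compl L i).
Local Notation X := (nthr L i).
Local Notation TL := (dsum_list L).

Lemma inadd_compl j : (j < size L)%N -> j <> i -> inadd M (nthr L j).
Proof.
move=> hj ji; have [k hk <-] := bump_surj hi hj ji; apply: inadd_of_retract.
by rewrite -nth_others //; apply: retract_nth; rewrite size_others.
Qed.

Lemma inadd_all_nth j : (j < size L)%N -> inadd TL (nthr L j).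
Proof. by move=> hj; apply: inadd_of_retract; apply: retract_nth. Qed.

Lemma inadd_all_compl : inadd TL M.
Proof.
apply: inadd_dsum_list => j; rewrite size_others => hj; rewrite nth_others //.
by apply: inadd_all_nth; apply: ltn_bump.
Qed.

Lemma compl_notin : ~ inadd M X.
Proof.
have iX := brigid_indec bL hi => aX.
have [j hj r] := indec_dsum_list iX (indec_inadd iX aX).
move: hj r; rewrite size_others => hj; rewrite nth_others // => r.
have hb := ltn_bump hi hj.
apply: (brigid_noniso bL hi hb); last by apply: indec_iso_of_retract r => //; apply: brigid_indec bL _ hb.
by apply/eqP; rewrite neq_bump.
Qed.

Lemma ext0_compl : ext0 M M.
Proof.
by apply: (ext0_inadd_l inadd_all_compl); apply: (ext0_inadd_r inadd_all_compl); apply: brigid_ext0.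
Qed.
Lemma ext0_compl_nth : ext0 M X.
Proof.
by apply: (ext0_inadd_l inadd_all_compl); apply: (ext0_inadd_r (inadd_all_nth hi)); apply: brigid_ext0.
Qed.
Lemma ext0_nth_compl : ext0 X M.
Proof.
by apply: (ext0_inadd_r inadd_all_compl); apply: (ext0_inadd_l (inadd_all_nth hi)); apply: brigid_ext0.
Qed.
Lemma ext0_nth : ext0 X X.
Proof.
by apply: (ext0_inadd_r (inadd_all_nth hi)); apply: (ext0_inadd_l (inadd_all_nth hi)); apply: brigid_ext0.
Qed.

Lemma sum_bump (V : zmodType) (F : nat -> V) :
  \sum_(j < size L) F j = F i + \sum_(j < (size L).-1) F (bump i j).
Proof.
have [n en] : exists n, size L = n.+1 by case: (size L) hi => // n _; exists n.
have hi' : (i < n.+1)%N by rewrite -en.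
by rewrite en (bigD1_ord (Ordinal hi')).
Qed.

Lemma sum_bump_nat (F : nat -> nat) :
  (\sum_(j < size L) F j = F i + \sum_(j < (size L).-1) F (bump i j))%N.
Proof.
have [n en] : exists n, size L = n.+1 by case: (size L) hi => // n _; exists n.
have hi' : (i < n.+1)%N by rewrite -en.
by rewrite en (bigD1_ord (Ordinal hi')).
Qed.

Lemma rdim_dsum_list L' v : rdim (dsum_list L') v = (\sum_(j < size L') rdim (nthr L' j) v)%N.
Proof. by elim: L' => [|Y L' IH]; rewrite ?big_ord0 //= big_ord_recl /= IH. Qed.

(** Both sides are rigid with the same dimension vector, which avoids permuting the summands by
    hand. *)
Lemma iso_dsum_compl : iso TL (dsum M X).
Proof.
apply: rigid_iso; first exact: brigid_ext0.
  apply: ext0_dsum_l; apply: ext0_dsum_r; [exact: ext0_compl | exact: ext0_compl_nth | exact: ext0_nth_compl | exact: ext0_nth].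
move=> v; rewrite /= !rdim_dsum_list (sum_bump_nat (fun j => rdim (nthr L j) v)) addnC size_others; congr (_ + _)%N.
by apply: eq_bigr => j _; rewrite nth_others.
Qed.

Lemma inadd_compl_of_coords F (c : nat -> int) d : ext0 F F -> ext0 F M -> ext0 M F -> (0 < d)%N ->
  (forall v, d%:Z * dimz F v = \sum_(j < size L) c j * dimz (nthr L j) v) ->
  c i = 0 -> inadd M F.
Proof.
move=> rF e1 e2 d0 hc ci; apply: (add_of_coords ext0_compl rF e1 e2 d0 hc) => j hj cj.
by apply: inadd_compl => // ji; apply: cj; rewrite ji.
Qed.

Hypothesis sL : spans L.

Lemma inadd_coords0 F c : inadd M F -> coords L F c -> c i = 0.
Proof.
move=> [k r] hc; have iO j : (j < size (others L i))%N -> indecomposable (nthr (others L i) j).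
  by rewrite size_others => hj; rewrite nth_others //; apply: (brigid_indec bL); apply: ltn_bump.
have [e' he] := inadd_coords iO (inadd_retract r (inadd_copies k (inadd_refl M))).
pose d' j := if j == i then 0 else e' (unbump i j).
have hd' : coords L F d'.
  move=> v; rewrite he size_others (sum_bump (fun j => d' j * dimz (nthr L j) v)) /d' eqxx mul0r add0r; apply: eq_bigr => j _.
  by rewrite eq_sym (negbTE (neq_bump _ _)) bumpK nth_others.
by rewrite (coords_uniq bL hc hd' hi) /d' eqxx.
Qed.

(* The coefficients of [Y] and [C'] at [X] add up to [-1]; if both were nonzero,
   they would have opposite signs and a positive combination of [Y] and [C']
   would have the dimension vector of an element of [add M]. *)
Lemma new_summand C c : ext0 C C -> ext0 C M -> ext0 M C -> ~ inadd M C ->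
  coords L C c -> c i = -1 ->
  exists Y C' y, [/\ iso C (dsum Y C'), indecomposable Y, ~ inadd M Y, inadd M C' &
    coords L Y y /\ y i = -1].
Proof.
move=> rC eCM eMC nC hc ci; have [Y [iY rY nY]] := indec_notin_inadd nC.
have [C' e] := retract_compl rY; exists Y, C'.
have [y hy] := sL Y; have [z hz] := sL C'; exists y.
have rY' : retract C' C by apply: retract_trans (retract_inr Y C') _; apply: iso_retract (iso_sym e).
have aY := inadd_of_retract rY; have aC' := inadd_of_retract rY'.
have yz : y i + z i = -1.
  by rewrite -ci; apply: (coords_uniq bL (coordsD hy hz (iso_dim e)) hc hi).
have compat F : inadd C F -> [/\ ext0 F F, ext0 F M & ext0 M F].
  move=> aF; split; [|exact: (ext0_inadd_l aF eCM)|exact: (ext0_inadd_r aF eMC)].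
  by apply: (ext0_inadd_l aF); apply: (ext0_inadd_r aF).
have [z0|z0] := eqVneq (z i) 0.
  have [h1 h2 h3] := compat _ aC'.
  have aMC' : inadd M C'.
    by apply: (inadd_compl_of_coords h1 h2 h3 (d := 1%N) (c := z)) => // v; rewrite mul1r hz.
  by split=> //; split=> //; rewrite -yz z0 addr0.
have [y0|y0] := eqVneq (y i) 0.
  have [h1 h2 h3] := compat _ aY; case: nY.
  by apply: (inadd_compl_of_coords h1 h2 h3 (d := 1%N) (c := y)) => // v; rewrite mul1r hy.
have [p [q [p0 e0]]] : exists p q : nat, (0 < p)%N /\ p%:Z * y i + q%:Z * z i = 0.
  exists `|z i|%N, `|y i|%N; split; first by rewrite absz_gt0.
  rewrite !abszE; case: (ltrgtP 0 (y i)) y0 => // hy0 _; case: (ltrgtP 0 (z i)) z0 => // hz0 _; lia.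
pose F := dsum (copies Y p) (copies C' q).
have aF : inadd C F by apply: inadd_dsum; apply: inadd_copies.
have [h1 h2 h3] := compat _ aF.
have hF := coordsD (coords_copies p hy) (coords_copies q hz) (X := F) (fun v => erefl).
case: nY; apply: (@inadd_retract _ _ _ _ F).
  apply: retract_trans (retract_inl _ _).
  by case: p p0 {e0 F aF h1 h2 h3 hF} => // p _; apply: retract_inl.
apply: (inadd_compl_of_coords h1 h2 h3 (d := 1%N)
  (c := fun j => p%:Z * y j + q%:Z * z j)) => [//|v|]; last exact: e0.
by rewrite mul1r hF.
Qed.

Lemma exchange_basic Y y : indecomposable Y -> ~ inadd M Y -> ext0 (dsum Y M) (dsum Y M) ->
  coords L Y y -> y i = -1 -> brigid (Y :: others L i) /\ spans (Y :: others L i).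
Proof.
move=> iY nY rY hy yi; split.
  split=> //= [[|j]|[|j] [|k]] //=; rewrite ?size_others ?ltnS.
  - by move=> hj; rewrite nth_others //; apply: (brigid_indec bL); apply: ltn_bump.
  - move=> _ hk _; rewrite nth_others // => e; apply: nY; apply: inadd_retract (iso_retract e) _.
    apply: inadd_compl; first exact: ltn_bump.
    by move/esym/eqP; apply/negP; rewrite neq_bump.
  - move=> hk _ _; rewrite nth_others // => e; apply: nY; apply: inadd_retract (iso_retract (iso_sym e)) _.
    apply: inadd_compl; first exact: ltn_bump.
    by move/esym/eqP; apply/negP; rewrite neq_bump.
  - move=> hj hk jk; rewrite !nth_others //; apply: (brigid_noniso bL); try exact: ltn_bump.
    by move/(can_inj (@bumpK i)) => e; apply: jk; rewrite e.
move=> N; have [c hc] := sL N.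
(* As y_i = -1, dim X equals - dim Y plus the sum of y_j dim T_j over the other j; this is
   substituted into the coordinates of [N]. The coefficient -1 is what keeps the new ones
   integral. *)
exists (fun j => if j is k.+1 then c (bump i k) + c i * y (bump i k) else - c i) => v.
rewrite /= size_others big_ord_recl /= hc.
rewrite (sum_bump (fun j => c j * dimz (nthr L j) v)).
under [X in _ = _ + X]eq_bigr => j _ do rewrite add0n nth_others // mulrDl -mulrA.
rewrite big_split /= -mulr_sumr (hy v) (sum_bump (fun j => y j * dimz (nthr L j) v)) yi.
ring.
Qed.

End Fixed.
End Exchange.

(** * Trimming an exact sequence to one summand of an end *)

Section RemoveSummand.
Variables (K : fieldType) (Q : quiver).
Local Notation rep := (rep K Q).
Implicit Types (M N P X Y Z E F T : rep).

Lemma inl_snd0 X Y i : @dsum_inl K Q X Y i *m @dsum_snd K Q X Y i = 0.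
Proof. by rewrite mul_row_col mulmx0 mul0mx addr0. Qed.
Lemma inr_fst0 X Y i : @dsum_inr K Q X Y i *m @dsum_fst K Q X Y i = 0.
Proof. by rewrite mul_row_col mulmx0 mul0mx add0r. Qed.

Lemma mono_factor X Y Z E (f : hom X E) (j : hom Y E) (q : hom E Z) :
  ses j q -> is_hom f -> (forall i, f i *m q i = 0) ->
  exists f' : hom X Y, is_hom f' /\ forall i, f' i *m j i = f i.
Proof.
move=> [hj [hq ex]] hf fq.
have [f' ef] : exists f' : hom X Y, forall i, f' i *m j i = f i.
  by exists (fun i => f i *m pinv (j i)) => i; apply: exactm_lift (ex i) (fq i).
exists f'; split=> // a; have [jf _ _] := ex (qt Q a); apply: (row_free_cancel jf).
by rewrite -mulmxA ef -(mulmxA (f' _)) hj mulmxA ef hf.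
Qed.

Lemma epi_factor X Y Z E (f : hom E X) (j : hom Y E) (q : hom E Z) :
  ses j q -> is_hom f -> (forall i, j i *m f i = 0) ->
  exists f' : hom Z X, is_hom f' /\ forall i, q i *m f' i = f i.
Proof.
move=> [hj [hq ex]] hf jf.
have [f' ef] : exists f' : hom Z X, forall i, q i *m f' i = f i.
  by exists (fun i => pinv (q i) *m f i) => i; apply: exactm_factor (ex i) (jf i).
exists f'; split=> // a; have [_ qf _] := ex (qs Q a); apply: (row_full_cancel qf).
by rewrite mulmxA -hq -mulmxA ef mulmxA ef hf.
Qed.

(** Since Ext^1(C', X) = 0, the inclusion of C' into C lifts to [E] and splits the map from [E] onto
    C'. The kernel of that map is E', a summand of [E] which still contains [X] and maps onto [Y].
    This makes the end term indecomposable, as an arrow demands. *)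
Lemma ses_remove_quot X E C Y C' (f : hom X E) (g : hom E C) :
  ses f g -> iso C (dsum Y C') -> ext0 C' X ->
  exists E' (f' : hom X E') (g' : hom E' Y), ses f' g' /\ retract E' E.
Proof.
move=> s e eC; have [u [v [hu [hv [uv vu]]]]] := e; have [hf [hg ex]] := s.
have hus : is_hom (hcomp u (@dsum_snd _ _ Y C')) by apply: is_hom_comp => //; apply: is_hom_snd.
have huf : is_hom (hcomp u (@dsum_fst _ _ Y C')) by apply: is_hom_comp => //; apply: is_hom_fst.
have hvi : is_hom (hcomp (@dsum_inr _ _ Y C') v) by apply: is_hom_comp => //; apply: is_hom_inr.
pose q := hcomp g (hcomp u (@dsum_snd _ _ Y C')); have hq : is_hom q by apply: is_hom_comp.
have [t [ht et]] := hom_lift s eC hvi.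
have tq i : t i *m q i = 1%:M.
  rewrite /q /hcomp mulmxA et /hcomp -mulmxA (mulmxA (v i)) vu mul1mx.
  exact: inr_snd.
have [E' [j s']] := exists_ker_ses hq (fun i => retract_full (tq i)).
have [hj [_ ex']] := s'.
have fq i : f i *m q i = 0 by rewrite /q /hcomp mulmxA (ses0 s) mul0mx.
have [f' [hf' ef]] := mono_factor s' hf fq.
have hg' : is_hom (hcomp j (hcomp g (hcomp u (@dsum_fst _ _ Y C')))).
  by do 2!apply: is_hom_comp => //.
exists E', f', (hcomp j (hcomp g (hcomp u (@dsum_fst _ _ Y C')))); split; last first.
  apply: retract_trans (retract_inr C' E') _; apply: iso_retract.
  by apply: (ses_split s'); exists t.
split=> //; split=> // i; apply: exactmP.
- by apply: (@row_free_of_mul _ _ _ _ _ (j i)); rewrite ef; case: (ex i).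
- have [_ gf _] := ex i; pose W := @dsum_inl _ _ Y C' i *m v i *m pinv (g i).
  have Wg : W *m g i = @dsum_inl _ _ Y C' i *m v i by rewrite -mulmxA pinv_full // mulmx1.
  have Wq : W *m q i = 0.
    by rewrite /q /hcomp mulmxA Wg -mulmxA (mulmxA (v i)) vu mul1mx inl_snd0.
  have WE := exactm_lift (ex' i) Wq.
  apply: (@retract_full _ _ _ (W *m pinv (j i))).
  rewrite /hcomp mulmxA WE mulmxA Wg -mulmxA (mulmxA (v i)) vu mul1mx.
  exact: inl_fst.
- by rewrite /hcomp mulmxA ef mulmxA (ses0 s) mul0mx.
apply/eqP; rewrite -(eqn_add2r (rdim C' i)) -(ses_dim s') (ses_dim s).
by rewrite (iso_dim e) addnA.
Qed.

Lemma ses_remove_sub X E C Y C' (f : hom C E) (g : hom E X) :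
  ses f g -> iso C (dsum Y C') -> ext0 X C' ->
  exists E' (f' : hom Y E') (g' : hom E' X), ses f' g' /\ retract E' E.
Proof.
move=> s e eC; have [u [v [hu [hv [uv vu]]]]] := e; have [hf [hg ex]] := s.
have hus : is_hom (hcomp u (@dsum_snd _ _ Y C')) by apply: is_hom_comp => //; apply: is_hom_snd.
have hvl : is_hom (hcomp (@dsum_inl _ _ Y C') v) by apply: is_hom_comp => //; apply: is_hom_inl.
have hvr : is_hom (hcomp (@dsum_inr _ _ Y C') v) by apply: is_hom_comp => //; apply: is_hom_inr.
pose j := hcomp (hcomp (@dsum_inr _ _ Y C') v) f; have hj : is_hom j by apply: is_hom_comp.
have [t [ht et]] := hom_ext s eC hus.
have jt i : j i *m t i = 1%:M.
  rewrite /j /hcomp -mulmxA et /hcomp -mulmxA (mulmxA (v i)) vu mul1mx.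
  exact: inr_snd.
have [E' [c s']] := exists_coker_ses hj (fun i => retract_free (jt i)).
have [_ [hc ex']] := s'.
have jg i : j i *m g i = 0 by rewrite /j /hcomp -mulmxA (ses0 s) mulmx0.
have [g' [hg' eg]] := epi_factor s' hg jg.
have hf' : is_hom (hcomp (hcomp (hcomp (@dsum_inl _ _ Y C') v) f) c).
  by do 2!apply: is_hom_comp => //.
exists E', (hcomp (hcomp (hcomp (@dsum_inl _ _ Y C') v) f) c), g'; split; last first.
  have hr : is_hom (fun i => hid E i - hcomp t j i).
    by apply: is_homB; [exact: is_hom_id | exact: is_hom_comp].
  have jr i : j i *m (hid E i - hcomp t j i) = 0.
    by rewrite mulmxBr mulmx1 /hcomp mulmxA jt mul1mx subrr.
  have [r [hr' er]] := epi_factor s' hr jr.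
  exists r, c; split=> // i; have [_ cf _] := ex' i; apply: (row_full_cancel cf).
  rewrite mulmxA er mulmxBl mul1mx /hcomp -mulmxA (ses0 s') mulmx0 subr0 mulmx1 //.
split=> //; split=> // i; apply: exactmP.
- have [ff _ _] := ex i; pose W := pinv (f i) *m u i *m @dsum_fst _ _ Y C' i.
  have fW : f i *m W = u i *m @dsum_fst _ _ Y C' i by rewrite !mulmxA pinv_free // mul1mx.
  have jW : j i *m W = 0.
    by rewrite /j /hcomp -mulmxA fW -mulmxA (mulmxA (v i)) vu mul1mx inr_fst0.
  have WE := exactm_factor (ex' i) jW.
  apply: (@retract_free _ _ _ _ (pinv (c i) *m W)).
  rewrite /hcomp -mulmxA WE -mulmxA fW -mulmxA (mulmxA (v i)) vu mul1mx.
  exact: inl_fst.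
- by apply: (@row_full_of_mul _ _ _ _ (c i)); rewrite eg; case: (ex i).
- by rewrite /hcomp -mulmxA eg -mulmxA (ses0 s) mulmx0.
apply/eqP; rewrite -(eqn_add2l (rdim C' i)) -(ses_dim s') (ses_dim s) (iso_dim e) /=.
by rewrite addnCA addnA.
Qed.

Lemma hom0_inadd_r N M Z : (forall h : hom N M, is_hom h -> forall v, h v = 0) ->
  inadd M Z -> forall h : hom N Z, is_hom h -> forall v, h v = 0.
Proof.
move=> h0 [k [f [g [hf hg e]]]] h hh v.
have z : forall m (u : hom N (copies M m)), is_hom u -> forall w, u w = 0.
  elim=> [|m IH] u hu w; first by apply/matrixP => x [].
  rewrite -[u w]mulmx1 -fst_inl_snd_inr mulmxDr !mulmxA.
  have -> : u w *m dsum_fst _ _ w = 0 by apply: (h0 _ (is_hom_comp hu (@is_hom_fst _ _ _ _))).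
  have -> : u w *m dsum_snd _ _ w = 0 by apply: (IH _ (is_hom_comp hu (@is_hom_snd _ _ _ _))).
  by rewrite !mul0mx addr0.
by rewrite -[h v]mulmx1 -e mulmxA -[h v *m f v]/(hcomp h f v) z ?mul0mx //; apply: is_hom_comp.
Qed.

Lemma hom0_inadd_l N M Z : (forall h : hom M N, is_hom h -> forall v, h v = 0) ->
  inadd M Z -> forall h : hom Z N, is_hom h -> forall v, h v = 0.
Proof.
move=> h0 [k [f [g [hf hg e]]]] h hh v.
have z : forall m (u : hom (copies M m) N), is_hom u -> forall w, u w = 0.
  elim=> [|m IH] u hu w; first by apply/matrixP => [[]].
  rewrite -[u w]mul1mx -fst_inl_snd_inr mulmxDl -!mulmxA.
  have -> : dsum_inl _ _ w *m u w = 0 by apply: (h0 _ (is_hom_comp (@is_hom_inl _ _ _ _) hu)).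
  have -> : dsum_inr _ _ w *m u w = 0 by apply: (IH _ (is_hom_comp (@is_hom_inr _ _ _ _) hu)).
  by rewrite !mulmx0 addr0.
by rewrite -[h v]mul1mx -e -mulmxA -[g v *m h v]/(hcomp g h v) z ?mulmx0 //; apply: is_hom_comp.
Qed.

End RemoveSummand.

(** * Existence and uniqueness of neighbours at a summand *)

Lemma euler_suml Q r (c : nat -> int) (F : nat -> 'I_(qn Q) -> int) (x y : 'I_(qn Q) -> int) :
  (forall v, x v = \sum_(j < r) c j * F j v) ->
  euler x y = \sum_(j < r) c j * euler (F j) y.
Proof.
move=> hx; rewrite /euler.
under eq_bigr => v _ do rewrite hx mulr_suml.
under [X in _ - X]eq_bigr => a _ do rewrite hx mulr_suml.
rewrite exchange_big [X in _ - X]exchange_big -sumrB /=; apply: eq_bigr => j _.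
rewrite mulrBr !mulr_sumr; congr (_ - _); apply: eq_bigr => v _; by rewrite mulrA.
Qed.

Lemma euler_sumr Q r (c : nat -> int) (F : nat -> 'I_(qn Q) -> int) (x y : 'I_(qn Q) -> int) :
  (forall v, y v = \sum_(j < r) c j * F j v) ->
  euler x y = \sum_(j < r) c j * euler x (F j).
Proof.
move=> hx; rewrite /euler.
under eq_bigr => v _ do rewrite hx mulr_sumr.
under [X in _ - X]eq_bigr => a _ do rewrite hx mulr_sumr.
rewrite exchange_big [X in _ - X]exchange_big -sumrB /=; apply: eq_bigr => j _.
rewrite mulrBr !mulr_sumr; congr (_ - _); apply: eq_bigr => v _; by rewrite mulrCA.
Qed.

Section Neighbours.
Variables (K : closedFieldType) (Q : quiver).
Hypothesis ac : acyclic Q.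
Local Notation rep := (rep K Q).
Local Notation A := (regular_rep K Q).
Local Notation nthr := (nth (zero_rep K Q)).
Implicit Types (M N P X Y Z E F T : rep) (L : seq rep).

Definition out_neighbour L i Y := [/\ indecomposable Y, basic_tilting (dsum (compl L i) Y) &
  exists M' (f : hom (nthr L i) M') (g : hom M' Y), inadd (compl L i) M' /\ ses f g].

Definition in_neighbour L i Y := [/\ indecomposable Y, basic_tilting (dsum (compl L i) Y) &
  exists M' (f : hom Y M') (g : hom M' (nthr L i)), inadd (compl L i) M' /\ ses f g].

Section Fixed.
Variables (L : seq rep) (i : nat).
Hypotheses (bL : brigid L) (hi : (i < size L)%N) (sL : spans L).
Local Notation M := (compl L i).
Local Notation X := (nthr L i).

Lemma nonsplit_l E C (f : hom X E) (g : hom E C) : inadd M E -> ses f g -> ~ ext0 C X.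
Proof.
move=> aE s e; apply: (compl_notin bL hi); apply: inadd_retract aE.
by apply: retract_trans (retract_inr C X) _; apply: iso_retract (ses_split_ext s e).
Qed.

Lemma nonsplit_r E C (f : hom C E) (g : hom E X) : inadd M E -> ses f g -> ~ ext0 X C.
Proof.
move=> aE s e; apply: (compl_notin bL hi); apply: inadd_retract aE.
by apply: retract_trans (retract_inl X C) _; apply: iso_retract (ses_split_ext s e).
Qed.

Lemma dsum_compl_basic Y : brigid (Y :: others L i) -> spans (Y :: others L i) ->
  basic_tilting (dsum M Y).
Proof.
move=> b s; apply/(basic_tiltingP ac); exists (Y :: others L i); split=> //.
have r := brigid_ext0 b; have [r1 r2 r3 r4] := ext0_dsumP r.
apply: rigid_iso => // [|v]; last by rewrite /= addnC.
by apply: ext0_dsum_l; apply: ext0_dsum_r.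
Qed.

(** The coordinate of [E] at [X] is 0 because [E] is in add M. Only dimensions enter, so this serves
    exact sequences in either direction. *)
Lemma coords_of_dim E C d : inadd M E -> coords L C d ->
  (forall v, rdim E v = rdim C v + rdim X v)%N -> d i = -1.
Proof.
move=> aE hd e; have [m hm] := sL E; have m0 := inadd_coords0 bL hi aE hm.
have h := coordsB hm (coords_nth hi) e.
by rewrite (coords_uniq bL hd h hi) m0 eqxx.
Qed.

(** The cokernel [C] has no extensions by [M] thanks to the approximation property; the other
    vanishings hold because it is a quotient of copies of [M]. Its coordinate -1 at [X] singles out
    one new summand [Y], and the rest of [C] is trimmed away. *)
Lemma out_exists k (f : hom X (copies M k)) : is_hom f -> hom_inj f ->
  (forall h : hom X M, is_hom h -> exists h' : hom (copies M k) M,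
     is_hom h' /\ forall i, f i *m h' i = h i) ->
  exists Y, out_neighbour L i Y.
Proof.
move=> hf jf ap; have [C [g s]] := exists_coker_ses hf jf; have [_ [hg ex]] := s.
have aE : inadd M (copies M k) by apply: inadd_copies (inadd_refl M).
have rM := ext0_compl bL hi.
have sg : hom_surj g by move=> v; case: (ex v).
have eCM : ext0 C M by apply: (ext0_coker s) => //; apply: ext0_copies_l.
have eMC : ext0 M C by apply: (ext0_quot hg sg); apply: ext0_copies_r.
have eCC : ext0 C C by apply: (ext0_quot hg sg); apply: ext0_copies_r.
have nC : ~ inadd M C.
  by move=> aC; apply: (nonsplit_l aE s); apply: (ext0_inadd_l aC); apply: ext0_compl_nth.
have [c hc] := sL C.
have ci : c i = -1 by apply: coords_of_dim aE hc _ => v; rewrite (ses_dim s) addnC.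
have [Y [C' [y [e iY nY aC' [hy yi]]]]] := new_summand bL hi sL eCC eCM eMC nC hc ci.
have rY : retract Y C := retract_trans (retract_inl Y C') (iso_retract (iso_sym e)).
have rYM : ext0 (dsum Y M) (dsum Y M).
  apply: ext0_dsum_l; apply: ext0_dsum_r => //.
  - by apply: (ext0_retract_l rY); apply: (ext0_retract_r rY).
  - exact: (ext0_retract_l rY).
  - exact: (ext0_retract_r rY).
have [bY sY] := exchange_basic bL hi sL iY nY rYM hy yi.
have eC'X : ext0 C' X by apply: (ext0_inadd_l aC'); apply: ext0_compl_nth.
have [E' [f' [g' [s' r']]]] := ses_remove_quot s e eC'X.
exists Y; split=> //; first exact: dsum_compl_basic.
by exists E', f', g'; split=> //; apply: inadd_retract r' aE.
Qed.

Lemma in_exists k (f : hom (copies M k) X) : is_hom f -> hom_surj f ->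
  (forall h : hom M X, is_hom h -> exists h' : hom M (copies M k),
     is_hom h' /\ forall i, h' i *m f i = h i) ->
  exists Y, in_neighbour L i Y.
Proof.
move=> hf jf ap; have [C [g s]] := exists_ker_ses hf jf; have [hg [_ ex]] := s.
have aE : inadd M (copies M k) by apply: inadd_copies (inadd_refl M).
have rM := ext0_compl bL hi.
have sg : hom_inj g by move=> v; case: (ex v).
have eMC : ext0 M C by apply: (ext0_ker s) => //; apply: ext0_copies_r.
have eCM : ext0 C M by apply: (ext0_sub hg sg); apply: ext0_copies_l.
have eCC : ext0 C C by apply: (ext0_sub hg sg); apply: ext0_copies_l.
have nC : ~ inadd M C.
  by move=> aC; apply: (nonsplit_r aE s); apply: (ext0_inadd_r aC); apply: ext0_nth_compl.
have [c hc] := sL C.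
have ci : c i = -1 by apply: coords_of_dim aE hc _ => v; rewrite (ses_dim s).
have [Y [C' [y [e iY nY aC' [hy yi]]]]] := new_summand bL hi sL eCC eCM eMC nC hc ci.
have rY : retract Y C := retract_trans (retract_inl Y C') (iso_retract (iso_sym e)).
have rYM : ext0 (dsum Y M) (dsum Y M).
  apply: ext0_dsum_l; apply: ext0_dsum_r => //.
  - by apply: (ext0_retract_l rY); apply: (ext0_retract_r rY).
  - exact: (ext0_retract_l rY).
  - exact: (ext0_retract_r rY).
have [bY sY] := exchange_basic bL hi sL iY nY rYM hy yi.
have eC'X : ext0 X C' by apply: (ext0_inadd_r aC'); apply: ext0_nth_compl.
have [E' [f' [g' [s' r']]]] := ses_remove_sub s e eC'X.
exists Y; split=> //; first exact: dsum_compl_basic.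
by exists E', f', g'; split=> //; apply: inadd_retract r' aE.
Qed.

(* If neither approximation is mono resp. epi, let [k] and [l] be the dimension
   vectors of the kernel and the cokernel. Both <k, -> and <-, l> vanish on
   [compl L i] and are positive at [nthr L i], so they have the same sign at
   [dim A]; but <k, dim A> <= 0 since [Hom(ker, A) = 0], while <dim A, l> > 0. *)
Lemma neighbour_exists : (forall v, (0 < rdim M v)%N) ->
  (exists Y, out_neighbour L i Y) \/ (exists Y, in_neighbour L i Y).
Proof.
move=> sM; have [k [f [hf apf]]] := left_approx X M.
have [k' [g [hg apg]]] := right_approx X M.
have [I [p [j [hp sp hj jj ef]]]] := exists_im hf.
have [J [p' [j' [hp' sp' hj' jj' eg]]]] := exists_im hg.
have [Kr [u su]] := exists_ker_ses hp sp; have [Lc [w sw]] := exists_coker_ses hj' jj'.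
have [hu [_ exu]] := su; have [_ [hw exw]] := sw.
have iu : hom_inj u by move=> v; case: (exu v).
have ssw : hom_surj w by move=> v; case: (exw v).
have rM := ext0_compl bL hi.
have eKM : ext0 Kr M by apply: (ext0_sub hu iu); apply: ext0_nth_compl.
have eKX : ext0 Kr X by apply: (ext0_sub hu iu); apply: ext0_nth.
have eML : ext0 M Lc by apply: (ext0_quot hw ssw); apply: ext0_compl_nth.
have eXL : ext0 X Lc by apply: (ext0_quot hw ssw); apply: ext0_nth.
case: (nonzero_or Kr) => nK; last first.
  left; apply: (out_exists hf) apf => v; rewrite -ef; apply: row_free_mul => //.
  by rewrite /row_free (eqP (sp v)); have := ses_dim su v; rewrite nK add0n => ->.
case: (nonzero_or Lc) => nL; last first.
  right; apply: (in_exists hg) apg => v; rewrite -eg; apply: row_full_mul => //.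
  by rewrite /row_full (eqP (jj' v)); have := ses_dim sw v; rewrite nL addn0 => ->.
exfalso.
(* Such a map extends to [X], since Ext^1(I, M) = 0, and the extension factors through the
   approximation [f], which kills [Kr]. *)
have hom0KM (h : hom Kr M) : is_hom h -> forall v, h v = 0.
  move=> hh v; have eI : ext0 I M by apply: (ext0_sub hj jj); apply: ext0_copies_l.
  have [h' [hh' e]] := hom_ext su eI hh; have [h'' [_ e']] := apf _ hh'.
  by rewrite -e -e' -ef -mulmxA (mulmxA (u v)) (ses0 su) mul0mx.
have hom0ML (h : hom M Lc) : is_hom h -> forall v, h v = 0.
  move=> hh v; have eJ : ext0 M J by apply: (ext0_quot hp' sp'); apply: ext0_copies_r.
  have [h' [hh' e]] := hom_lift sw eJ hh; have [h'' [_ e']] := apg _ hh'.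
  by rewrite -e -e' -eg -!mulmxA (ses0 sw) !mulmx0.
(* Sincerity enters here: a nonzero image inside [A] is projective and would map nontrivially to
   [M], giving a nonzero map from [Kr] to [M]. *)
have hom0KA (h : hom Kr A) : is_hom h -> forall v, h v = 0.
  move=> hh v; have [N [q [z [hq sq hz jz eh]]]] := exists_im hh.
  case: (nonzero_or N) => [nN|N0]; last first.
    by rewrite -eh; move: (q v) (z v); rewrite N0 => q1 z1; rewrite [q1]thinmx0 mul0mx.
  have eN Y : ext0 N Y by apply: (ext0_sub hz jz); apply: regular_ext0.
  have [h1 [v1 [hh1 /eqP ne]]] := projective_hom_sincere ac nN eN sM.
  case: ne; apply: (row_full_cancel (sq v1)).
  by rewrite mulmx0 -[LHS]/(hcomp q h1 v1) hom0KM //; apply: is_hom_comp.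
have eKA := euler_hom0_le0 hom0KA.
have [h [v [hh hv]]] := regular_hom_neq0 ac nL.
have eAL := euler_ext0_gt0 (regular_ext0 ac (N := Lc)) hh hv.
have kx : 0 < euler (dimz Kr) (dimz X).
  have [b hb] := nK; apply: (euler_ext0_gt0 (i := b) eKX hu).
  by rewrite -mxrank_eq0 (eqP (iu b)) -lt0n.
have xl : 0 < euler (dimz X) (dimz Lc).
  have [b hb] := nL; apply: (euler_ext0_gt0 (i := b) eXL hw).
  by rewrite -mxrank_eq0 (eqP (ssw b)) -lt0n.
have [c hc] := sL A.
have other t : (t < (size L).-1)%N -> inadd M (nthr L (bump i t)).
  by move=> ht; apply: (inadd_compl hi (ltn_bump hi ht)); apply/eqP; rewrite eq_sym neq_bump.
have otherK t : (t < (size L).-1)%N -> euler (dimz Kr) (dimz (nthr L (bump i t))) = 0.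
  move=> /other ot; apply: euler_hom0_ext0; first exact: (ext0_inadd_r ot eKM).
  exact: (hom0_inadd_r hom0KM ot).
have otherL t : (t < (size L).-1)%N -> euler (dimz (nthr L (bump i t))) (dimz Lc) = 0.
  move=> /other ot; apply: euler_hom0_ext0; first exact: (ext0_inadd_l ot eML).
  exact: (hom0_inadd_l hom0ML ot).
move: eKA eAL; rewrite (euler_sumr (F := fun j => dimz (nthr L j)) _ hc).
rewrite (euler_suml (F := fun j => dimz (nthr L j)) _ hc).
rewrite (sum_bump hi (fun j => c j * euler (dimz Kr) (dimz (nthr L j)))).
rewrite (sum_bump hi (fun j => c j * euler (dimz (nthr L j)) (dimz Lc))).
rewrite big1 => [|t _]; last by rewrite otherK ?mulr0.
rewrite big1 => [|t _]; last by rewrite otherL ?mulr0.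
rewrite !addr0 pmulr_lle0 // pmulr_lgt0 // => c1 c2.
by move: (lt_le_trans c2 c1); rewrite ltxx.
Qed.

Lemma out_notin Y : out_neighbour L i Y -> ~ inadd M Y.
Proof.
move=> [_ _ [E [f [g [aE s]]]]] aY; apply: (nonsplit_l aE s).
by apply: (ext0_inadd_l aY); apply: ext0_compl_nth.
Qed.

Lemma in_notin Y : in_neighbour L i Y -> ~ inadd M Y.
Proof.
move=> [_ _ [E [f [g [aE s]]]]] aY; apply: (nonsplit_r aE s).
by apply: (ext0_inadd_r aY); apply: ext0_nth_compl.
Qed.

Lemma out_not_iso Y : out_neighbour L i Y -> ~ iso X Y.
Proof.
move=> [_ _ [E [f [g [aE s]]]]] e; apply: (nonsplit_l aE s).
by apply: (ext0_retract_l (iso_retract (iso_sym e))); apply: ext0_nth.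
Qed.

Lemma in_not_iso Y : in_neighbour L i Y -> ~ iso X Y.
Proof.
move=> [_ _ [E [f [g [aE s]]]]] e; apply: (nonsplit_r aE s).
by apply: (ext0_retract_r (iso_retract (iso_sym e))); apply: ext0_nth.
Qed.

(** The outgoing sequence embeds [X] into add M, and Ext^1(M, Z) = 0, so Ext^1(X, Z) = 0. This would
    split the incoming sequence. *)
Lemma out_in_disjoint Y Z : out_neighbour L i Y -> in_neighbour L i Z -> False.
Proof.
move=> [_ _ [E [f [g [aE s]]]]] [_ bZ [E' [f' [g' [aE' s']]]]].
apply: (nonsplit_r aE' s'); have [hf [_ ex]] := s; apply: (ext0_sub hf).
  by move=> v; case: (ex v).
apply: (ext0_inadd_l aE).
by have [_ h _ _] := ext0_dsumP (basic_tilting_ext0 bZ).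
Qed.

(** Exchanging [X] for [Y] gives a family whose dimension vectors still generate, and Y' is
    compatible with it. So Y' is a summand of it, and not one coming from [M]. *)
Lemma neighbour_unique Y Y' y : indecomposable Y -> indecomposable Y' ->
  ~ inadd M Y -> ~ inadd M Y' -> coords L Y y -> y i = -1 ->
  ext0 (dsum M Y) (dsum M Y) -> ext0 (dsum M Y') (dsum M Y') -> ext0 Y Y' -> ext0 Y' Y ->
  iso Y Y'.
Proof.
move=> iY iY' nY nY' hy yi /ext0_dsumP[e1 e2 e3 e4] /ext0_dsumP[_ e5 e6 e7] e8 e9.
have rYM : ext0 (dsum Y M) (dsum Y M) by apply: ext0_dsum_l; apply: ext0_dsum_r.
have [bY sY] := exchange_basic bL hi sL iY nY rYM hy yi.
have : inadd (dsum_list (Y :: others L i)) Y'.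
  apply: add_of_spans => //=; first by apply: ext0_dsum_r.
  exact: ext0_dsum_l.
move=> /(indec_inadd iY') /(indec_prime iY')[r|r]; last by case: nY'; apply: inadd_of_retract.
by apply: iso_sym; apply: indec_iso_of_retract.
Qed.

(** Each of [Y] and Y' is a quotient of a module in add M, with which the other has no extensions;
    hence they have none with each other. *)
Lemma out_unique Y Y' : out_neighbour L i Y -> out_neighbour L i Y' -> iso Y Y'.
Proof.
move=> oY oY'; have [iY bY [E [f [g [aE s]]]]] := oY.
have [iY' bY' [E' [f' [g' [aE' s']]]]] := oY'.
have [c hc] := sL Y.
have ci : c i = -1 by apply: coords_of_dim aE hc _ => v; rewrite (ses_dim s) addnC.
have r := basic_tilting_ext0 bY; have r' := basic_tilting_ext0 bY'.
have [_ _ h1 _] := ext0_dsumP r; have [_ _ h2 _] := ext0_dsumP r'.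
have [_ [hg ex]] := s; have [_ [hg' ex']] := s'.
apply: (neighbour_unique iY iY' (out_notin oY) (out_notin oY') hc ci r r').
  apply: (ext0_quot hg'); first by move=> v; case: (ex' v).
  exact: ext0_inadd_r aE' h1.
apply: (ext0_quot hg); first by move=> v; case: (ex v).
exact: ext0_inadd_r aE h2.
Qed.

Lemma in_unique Y Y' : in_neighbour L i Y -> in_neighbour L i Y' -> iso Y Y'.
Proof.
move=> oY oY'; have [iY bY [E [f [g [aE s]]]]] := oY.
have [iY' bY' [E' [f' [g' [aE' s']]]]] := oY'.
have [c hc] := sL Y.
have ci : c i = -1 by apply: coords_of_dim aE hc _ => v; rewrite (ses_dim s).
have r := basic_tilting_ext0 bY; have r' := basic_tilting_ext0 bY'.
have [_ h1 _ _] := ext0_dsumP r; have [_ h2 _ _] := ext0_dsumP r'.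
have [hf [_ ex]] := s; have [hf' [_ ex']] := s'.
apply: (neighbour_unique iY iY' (in_notin oY) (in_notin oY') hc ci r r').
  apply: (ext0_sub hf); first by move=> v; case: (ex v).
  exact: ext0_inadd_l aE h2.
apply: (ext0_sub hf'); first by move=> v; case: (ex' v).
exact: ext0_inadd_l aE' h1.
Qed.

End Fixed.

(** The right-hand side retains the i-th summand, which the left-hand side has lost. *)
Lemma neighbours_distinct L i j Y Y' : brigid L -> (i < size L)%N -> (j < size L)%N -> i <> j ->
  indecomposable Y -> ~ iso (nthr L i) Y -> ~ iso (dsum (compl L i) Y) (dsum (compl L j) Y').
Proof.
move=> bL hi hj ij iY nXY e; have iX := brigid_indec bL hi.
have r : retract (nthr L i) (dsum (compl L i) Y).
  apply: retract_trans (iso_retract (iso_sym e)); apply: retract_trans (retract_inl _ _).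
  by apply: indec_inadd => //; apply: inadd_compl.
case: (indec_prime iX r) => [r'|r'].
  by apply: (compl_notin bL hi); apply: inadd_of_retract.
by apply: nXY; apply: indec_iso_of_retract.
Qed.

End Neighbours.

(** * Arrows at a tilting module and saturation *)

Section Saturated.
Variables (K : closedFieldType) (Q : quiver).
Hypothesis ac : acyclic Q.
Local Notation rep := (rep K Q).
Local Notation nthr := (nth (zero_rep K Q)).
Implicit Types (M N P X Y Z E F T : rep) (L : seq rep).

Lemma ses_iso_l X X' E Y (f : hom X E) (g : hom E Y) : ses f g -> iso X' X ->
  exists f' : hom X' E, ses f' g.
Proof.
move=> s e; have [u [v [hu [hv [uv vu]]]]] := e; have [hf [hg ex]] := s.
exists (hcomp u f); split; first exact: is_hom_comp.
split=> // i; have [ff gf _] := ex i; apply: exactmP => //.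
- by apply: row_free_mul => //; apply: retract_free (uv i).
- by rewrite /hcomp -mulmxA (ses0 s) mulmx0.
by rewrite (iso_dim e) (ses_dim s).
Qed.

Lemma ses_iso_r X E Y Y' (f : hom X E) (g : hom E Y) : ses f g -> iso Y Y' ->
  exists g' : hom E Y', ses f g'.
Proof.
move=> s e; have [u [v [hu [hv [uv vu]]]]] := e; have [hf [hg ex]] := s.
exists (hcomp g u); split=> //; split; first exact: is_hom_comp.
move=> i; have [ff gf _] := ex i; apply: exactmP => //.
- by apply: row_full_mul => //; apply: retract_full (vu i).
- by rewrite /hcomp mulmxA (ses0 s) mul0mx.
by rewrite -(iso_dim e) (ses_dim s).
Qed.

Variables (T : rep) (L : seq rep).
Hypotheses (eT : iso T (dsum_list L)) (bL : brigid L) (sL : spans L).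

Lemma basic_T : basic_tilting T.
Proof. by apply/(basic_tiltingP ac); exists L. Qed.

(** Cancelling [X] is done on dimension vectors: [M] and the complement are rigid and agree
    there. *)
Lemma summand_index M X : iso T (dsum M X) -> indecomposable X ->
  exists i, [/\ (i < size L)%N, iso X (nthr L i) & iso M (compl L i)].
Proof.
move=> e iX; have e' := iso_trans (iso_sym e) eT.
have [i hi r] := indec_dsum_list iX (retract_trans (retract_inr M X) (iso_retract e')).
have eX := indec_iso_of_retract iX (brigid_indec bL hi) r.
exists i; split=> //; apply: rigid_iso; last 2 first.
- exact: ext0_compl.
- move=> v; have := iso_dim (iso_trans e' (iso_dsum_compl bL hi)) v; rewrite /= (iso_dim eX).
  by move/addIn.
have rM := retract_trans (retract_inl M X) (iso_retract e').
by apply: (ext0_retract_l rM); apply: (ext0_retract_r rM); apply: brigid_ext0.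
Qed.

Lemma tarrow_out T' : tarrow T T' ->
  exists i Y, [/\ (i < size L)%N, out_neighbour L i Y & iso T' (dsum (compl L i) Y)].
Proof.
move=> [_ [bT' [M [X [Y [e1 e2 iX iY [M' [f [g [/in_addP aM' s]]]]]]]]]].
have [i [hi eX eM]] := summand_index e1 iX.
have e3 := iso_trans e2 (iso_dsum eM (iso_refl Y)).
exists i, Y; split=> //; split=> //; first exact: (basic_tilting_iso ac e3).
have [f' s'] := ses_iso_l s (iso_sym eX); exists M', f', g; split=> //.
by apply: inadd_trans aM'; apply: inadd_of_retract; apply: iso_retract.
Qed.

Lemma tarrow_in T' : tarrow T' T ->
  exists i Y, [/\ (i < size L)%N, in_neighbour L i Y & iso T' (dsum (compl L i) Y)].
Proof.
move=> [bT' [_ [M [Y [X [e2 e1 iY iX [M' [f [g [/in_addP aM' s]]]]]]]]]].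
have [i [hi eX eM]] := summand_index e1 iX.
have e3 := iso_trans e2 (iso_dsum eM (iso_refl Y)).
exists i, Y; split=> //; split=> //; first exact: (basic_tilting_iso ac e3).
have [g' s'] := ses_iso_r s eX; exists M', f, g'; split=> //.
by apply: inadd_trans aM'; apply: inadd_of_retract; apply: iso_retract.
Qed.

Lemma out_tarrow i Y : (i < size L)%N -> out_neighbour L i Y -> tarrow T (dsum (compl L i) Y).
Proof.
move=> hi [iY bY [M' [f [g [aM' s]]]]]; split; first exact: basic_T; split=> //.
exists (compl L i), (nthr L i), Y; split=> //.
- exact: iso_trans eT (iso_dsum_compl bL hi).
- exact: iso_refl.
- exact: brigid_indec.
by exists M', f, g; split=> //; apply/in_addP.
Qed.

Lemma in_tarrow i Y : (i < size L)%N -> in_neighbour L i Y -> tarrow (dsum (compl L i) Y) T.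
Proof.
move=> hi [iY bY [M' [f [g [aM' s]]]]]; split=> //; split; first exact: basic_T.
exists (compl L i), Y, (nthr L i); split=> //.
- exact: iso_refl.
- exact: iso_trans eT (iso_dsum_compl bL hi).
- exact: brigid_indec.
by exists M', f, g; split=> //; apply/in_addP.
Qed.

Lemma saturated_of_sincere : (0 < qn Q)%N ->
  (forall i v, (i < size L)%N -> (0 < rdim (compl L i) v)%N) -> saturated T.
Proof.
move=> n0 sinc; have sz := brigid_spans_size bL sL.
(* The boolean records the direction of the arrow. Since the two directions exclude each other, it
   splits the indices into those counted by [nout] and by [nin]. *)
have : forall i : 'I_(size L), exists w : bool * rep,
    if w.1 then out_neighbour L i w.2 else in_neighbour L i w.2.
  move=> i; have hi := ltn_ord i.
  have [[Y h]|[Y h]] := neighbour_exists ac bL hi sL (fun v => sinc i v hi).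
    by exists (true, Y).
  by exists (false, Y).
move=> /fin_all_exists[w hw].
have i0 : 'I_(size L) by rewrite sz; exact: Ordinal n0.
pose F (i : 'I_(size L)) := dsum (compl L i) (w i).2; pose s b := [seq i <- enum 'I_(size L) | (w i).1 == b].
have sb b i : (i \in s b) = ((w i).1 == b) by rewrite mem_filter mem_enum andbT.
have us b : uniq (s b) by apply: filter_uniq; apply: enum_uniq.
have outw i : (w i).1 -> out_neighbour L i (w i).2 by move=> e; have := hw i; rewrite e.
have inw i : (w i).1 = false -> in_neighbour L i (w i).2 by move=> e; have := hw i; rewrite e.
have notiso i j : i <> j -> ~ iso (F i) (F j).
  move=> ij; have ij' : val i <> val j by move/val_inj.
  have := hw i; case: (w i).1 => h.
    have [iY _ _] := h.
    exact: (neighbours_distinct bL (ltn_ord i) (ltn_ord j) ij' iY (out_not_iso bL (ltn_ord i) h)).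
  have [iY _ _] := h.
  exact: (neighbours_distinct bL (ltn_ord i) (ltn_ord j) ij' iY (in_not_iso bL (ltn_ord i) h)).
have dist b i j : (i < j < size (s b))%N ->
    ~ iso (nthr [seq F i | i <- s b] i) (nthr [seq F i | i <- s b] j).
  move=> /andP[ij hj]; have hi := ltn_trans ij hj; rewrite !(nth_map i0) //.
  apply: notiso => /eqP; rewrite nth_uniq ?us // => /eqP e.
  by rewrite e ltnn in ij.
exists (size (s true)), (size (s false)); split.
- exists [seq F i | i <- s true]; split; first by rewrite size_map.
  + move=> k hk; rewrite (nth_map i0) //; apply: out_tarrow => //; apply: outw.
    by have := mem_nth i0 hk; rewrite sb => /eqP.
  + by move=> i j; apply: dist.
  move=> T' /tarrow_out[i [Y [hi oY e]]]; pose i' := Ordinal hi.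
  have wi : (w i').1 = true.
    by case wi: (w i').1 => //; case: (out_in_disjoint bL hi oY (inw i' wi)).
  have hi' : i' \in s true by rewrite sb wi.
  exists (index i' (s true)); first by rewrite index_mem.
  rewrite (nth_map i0) ?index_mem // nth_index //; apply: iso_trans e _.
  by apply: iso_dsum (iso_refl _) _; apply: (out_unique bL hi sL oY (outw i' wi)).
- exists [seq F i | i <- s false]; split; first by rewrite size_map.
  + move=> k hk; rewrite (nth_map i0) //; apply: in_tarrow => //; apply: inw.
    by have := mem_nth i0 hk; rewrite sb => /eqP.
  + by move=> i j; apply: dist.
  move=> T' /tarrow_in[i [Y [hi oY e]]]; pose i' := Ordinal hi.
  have wi : (w i').1 = false.
    by case wi: (w i').1 => //; case: (out_in_disjoint bL hi (outw i' wi) oY).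
  have hi' : i' \in s false by rewrite sb wi.
  exists (index i' (s false)); first by rewrite index_mem.
  rewrite (nth_map i0) ?index_mem // nth_index //; apply: iso_trans e _.
  by apply: iso_dsum (iso_refl _) _; apply: (in_unique bL hi sL oY (inw i' wi)).
rewrite -sz !size_filter; have := count_predC (fun i => (w i).1 == true) (enum 'I_(size L)).
rewrite -cardE card_ord => e; rewrite -[RHS]e; congr (_ + _)%N.
by apply: eq_count => i /=; case: (w i).1.
Qed.

Lemma nonsaturated_compl : (0 < qn Q)%N -> ~ saturated T ->
  exists i v, (i < size L)%N /\ rdim (compl L i) v = 0%N.
Proof.
move=> n0 ns; apply: NNPP => h; apply: ns; apply: saturated_of_sincere => // i v hi.
by rewrite lt0n; apply/eqP => e; apply: h; exists i, v.
Qed.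

(* Since the dimension vectors of the summands generate [Z^n], the only one
   not vanishing at [v] takes the value [1] there. *)
Lemma rdim_le1_of_compl i v : (i < size L)%N -> rdim (compl L i) v = 0%N ->
  forall j, (j < size L)%N -> (rdim (nthr L j) v <= 1)%N.
Proof.
move=> hi hv j hj; case: (eqVneq j i) => [->|/eqP ji]; last first.
  have [k r] := inadd_compl hi hj ji.
  by apply: leq_trans (retract_dim r v) _; rewrite rdim_copies hv muln0.
have [c hc] := sL (simple_rep K v); have := hc v.
rewrite (sum_bump hi (fun j => c j * dimz (nthr L j) v)) big1 => [|k _]; last first.
  have [|m r] := inadd_compl hi (ltn_bump hi (ltn_ord k)); first by apply/eqP; rewrite eq_sym neq_bump.
  have := retract_dim r v; rewrite rdim_copies hv muln0 leqn0 /dimz => /eqP ->.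
  by rewrite mulr0.
rewrite addr0 /dimz /= eqxx /= => /(congr1 absz); rewrite abszM /= => /esym/eqP.
by rewrite muln_eq1 => /andP[_ /eqP ->].
Qed.

Lemma summand_euler j : (j < size L)%N -> euler (dimz (nthr L j)) (dimz (nthr L j)) = 1.
Proof.
move=> hj; have iX := brigid_indec bL hj; have rX := ext0_nth bL hj.
apply: euler_scalar => //; first by case: iX.
by move=> f hf; apply: rigid_endo_scalar.
Qed.

End Saturated.

(** * Bounding roots by a subadditive function *)

Section EulerBound.
Variable Q : quiver.
Hypothesis ac : acyclic Q.

Lemma no_loop a : qs Q a != qt Q a.
Proof.
apply/eqP => e; have /negP := ac (qs Q a) (p := [:: a]) isT; apply.
by rewrite /= eqxx e eqxx.
Qed.

Definition subadditive (d : 'I_(qn Q) -> nat) :=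
  (forall i, 0 < d i)%N /\
  forall i, (\sum_j qadj Q i j * d j <= 2 * d i)%N.

(** Absence of loops matters: [qadj] counts a loop once, the right-hand side twice. *)
Lemma sum_qadj (d : 'I_(qn Q) -> nat) i : (\sum_j qadj Q i j * d j =
  \sum_a ((qs Q a == i) * d (qt Q a) + (qt Q a == i) * d (qs Q a)))%N.
Proof.
have e j : (qadj Q i j * d j = \sum_a ((qs Q a == i) && (qt Q a == j) ||
    (qs Q a == j) && (qt Q a == i)) * d j)%N.
  by rewrite -big_distrl /=; congr (_ * _)%N; rewrite /qadj -sum1_count big_mkcond big_enum.
under eq_bigr => j _ do rewrite e.
rewrite exchange_big /=; apply: eq_bigr => a _.
have nl := no_loop a.
transitivity (\sum_j ((qs Q a == i) * ((qt Q a == j) * d j) + (qt Q a == i) * ((qs Q a == j) * d j)))%N.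
  apply: eq_bigr => j _; rewrite !mulnA -mulnDl; congr (_ * _)%N.
  case: (eqVneq (qs Q a) i) => [si|_]; last by case: (qs Q a == j); case: (qt Q a == i).
  rewrite -si [qt Q a == qs Q a]eq_sym (negbTE nl) andbF orbF /=.
  by case: (qt Q a == j).
rewrite big_split -!big_distrr /=.
have pick x : (\sum_j (x == j) * d j = d x)%N.
  rewrite (bigD1 x) //= eqxx mul1n big1 ?addn0 // => j.
  by rewrite eq_sym => /negbTE ->.
by rewrite !pick.
Qed.

(* Completing squares with y_i = x_i / d_i gives
   sum_a d_s d_t (y_s - y_t)^2 <= 2 <x, x>. *)
Lemma euler_arrow_bound d (x : 'I_(qn Q) -> nat) : subadditive d ->
  euler (fun i => (x i)%:Z) (fun i => (x i)%:Z) = 1 ->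
  forall a, `|(x (qs Q a))%:R / (d (qs Q a))%:R - (x (qt Q a))%:R / (d (qt Q a))%:R| <= 2 :> rat.
Proof.
move=> [d0 hd] hx a.
pose y i : rat := (x i)%:R / (d i)%:R; pose D i : rat := (d i)%:R.
have D0 i : 0 < D i by rewrite /D ltr0n.
have D1 i : 1 <= D i by rewrite /D ler1n.
have xy i : (x i)%:R = y i * D i by rewrite /y /D divfK // pnatr_eq0 -lt0n.
have q1 : \sum_i (y i * D i) ^+ 2 - \sum_a (y (qs Q a) * D (qs Q a)) * (y (qt Q a) * D (qt Q a)) = 1.
  have := congr1 (fun z : int => z%:~R : rat) hx; rewrite /euler rmorphB !rmorph_sum /=.
  move=> h; apply: (etrans _ h); congr (_ - _); apply: eq_bigr => i _; rewrite rmorphM /= -!xy ?expr2 //.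
have sq : \sum_a D (qs Q a) * D (qt Q a) * (y (qs Q a) - y (qt Q a)) ^+ 2 <= 2.
  (* Expanding the squares gathers, at each vertex, the weighted degree sum of [sum_qadj].
     Subadditivity bounds it by 2 d_i, which turns the right-hand side into at most 2 <x, x>. *)
  have -> : \sum_a D (qs Q a) * D (qt Q a) * (y (qs Q a) - y (qt Q a)) ^+ 2 =
      \sum_i y i ^+ 2 * D i * (\sum_a ((qs Q a == i) * d (qt Q a) + (qt Q a == i) * d (qs Q a)))%N%:R
      - 2 * \sum_a (y (qs Q a) * D (qs Q a)) * (y (qt Q a) * D (qt Q a)).
    under [X in _ = X - _]eq_bigr => i _ do rewrite natr_sum mulr_sumr.
    rewrite exchange_big mulr_sumr -sumrB /=; apply: eq_bigr => b _.
    have pick z (F : 'I_(qn Q) -> rat) c : \sum_i F i * ((z == i)%:R * c) = F z * c.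
      rewrite (bigD1 z) //= eqxx mul1r big1 ?addr0 // => i.
      by rewrite eq_sym => /negbTE ->; rewrite mul0r mulr0.
    under [X in _ = X - _]eq_bigr => i _ do rewrite natrD !natrM mulrDr.
    rewrite big_split /= (pick _ (fun i => y i ^+ 2 * D i)) (pick _ (fun i => y i ^+ 2 * D i)).
    by rewrite -/(D _) -/(D _); ring.
  have e2 := congr1 ( *%R 2) q1; rewrite mulr1 in e2; rewrite -[X in _ <= X]e2.
  rewrite mulrBr lerD2r mulr_sumr; apply: ler_sum => i _.
  have : ((\sum_a ((qs Q a == i) * d (qt Q a) + (qt Q a == i) * d (qs Q a)))%N%:R : rat) <= 2 * D i.
    by rewrite -sum_qadj /D -natrM ler_nat.
  move=> /(ler_wpM2l (_ : 0 <= y i ^+ 2 * D i)) h; apply: le_trans (h _) _.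
    by rewrite mulr_ge0 ?sqr_ge0 // ltW.
  by rewrite le_eqVlt; apply/orP; left; apply/eqP; ring.
have : D (qs Q a) * D (qt Q a) * (y (qs Q a) - y (qt Q a)) ^+ 2 <= 2.
  apply: le_trans sq; rewrite (bigD1 a) //= lerDl; apply: sumr_ge0 => b _.
  by rewrite mulr_ge0 ?sqr_ge0 // mulr_ge0 ?ltW.
rewrite -!/(y _); move: (y _ - y _) => z; set e := D _ * D _ => h.
have e1 : 1 <= e by rewrite -[1]mulr1 ler_pM.
have z2 : z ^+ 2 <= 2.
  by apply: le_trans h; rewrite ler_peMl ?sqr_ge0.
(* The bound 2 is a rational weakening of the square root of 2. *)
by rewrite ler_norml; apply/andP; split; nra.
Qed.

Lemma euler_bound d v0 : connected_quiver Q -> subadditive d ->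
  exists B, forall x : 'I_(qn Q) -> nat,
    euler (fun i => (x i)%:Z) (fun i => (x i)%:Z) = 1 -> (x v0 <= 1)%N -> forall i, (x i <= B)%N.
Proof.
move=> [_ conn] sd; have [d0 _] := sd.
have H : forall i, exists b : nat, forall x : 'I_(qn Q) -> nat,
    euler (fun i => (x i)%:Z) (fun i => (x i)%:Z) = 1 -> (x v0 <= 1)%N -> (x i <= b)%N.
  move=> i; have /connectP[p hp ei] := conn v0 i.
  (* The ratio x/d is at most 1 at [v0] and grows by at most 2 along each edge of the path to
     [i]. *)
  exists (d i * (2 * size p + 1))%N => x qx x0.
  have ab := euler_arrow_bound sd qx.
  pose y i : rat := (x i)%:R / (d i)%:R.
  have y0 : y v0 <= 1.
    by rewrite ler_pdivrMr ?ltr0n // mul1r ler_nat (leq_trans x0).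
  have adj u v : (0 < qadj Q u v)%N -> y v <= y u + 2.
    rewrite /qadj -has_count => /hasP[a _ /orP[/andP[/eqP <- /eqP <-]|/andP[/eqP <- /eqP <-]]].
      by have := ab a; rewrite ler_norml -!/(y _) => /andP[h1 h2]; lra.
    by have := ab a; rewrite ler_norml -!/(y _) => /andP[h1 h2]; lra.
  have step : forall p u, path (fun x y => (0 < qadj Q x y)%N) u p -> y (last u p) <= y u + 2 * (size p)%:R.
    elim=> [|w s IH] u /=; first by move=> _; rewrite mulr0 addr0.
    case/andP=> /adj h1 /IH h2; rewrite -addn1 natrD; lra.
  have := step _ _ hp; rewrite -ei => h.
  have : y i <= 1 + 2 * (size p)%:R by lra.
  rewrite ler_pdivrMr ?ltr0n // => h'.
  by rewrite -(ler_nat rat) natrM natrD natrM mulrC [2 * _ + _]addrC.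
have [B hB] := fin_all_exists H.
exists (\sum_i B i)%N => x qx x0 i; apply: leq_trans (hB i x qx x0) _.
by rewrite (bigD1 i) //= leq_addr.
Qed.

End EulerBound.

(** * Subadditive functions on the Dynkin and Euclidean graphs *)

Section Graphs.

Definition wdeg (E : seq (nat * nat)) (d : nat -> nat) (u : nat) : nat :=
  sumn [seq ((e.1 == u) * d e.2 + (e.2 == u) * d e.1)%N | e <- E].

Lemma wdeg_cat E E' d u : wdeg (E ++ E') d u = (wdeg E d u + wdeg E' d u)%N.
Proof. by rewrite /wdeg map_cat sumn_cat. Qed.

(** It is only an inequality, as [wdeg] counts loops twice and includes neighbours outside the
    range. This is the direction that subadditivity needs. *)
Lemma sum_emult k E (d : nat -> nat) u : (\sum_(j < k) emult E u j * d j <= wdeg E d u)%N.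
Proof.
have pick (x : nat) : (\sum_(j < k) (x == j) * d j <= d x)%N.
  case: (ltnP x k) => hx.
    rewrite (bigD1 (Ordinal hx)) // big1 => [|j /eqP ne].
      by rewrite /= addn0; case: (_ == _); rewrite ?mul1n.
    by case: eqP => // e; case: ne; apply: val_inj.
  rewrite big1 // => j _; case: eqP => // e.
  by have := ltn_ord j; rewrite -e ltnNge hx.
elim: E => [|[p q] E IH]; first by rewrite big1.
rewrite /emult /= -/(emult E u _); under eq_bigr => j _ do rewrite mulnDl.
rewrite big_split /=; apply: leq_add; last exact: IH.
apply: (@leq_trans (\sum_(j < k) ((p == u) * ((q == j) * d j) + (q == u) * ((p == j) * d j)))).
  apply: leq_sum => j _; rewrite !mulnA -mulnDl leq_mul2r; apply/orP; right.
  by rewrite !xpair_eqE; case: (p == u); case: (q == u); case: (p == j); case: (q == j).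
by rewrite big_split -!big_distrr /=; apply: leq_add; rewrite leq_mul2l pick orbT.
Qed.

Lemma graph_subadditive (Q : quiver) k E (d : nat -> nat) : has_graph Q k E ->
  (forall u, u < k -> 0 < d u)%N -> (forall u, u < k -> wdeg E d u <= 2 * d u)%N ->
  exists d', @subadditive Q d'.
Proof.
move=> [ek [sigma [bs hs]]] d0 hd; exists (fun i => d (sigma i)); split.
  by move=> i; apply: d0; rewrite -ek.
move=> i; apply: leq_trans (hd (sigma i) _); last by rewrite -ek.
apply: leq_trans (sum_emult (qn Q) E d (sigma i)).
rewrite [X in (_ <= X)%N](reindex sigma) /=; last exact: onW_bij.
by apply: leq_sum => j _; rewrite hs.
Qed.

Lemma sumn_iota_pick n u (f : nat -> nat) :
  (sumn [seq (i == u) * f i | i <- iota 0 n] = (u < n) * f u)%N.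
Proof.
elim: n => // n IH; rewrite -addn1 iotaD map_cat sumn_cat IH /= addn0 add0n addn1 ltnS.
by case: (ltngtP u n) => [h|h|->]; rewrite ?mul0n ?mul1n ?add0n ?addn0 //; lia.
Qed.

Lemma wdeg_path m d u : wdeg (path_edges m) d u =
  ((u.+1 < m) * d u.+1 + (0 < u < m) * d u.-1)%N.
Proof.
rewrite /wdeg /path_edges -map_comp.
have -> : sumn [seq ((fun e : nat * nat => ((e.1 == u) * d e.2 + (e.2 == u) * d e.1)%N) \o (fun i => (i, i.+1))) i | i <- iota 0 m.-1] =
   (sumn [seq (i == u) * d i.+1 | i <- iota 0 m.-1] + sumn [seq (i.+1 == u) * d i | i <- iota 0 m.-1])%N.
  by elim: (iota _ _) => //= i s ->; rewrite addnACA.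
rewrite (sumn_iota_pick _ u (fun i => d i.+1)); congr (_ * _ + _)%N; first by lia.
case: u => [|u]; first by elim: (iota _ _).
rewrite (eq_map (g := fun i => (i == u) * d i)%N) // sumn_iota_pick /=.
by congr (_ * _)%N; lia.
Qed.

Lemma At_edgesE k : At_edges k = path_edges k.+1 ++ [:: (k, 0%N)].
Proof.
rewrite /At_edges /path_edges -[in LHS]addn1 iotaD map_cat /= add0n addn1 modnn; congr (_ ++ _).
by apply/eq_in_map => i; rewrite mem_iota add0n => /= hi; rewrite modn_small.
Qed.

(** On a Euclidean graph the weights are the minimal positive radical vector. A Dynkin graph takes
    the restriction of such a vector from a Euclidean graph containing it: the one of type A, D with
    one vertex range longer, and for E_6, E_7 and E_8 always the extended E_8. *)
Lemma exists_subadditive Q : dynkin Q \/ euclidean Q -> exists d, @subadditive Q d.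
Proof.
case=> [[k [[k1 h]|[[k4 h]|[hk h]]]]|[[k [k1 h]]|[[k [k4 h]]|[h|[h|h]]]]].
- apply: (graph_subadditive (d := fun=> 1%N) h) => // u hu.
  by rewrite wdeg_path; lia.
- apply: (graph_subadditive (d := fun u => if (u < k - 2)%N then 2%N else 1%N) h).
    by move=> u _; case: ifP.
  move=> u hu; rewrite wdeg_cat wdeg_path /wdeg /=.
  by repeat (case: ifP => ?); lia.
- move: hk h; rewrite !inE => /or3P[] /eqP ->.
  + by move/(graph_subadditive (d := nth 0 [:: 2; 4; 6; 5; 4; 3])%N); apply; do 6!case=> //.
  + by move/(graph_subadditive (d := nth 0 [:: 2; 4; 6; 5; 4; 3; 3])%N); apply; do 7!case=> //.
  + by move/(graph_subadditive (d := nth 0 [:: 2; 4; 6; 5; 4; 3; 2; 3])%N); apply; do 8!case=> //.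
- apply: (graph_subadditive (d := fun=> 1%N) h) => // u hu.
  by rewrite At_edgesE wdeg_cat wdeg_path /wdeg /=; lia.
- apply: (graph_subadditive (d := fun u => if (0 < u < k - 2)%N then 2%N else 1%N) h).
    by move=> u _; case: ifP.
  move=> u hu; rewrite wdeg_cat wdeg_path /wdeg /=.
  by repeat (case: ifP => ?); lia.
- by move: h => /(graph_subadditive (d := nth 0 [:: 1; 2; 3; 2; 1; 2; 1])%N); apply; do 7!case=> //.
- by move: h => /(graph_subadditive (d := nth 0 [:: 1; 2; 3; 4; 3; 2; 1; 2])%N); apply; do 8!case=> //.
- by move: h => /(graph_subadditive (d := nth 0 [:: 2; 4; 6; 5; 4; 3; 2; 1; 3])%N); apply; do 9!case=> //.
Qed.

End Graphs.

(** * Finiteness of the non-saturated tilting modules *)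

Lemma rigid_finite (K : closedFieldType) (Q : quiver) (B : nat) :
  exists Ls : seq (rep K Q), forall T : rep K Q, ext0 T T ->
    (forall v, (rdim T v <= B)%N) ->
    exists2 i, (i < size Ls)%N & iso T (nth (zero_rep K Q) Ls i).
Proof.
have H : forall d : {ffun 'I_(qn Q) -> 'I_B.+1}, exists R : rep K Q,
    forall T : rep K Q, ext0 T T -> (forall v, rdim T v = d v) -> iso T R.
  move=> d; case: (classic (exists T : rep K Q, ext0 T T /\ forall v, rdim T v = d v)) => [[R [rR eR]]|h].
    by exists R => T rT eT; apply: rigid_iso => // v; rewrite eT eR.
  by exists (zero_rep K Q) => T rT eT; case: h; exists T.
have [R hR] := fin_all_exists H.
exists [seq R d | d <- enum {ffun 'I_(qn Q) -> 'I_B.+1}] => T rT hT.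
pose d := [ffun v => inord (rdim T v) : 'I_B.+1].
have dE v : rdim T v = d v by rewrite ffunE inordK // ltnS.
have md : d \in enum {ffun 'I_(qn Q) -> 'I_B.+1} by rewrite mem_enum.
exists (index d (enum {ffun 'I_(qn Q) -> 'I_B.+1})); first by rewrite size_map index_mem.
by rewrite (nth_map d) ?index_mem // nth_index //; apply: hR.
Qed.

Theorem theorem5p4 (K : closedFieldType) (Q : quiver) :
  connected_quiver Q -> acyclic Q -> (dynkin Q \/ euclidean Q) ->
  forall T0 : rep K Q, basic_tilting T0 ->
  exists L : seq (rep K Q),
    forall T : rep K Q, same_component T0 T -> ~ saturated T ->
      exists2 i, (i < size L)%N & iso T (nth (zero_rep K Q) L i).
Proof.
move=> conn ac /exists_subadditive[d sd] T0 bT0; have n0 := conn.1.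
have [B hB] := fin_all_exists (fun v0 => euler_bound ac v0 conn sd).
(* There are [qn Q] summands, and each has coordinates at most [B v] for the vertex [v] where a
   complement vanishes; summing over [v] covers every choice of it. *)
have [Ls hLs] := rigid_finite K Q (qn Q * \sum_v B v).
exists Ls => T sc ns.
(* Both ends of an arrow are basic tilting, so the property spreads from [T0] over its component. *)
have bT : basic_tilting T.
  have tr : basic_tilting T0 <-> basic_tilting T.
    by elim: sc => [x y [bx [by_ _]]|x|x y _ [h1 h2]|x y z _ [h1 h2] _ [h3 h4]]; split; auto.
  exact: (tr.1 bT0).
have rT := basic_tilting_ext0 bT.
have /(basic_tiltingP ac)[L [e bL sL]] := bT.
have [i [v [hi hv]]] := nonsaturated_compl ac e bL sL n0 ns.
apply: hLs => // w; rewrite (iso_dim e) rdim_dsum_list; move: (brigid_spans_size bL sL) => sz.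
have -> : (qn Q * \sum_v B v = \sum_(j < size L) \sum_v B v)%N.
  by rewrite sum_nat_const card_ord sz.
apply: leq_sum => j _; have hj := ltn_ord j.
have h := hB v (rdim (nth (zero_rep K Q) L j)) (summand_euler bL hj)
  (rdim_le1_of_compl sL hi hv hj) w.
apply: leq_trans h _.
by rewrite (bigD1 v) //= leq_addr.
Qed.
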